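(* Let $\Gamma$ be a connective differential graded algebra over a commutative ring $k$ with $H^n(\Gamma)\neq 0$ for only finitely many integers $n$, and let $\mathcal{T}=\mathsf{D}(\Gamma)$. Then \[\mathcal{T}^{\mathsf{b}}_p=\mathsf{broad}_{\Sigma}(\mathsf{per}(\Gamma))=\mathsf{thick}(\mathsf{Add}(\Gamma))\quad\text{and}\quad \mathcal{T}^{\mathsf{b}}_i=\mathsf{broad}_{\Pi}(\mathsf{per}(\Gamma)^{*})=\mathsf{thick}(\mathsf{Prod}(\Gamma^{*})).\]
   Context: $\mathsf{D}(\Gamma)$ is the derived category of right dg $\Gamma$-modules; $\Gamma$ is connective if $H^n(\Gamma)=0$ for all $n>0$. Subcategories are full and closed under isomorphism. A thick subcategory is a triangulated subcategory closed under direct summands; $\mathsf{thick}(\mathcal{X})$ is the smallest one containing $\mathcal{X}$. $\mathsf{per}(\Gamma)=\mathsf{thick}(\Gamma)$ is the subcategory $\mathcal{T}^{\mathsf{c}}$ of compact objects of $\mathsf{D}(\Gamma)$. $\mathsf{Add}(x)$ (resp. $\mathsf{Prod}(x)$) consists of summands of coproducts (resp. products) of copies of $x$. $\mathsf{broad}_\Sigma(\mathcal{X})$ (resp. $\mathsf{broad}_\Pi(\mathcal{X})$) is the smallest thick subcategory containing $\mathcal{X}$ and closed under self-coproducts $x^{(I)}$ (resp. self-products $x^I$) for all sets $I$. For a compact object $t$, its Brown–Comenetz dual $t^*$ is the object representing $\mathrm{Hom}_{\mathbb{Z}}(\mathrm{Hom}_{\mathcal{T}}(t,-),\mathbb{Q}/\mathbb{Z})$;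 $\mathsf{per}(\Gamma)^*=\{t^*:t\in\mathsf{per}(\Gamma)\}$. For a class $\mathcal{X}$, $\mathcal{X}^{\leftrightarrow}$ (resp. ${}^{\leftrightarrow}\mathcal{X}$) is the subcategory of those $t$ such that for every $x\in\mathcal{X}$, $\mathrm{Hom}_{\mathcal{T}}(x,t[n])=0$ (resp. $\mathrm{Hom}_{\mathcal{T}}(t,x[n])=0$) for all but finitely many $n\in\mathbb{Z}$. Set $\mathcal{T}^{\mathsf{b}}=(\mathcal{T}^{\mathsf{c}})^{\leftrightarrow}$, $\mathcal{T}^{\mathsf{b}}_p={}^{\leftrightarrow}(\mathcal{T}^{\mathsf{b}})$, $\mathcal{T}^{\mathsf{b}}_i=(\mathcal{T}^{\mathsf{b}})^{\leftrightarrow}$. *)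

(* Defs.v *)
From HB Require Import structures.
From mathcomp Require Import all_boot all_order all_algebra.
From mathcomp Require Import zify.

Set Implicit Arguments.
Unset Strict Implicit.
Unset Printing Implicit Defensive.

Import Order.TTheory GRing.Theory Num.Theory.
Local Open Scope ring_scope.

Definition ksign (k : comPzRingType) (n : int) : k := (-1) ^+ `|n|%N.

(* Grading is cohomological.  Structure maps carry the degree equation they
   rely on as an argument (int has unique identity proofs), so that the axioms
   are stated without casts between equal degrees. *)
Record dgalg (k : comPzRingType) := DGAlg {
  dga_sort :> int -> lmodType k;
  dga_d : forall i j : int, i + 1 = j -> dga_sort i -> dga_sort j;
  dga_mul : forall i j l : int, i + j = l ->
    dga_sort i -> dga_sort j -> dga_sort l;
  dga_one : dga_sort 0;
  dga_d_linear : forall i j (e : i + 1 = j), linear (dga_d e);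
  dga_mul_linearl : forall i j l (e : i + j = l) (b : dga_sort j),
    linear (fun a : dga_sort i => dga_mul e a b);
  dga_mul_linearr : forall i j l (e : i + j = l) (a : dga_sort i),
    linear (fun b : dga_sort j => dga_mul e a b);
  dga_mul1l : forall i (e : 0 + i = i) (a : dga_sort i), dga_mul e dga_one a = a;
  dga_mul1r : forall i (e : i + 0 = i) (a : dga_sort i), dga_mul e a dga_one = a;
  dga_mulA : forall h i j hi ij hij
    (e1 : h + i = hi) (e2 : hi + j = hij) (e3 : i + j = ij) (e4 : h + ij = hij)
    (a : dga_sort h) (b : dga_sort i) (c : dga_sort j),
    dga_mul e2 (dga_mul e1 a b) c = dga_mul e4 a (dga_mul e3 b c);
  dga_dd : forall i j l (e : i + 1 = j) (e' : j + 1 = l) (a : dga_sort i),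
    dga_d e' (dga_d e a) = 0;
  dga_leibniz : forall i j l i1 j1 l1
    (e : i + j = l) (el : l + 1 = l1) (ei : i + 1 = i1) (ej : j + 1 = j1)
    (e1 : i1 + j = l1) (e2 : i + j1 = l1) (a : dga_sort i) (b : dga_sort j),
    dga_d el (dga_mul e a b) =
      dga_mul e1 (dga_d ei a) b + ksign k i *: dga_mul e2 a (dga_d ej b)
}.

(* Right dg modules. *)
Record dgmod (k : comPzRingType) (A : dgalg k) := DGMod {
  dgm_sort :> int -> lmodType k;
  dgm_d : forall i j : int, i + 1 = j -> dgm_sort i -> dgm_sort j;
  dgm_act : forall i j l : int, i + j = l -> dgm_sort i -> A j -> dgm_sort l;
  dgm_d_linear : forall i j (e : i + 1 = j), linear (dgm_d e);
  dgm_act_linearl : forall i j l (e : i + j = l) (a : A j),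
    linear (fun x : dgm_sort i => dgm_act e x a);
  dgm_act_linearr : forall i j l (e : i + j = l) (x : dgm_sort i),
    linear (fun a : A j => dgm_act e x a);
  dgm_act1 : forall i (e : i + 0 = i) (x : dgm_sort i),
    dgm_act e x (dga_one A) = x;
  dgm_actA : forall h i j hi ij hij
    (e1 : h + i = hi) (e2 : hi + j = hij) (e3 : i + j = ij) (e4 : h + ij = hij)
    (x : dgm_sort h) (a : A i) (b : A j),
    dgm_act e2 (dgm_act e1 x a) b = dgm_act e4 x (dga_mul e3 a b);
  dgm_dd : forall i j l (e : i + 1 = j) (e' : j + 1 = l) (x : dgm_sort i),
    dgm_d e' (dgm_d e x) = 0;
  dgm_leibniz : forall i j l i1 j1 l1
    (e : i + j = l) (el : l + 1 = l1) (ei : i + 1 = i1) (ej : j + 1 = j1)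
    (e1 : i1 + j = l1) (e2 : i + j1 = l1) (x : dgm_sort i) (a : A j),
    dgm_d el (dgm_act e x a) =
      dgm_act e1 (dgm_d ei x) a + ksign k i *: dgm_act e2 x (dga_d ej a)
}.

Section IsLinear.
Variables (k : pzRingType) (U V : lmodType k) (f : U -> V).
Hypothesis fL : linear f.

Lemma is_linear0 : f 0 = 0.
Proof. by have := fL (-1) 0 0; rewrite scaleN1r addNr scaleN1r addNr. Qed.

Lemma is_linearD : {morph f : x y / x + y}.
Proof. by move=> x y; have := fL 1 x y; rewrite !scale1r. Qed.

Lemma is_linearZ c : {morph f : x / c *: x}.
Proof. by move=> x; have := fL c x 0; rewrite is_linear0 !addr0. Qed.

Lemma is_linearN : {morph f : x / - x}.
Proof. by move=> x; rewrite -!scaleN1r is_linearZ. Qed.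

End IsLinear.

Lemma shift_deg1 (n i j : int) : i + 1 = j -> i + n + 1 = j + n.
Proof. by move=> <-; rewrite addrAC. Qed.

Lemma shift_deg (n i j l : int) : i + j = l -> i + n + j = l + n.
Proof. by move=> <-; rewrite addrAC. Qed.

Lemma ksignD (k : comPzRingType) (i n : int) :
  ksign k (i + n) = ksign k i * ksign k n.
Proof.
rewrite /ksign -exprD -signr_odd -[RHS]signr_odd oddD.
by have -> : odd `|(i + n)%R|%N = odd `|i|%N (+) odd `|n|%N by lia.
Qed.

Lemma ksignMK (k : comPzRingType) (i : int) : ksign k i * ksign k i = 1.
Proof. by rewrite /ksign -expr2 sqrr_sign. Qed.

Section DGModules.
Variables (k : comPzRingType) (A : dgalg k).
Implicit Types M N L : dgmod A.

Definition dgreg : dgmod A :=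
  DGMod (@dga_d_linear k A) (@dga_mul_linearl k A) (@dga_mul_linearr k A)
    (@dga_mul1r k A) (@dga_mulA k A) (@dga_dd k A) (@dga_leibniz k A).

Record dghom M N := DGHom {
  dgh_fun :> forall i : int, M i -> N i;
  dgh_linear : forall i, linear (@dgh_fun i);
  dgh_d : forall i j (e : i + 1 = j) (x : M i),
    dgh_fun (dgm_d e x) = dgm_d e (dgh_fun x);
  dgh_act : forall i j l (e : i + j = l) (x : M i) (a : A j),
    dgh_fun (dgm_act e x a) = dgm_act e (dgh_fun x) a
}.
Arguments dgh_fun {M N} _ i _.

Definition dghom_id M : dghom M M.
Proof. by exists (fun i x => x). Defined.

Definition dghom_comp M N L (g : dghom N L) (f : dghom M N) : dghom M L.
Proof.
exists (fun i x => g i (f i x)).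
- by move=> i c x y; rewrite !dgh_linear.
- by move=> i j e x; rewrite !dgh_d.
- by move=> i j l e x a; rewrite !dgh_act.
Defined.

Definition dghom_zero M N : dghom M N.
Proof.
exists (fun i _ => 0).
- by move=> i c x y; rewrite scaler0 addr0.
- by move=> i j e x; rewrite (is_linear0 (@dgm_d_linear _ _ N i j e)).
- by move=> i j l e x a; rewrite (is_linear0 (@dgm_act_linearl _ _ N i j l e a)).
Defined.

Definition dghom_add M N (f g : dghom M N) : dghom M N.
Proof.
exists (fun i x => f i x + g i x).
- by move=> i c x y; rewrite !dgh_linear scalerDr addrACA.
- by move=> i j e x; rewrite !dgh_d (is_linearD (@dgm_d_linear _ _ N i j e)).
- by move=> i j l e x a; rewrite !dgh_act
    (is_linearD (@dgm_act_linearl _ _ N i j l e a)).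
Defined.

Definition dghom_opp M N (f : dghom M N) : dghom M N.
Proof.
exists (fun i x => - f i x).
- by move=> i c x y; rewrite !dgh_linear opprD scalerN.
- by move=> i j e x; rewrite !dgh_d (is_linearN (@dgm_d_linear _ _ N i j e)).
- by move=> i j l e x a; rewrite !dgh_act
    (is_linearN (@dgm_act_linearl _ _ N i j l e a)).
Defined.

Definition homotopic M N (f g : dghom M N) : Prop :=
  exists h : forall i j, j + 1 = i -> M i -> N j,
  [/\ forall i j (e : j + 1 = i), linear (h i j e),
      forall i j i' j' l (e : j + 1 = i) (e' : j' + 1 = i')
        (el : i + l = i') (el' : j + l = j') (x : M i) (a : A l),
        h i' j' e' (dgm_act el x a) = dgm_act el' (h i j e x) a
    & forall i j l (e : j + 1 = i) (e' : i + 1 = l) (x : M i),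
        f i x - g i x = dgm_d e (h i j e x) + h l i e' (dgm_d e' x)].

Definition cohom_zero_at M (n : int) : Prop :=
  forall m p (em : m + 1 = n) (ep : n + 1 = p) (x : M n),
    dgm_d ep x = 0 -> exists y : M m, x = dgm_d em y.

(* H^n(s) is injective and surjective for every n. *)
Definition quasi_iso M N (s : dghom M N) : Prop :=
  forall m n p (em : m + 1 = n) (ep : n + 1 = p),
    (forall (x : M n) (y : N m), dgm_d ep x = 0 -> s n x = dgm_d em y ->
       exists z : M m, x = dgm_d em z) /\
    (forall y : N n, dgm_d ep y = 0 ->
       exists (x : M n) (z : N m), dgm_d ep x = 0 /\ y = s n x + dgm_d em z).


Section Shift.
Variables (n : int) (M : dgmod A).

Definition dgshift_d i j (e : i + 1 = j) (x : M (i + n)) : M (j + n) :=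
  ksign k n *: dgm_d (shift_deg1 n e) x.

Definition dgshift_act i j l (e : i + j = l) (x : M (i + n)) (a : A j) : M (l + n) :=
  dgm_act (shift_deg n e) x a.

(* M[n]^i = M^(i + n), with d_{M[n]} = (-1)^n d_M and the same action. *)
Definition dgshift : dgmod A.
Proof.
exists (fun i => M (i + n)) dgshift_d dgshift_act.
- move=> i j e c x y.
  by rewrite /dgshift_d dgm_d_linear scalerDr !scalerA mulrC.
- by move=> i j l e a c x y; apply: dgm_act_linearl.
- by move=> i j l e x c a b; apply: dgm_act_linearr.
- by move=> i e x; apply: dgm_act1.
- by move=> *; apply: dgm_actA.
- move=> i j l e e' x.
  by rewrite /dgshift_d (is_linearZ (@dgm_d_linear _ _ M _ _ _)) dgm_dd !scaler0.
- move=> i j l i1 j1 l1 e el ei ej e1 e2 x a; rewrite /dgshift_d /dgshift_act.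
  rewrite (dgm_leibniz _ _ (shift_deg1 n ei) ej (shift_deg n e1) (shift_deg n e2)).
  rewrite scalerDr (is_linearZ (@dgm_act_linearl _ _ M _ _ _ _ _)) scalerA.
  by rewrite ksignD mulrCA ksignMK mulr1.
Defined.

End Shift.

Definition dghom_shift (n : int) M N (f : dghom M N) :
  dghom (dgshift n M) (dgshift n N).
Proof.
exists (fun i (x : M (i + n)) => f (i + n) x : dgshift n N i).
- by move=> i; exact: (@dgh_linear _ _ f (i + n)).
- move=> i j e x /=; rewrite (is_linearZ (@dgh_linear _ _ f _)).
  by rewrite dgh_d.
- by move=> i j l e x a; exact: (dgh_act f (shift_deg n e)).
Defined.

Lemma quasi_iso_shift (n : int) M N (s : dghom M N) :
  quasi_iso s -> quasi_iso (dghom_shift n s).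
Proof.
move=> qs i j l em ep.
have [inj surj] := qs _ _ _ (shift_deg1 n em) (shift_deg1 n ep).
have unsgn (V : lmodType k) (v w : V) : ksign k n *: v = w -> v = ksign k n *: w.
  by move=> <-; rewrite scalerA ksignMK scale1r.
split=> [x y|y]; rewrite /= /dgshift_d.
  move=> /unsgn; rewrite scaler0 => dx.
  rewrite -(is_linearZ (@dgm_d_linear _ _ N _ _ _)) => /(inj _ _ dx)[z ->].
  exists (ksign k n *: z : M (i + n)) => /=.
  rewrite (is_linearZ (@dgm_d_linear _ _ M _ _ _)) scalerA.
  by rewrite ksignMK scale1r.
move=> /unsgn; rewrite scaler0 => /surj[x [z [dx ->]]].
exists x, (ksign k n *: z : N (i + n)); split=> /=.
  by rewrite dx scaler0.
by rewrite (is_linearZ (@dgm_d_linear _ _ N _ _ _)) scalerA ksignMK scale1r.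
Qed.

Section Cone.
Variables (M N : dgmod A) (f : dghom M N).

Definition dgcone_d i j (e : i + 1 = j) (x : N i * M (i + 1)) : N j * M (j + 1) :=
  match e in _ = l return (N l * M (l + 1)%R)%type with
  | erefl => (dgm_d erefl x.1 + f (i + 1) x.2, - dgm_d erefl x.2)
  end.

Definition dgcone_act i j l (e : i + j = l) (x : N i * M (i + 1)) (a : A j) :
    N l * M (l + 1) :=
  (dgm_act e x.1 a, dgm_act (shift_deg 1 e) x.2 a).

(* cone(f)^i = N^i (+) M^(i + 1), d (y, x) = (d y + f x, - d x). *)
Definition dgcone : dgmod A.
Proof.
exists (fun i => (N i * M (i + 1)%R)%type : lmodType k) dgcone_d dgcone_act.
- move=> i j; case: j / => c [y x] [y' x'] /=; congr (_, _) => /=.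
    by rewrite dgm_d_linear dgh_linear scalerDr addrACA.
  by rewrite dgm_d_linear opprD scalerN.
- by move=> i j l e a c [y x] [y' x']; rewrite /dgcone_act /= !dgm_act_linearl.
- by move=> i j l e [y x] c a b; rewrite /dgcone_act /= !dgm_act_linearr.
- move=> i e [y x]; rewrite /dgcone_act /= dgm_act1; congr (_, _).
  by rewrite dgm_act1.
- move=> h i j hi ij hij e1 e2 e3 e4 [y x] a b; rewrite /dgcone_act /=.
  by congr (_, _); apply: dgm_actA.
- move=> i j l; case: j /; case: l / => [[y x]] /=.
  rewrite (is_linearD (@dgm_d_linear _ _ N _ _ _)) dgm_dd add0r.
  rewrite (is_linearN (@dgh_linear _ _ f _)) dgh_d subrr.
  by rewrite (is_linearN (@dgm_d_linear _ _ M _ _ _)) dgm_dd !oppr0.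
- move=> i j l i1 j1 l1 e el ei; case: l1 / el; case: i1 / ei.
  move=> ej e1 e2 [y x] a; rewrite /dgcone_act /=; congr (_, _) => /=.
    rewrite (dgm_leibniz _ erefl erefl ej e1 e2) dgh_act.
    rewrite (is_linearD (@dgm_act_linearl _ _ N _ _ _ _ _)) addrAC.
    by rewrite (eq_irrelevance (shift_deg 1 e) e1).
  rewrite (dgm_leibniz _ erefl erefl ej (shift_deg 1 e1) (shift_deg 1 e2)).
  rewrite opprD (is_linearN (@dgm_act_linearl _ _ M _ _ _ _ _)).
  by rewrite -scaleNr ksignD /ksign expr1 mulrN1 opprK.
Defined.

Definition cone_in : dghom N dgcone.
Proof.
exists (fun i (y : N i) => (y, 0) : dgcone i).
- by move=> i c y y'; congr (_, _) => /=; rewrite scaler0 addr0.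
- move=> i j; case: j / => y /=.
  by rewrite (is_linear0 (@dgh_linear _ _ f _)) addr0
    (is_linear0 (@dgm_d_linear _ _ M _ _ _)) oppr0.
- move=> i j l e y a /=; rewrite /dgcone_act /=.
  by rewrite (is_linear0 (@dgm_act_linearl _ _ M _ _ _ _ _)).
Defined.

Definition cone_out : dghom dgcone (dgshift 1 M).
Proof.
exists (fun i (x : dgcone i) => x.2 : dgshift 1 M i).
- by [].
- move=> i j; case: j / => x /=.
  rewrite /dgshift_d /ksign expr1 scaleN1r; congr (- dgm_d _ _).
  exact: eq_irrelevance.
- by [].
Defined.

End Cone.

(* D(A) is the category of right dg A-modules up to homotopy with the
   quasi-isomorphisms formally inverted: morphisms are formal composites and
   sums of homotopy classes of dg maps and of inverses of quasi-isomorphisms,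
   modulo the congruence generated by the axioms of a preadditive category,
   functoriality and additivity of the localization, and s s^-1 = 1 = s^-1 s.
   (The localization of an additive category at a calculus of fractions is
   additive, so that adjoining sums does not change the morphisms.) *)
Inductive dmor : dgmod A -> dgmod A -> Type :=
| dloc M N of dghom M N : dmor M N
| dinv M N (s : dghom M N) of quasi_iso s : dmor N M
| dcomp M N L of dmor N L & dmor M N : dmor M L
| dadd M N of dmor M N & dmor M N : dmor M N.

Definition did M : dmor M M := dloc (dghom_id M).
Definition dzero M N : dmor M N := dloc (dghom_zero M N).
Definition dopp M N (f : dmor M N) : dmor M N :=
  dcomp (dloc (dghom_opp (dghom_id N))) f.

Inductive deq : forall M N, dmor M N -> dmor M N -> Prop :=
| deq_refl M N (f : dmor M N) : deq f f
| deq_sym M N (f g : dmor M N) : deq f g -> deq g f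
| deq_trans M N (f g h : dmor M N) : deq f g -> deq g h -> deq f h
| deq_comp M N L (g g' : dmor N L) (f f' : dmor M N) :
    deq g g' -> deq f f' -> deq (dcomp g f) (dcomp g' f')
| deq_add M N (f f' g g' : dmor M N) :
    deq f f' -> deq g g' -> deq (dadd f g) (dadd f' g')
| deq_compA M N L P (h : dmor L P) (g : dmor N L) (f : dmor M N) :
    deq (dcomp h (dcomp g f)) (dcomp (dcomp h g) f)
| deq_comp1l M N (f : dmor M N) : deq (dcomp (did N) f) f
| deq_comp1r M N (f : dmor M N) : deq (dcomp f (did M)) f
| deq_addA M N (f g h : dmor M N) :
    deq (dadd f (dadd g h)) (dadd (dadd f g) h)
| deq_addC M N (f g : dmor M N) : deq (dadd f g) (dadd g f)
| deq_add0 M N (f : dmor M N) : deq (dadd f (dzero M N)) f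
| deq_addN M N (f : dmor M N) : deq (dadd f (dopp f)) (dzero M N)
| deq_compDl M N L (g g' : dmor N L) (f : dmor M N) :
    deq (dcomp (dadd g g') f) (dadd (dcomp g f) (dcomp g' f))
| deq_compDr M N L (g : dmor N L) (f f' : dmor M N) :
    deq (dcomp g (dadd f f')) (dadd (dcomp g f) (dcomp g f'))
| deq_loc M N (f g : dghom M N) : homotopic f g -> deq (dloc f) (dloc g)
| deq_loc_comp M N L (g : dghom N L) (f : dghom M N) :
    deq (dloc (dghom_comp g f)) (dcomp (dloc g) (dloc f))
| deq_loc_add M N (f g : dghom M N) :
    deq (dloc (dghom_add f g)) (dadd (dloc f) (dloc g))
| deq_invl M N (s : dghom M N) (qs : quasi_iso s) :
    deq (dcomp (dinv qs) (dloc s)) (did M)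
| deq_invr M N (s : dghom M N) (qs : quasi_iso s) :
    deq (dcomp (dloc s) (dinv qs)) (did N).

Fixpoint dshift (n : int) M N (f : dmor M N) :
    dmor (dgshift n M) (dgshift n N) :=
  match f with
  | dloc _ _ f => dloc (dghom_shift n f)
  | dinv _ _ _ qs => dinv (quasi_iso_shift n qs)
  | dcomp _ _ _ g f => dcomp (dshift n g) (dshift n f)
  | dadd _ _ f g => dadd (dshift n f) (dshift n g)
  end.

Definition diso M N (f : dmor M N) : Prop :=
  exists g : dmor N M, deq (dcomp g f) (did M) /\ deq (dcomp f g) (did N).

(* Hom_{D(A)}(M, N) = 0 *)
Definition dhom_zero M N : Prop := forall f : dmor M N, deq f (dzero M N).

Definition distinguished M N L
    (u : dmor M N) (v : dmor N L) (w : dmor L (dgshift 1 M)) : Prop :=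
  exists (M' N' : dgmod A) (f : dghom M' N')
    (a : dmor M M') (b : dmor N N') (c : dmor L (dgcone f)),
  [/\ diso a, diso b & diso c] /\
  [/\ deq (dcomp b u) (dcomp (dloc f) a),
      deq (dcomp c v) (dcomp (dloc (cone_in f)) b)
    & deq (dcomp (dshift 1 a) w) (dcomp (dloc (cone_out f)) c)].

(* M is a direct summand of N: N is a biproduct of M and some M'. *)
Definition dsummand M N : Prop :=
  exists (M' : dgmod A) (i : dmor M N) (p : dmor N M)
    (i' : dmor M' N) (p' : dmor N M'),
  [/\ deq (dcomp p i) (did M), deq (dcomp p' i') (did M'),
      deq (dcomp p' i) (dzero M M'), deq (dcomp p i') (dzero M' M)
    & deq (dadd (dcomp i p) (dcomp i' p')) (did N)].

Section Limits.
Variables (I : Type) (X : I -> dgmod A) (C : dgmod A).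

Definition is_coproduct (inj : forall i, dmor (X i) C) : Prop :=
  forall (Y : dgmod A) (g : forall i, dmor (X i) Y),
    exists h : dmor C Y, (forall i, deq (dcomp h (inj i)) (g i)) /\
      forall h' : dmor C Y, (forall i, deq (dcomp h' (inj i)) (g i)) -> deq h' h.

Definition is_product (proj : forall i, dmor C (X i)) : Prop :=
  forall (Y : dgmod A) (g : forall i, dmor Y (X i)),
    exists h : dmor Y C, (forall i, deq (dcomp (proj i) h) (g i)) /\
      forall h' : dmor Y C, (forall i, deq (dcomp (proj i) h') (g i)) -> deq h' h.

End Limits.

(* The canonical map from the direct sum of the Hom(t, X i) to Hom(t, C) is
   surjective and injective, for every coproduct C of every family X. *)
Definition dcompact (t : dgmod A) : Prop :=
  forall (I : Type) (X : I -> dgmod A) (C : dgmod A)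
    (inj : forall i, dmor (X i) C), is_coproduct inj ->
  let sum (r : seq I) (g : forall i, dmor t (X i)) :=
    foldr (fun i h => dadd (dcomp (inj i) (g i)) h) (dzero t C) r in
  (forall f : dmor t C, exists (r : seq I) (g : forall i, dmor t (X i)),
     List.NoDup r /\ deq f (sum r g)) /\
  (forall (r : seq I) (g : forall i, dmor t (X i)), List.NoDup r ->
     deq (sum r g) (dzero t C) ->
     forall i, List.In i r -> deq (g i) (dzero t (X i))).

Definition subcat := dgmod A -> Prop.

Definition Add (M : dgmod A) : subcat := fun t =>
  exists (I : Type) (C : dgmod A) (inj : I -> dmor M C),
    is_coproduct inj /\ dsummand t C.

Definition Prod (M : dgmod A) : subcat := fun t =>
  exists (I : Type) (P : dgmod A) (proj : I -> dmor P M),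
    is_product proj /\ dsummand t P.

Definition is_thick (C : subcat) : Prop :=
  [/\ forall t, deq (did t) (dzero t t) -> C t,
      forall s t (f : dmor s t), diso f -> C s -> C t,
      forall n t, C t -> C (dgshift n t),
      forall M N L (u : dmor M N) (v : dmor N L) (w : dmor L (dgshift 1 M)),
        distinguished u v w -> C M -> C N -> C L
    & forall s t, dsummand s t -> C t -> C s].

Definition coproduct_closed (C : subcat) : Prop :=
  forall (I : Type) (M S : dgmod A) (inj : I -> dmor M S),
    is_coproduct inj -> C M -> C S.

Definition product_closed (C : subcat) : Prop :=
  forall (I : Type) (M P : dgmod A) (proj : I -> dmor P M),
    is_product proj -> C M -> C P.

Definition thick (X : subcat) : subcat := fun t =>
  forall C : subcat, is_thick C -> (forall x, X x -> C x) -> C t.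

Definition broad_sum (X : subcat) : subcat := fun t =>
  forall C : subcat, is_thick C -> coproduct_closed C ->
    (forall x, X x -> C x) -> C t.

Definition broad_prod (X : subcat) : subcat := fun t =>
  forall C : subcat, is_thick C -> product_closed C ->
    (forall x, X x -> C x) -> C t.

Definition per : subcat := thick (eq dgreg).

(* X^<-> *)
Definition bounded_right (X : subcat) : subcat := fun t =>
  forall x, X x ->
    exists r : seq int, forall n, n \notin r -> dhom_zero x (dgshift n t).

(* ^<->X *)
Definition bounded_left (X : subcat) : subcat := fun t =>
  forall x, X x ->
    exists r : seq int, forall n, n \notin r -> dhom_zero t (dgshift n x).

Definition Tb : subcat := bounded_right dcompact.
Definition Tbp : subcat := bounded_left Tb.
Definition Tbi : subcat := bounded_right Tb.

End DGModules.

Definition QZ : zmodType :=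
  Quotient.quot (GRing.ZmodClosed.clone rat (@Num.int_num_subdef rat) _).

Section Duality.
Variables (k : comPzRingType) (A : dgalg k).

(* Hom_Z(Hom_{D(A)}(s, t), Q/Z) *)
Record dchar (s t : dgmod A) := DChar {
  dchar_fun :> dmor s t -> QZ;
  dchar_deq : forall f g, deq f g -> dchar_fun f = dchar_fun g;
  dchar_add : forall f g, dchar_fun (dadd f g) = dchar_fun f + dchar_fun g
}.

(* t' represents the functor x |-> Hom_Z(Hom(t, x), Q/Z): eta is a natural
   isomorphism of abelian groups from Hom(x, t') to Hom_Z(Hom(t, x), Q/Z). *)
Definition bc_dual (t t' : dgmod A) : Prop :=
  exists eta : forall x, dmor x t' -> dchar t x,
  [/\ forall x (f f' : dmor x t'), deq f f' <-> eta x f =1 eta x f',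
      forall x (c : dchar t x), exists f : dmor x t', eta x f =1 c,
      forall x (f f' : dmor x t') g, eta x (dadd f f') g = eta x f g + eta x f' g
    & forall x y (h : dmor x y) (f : dmor y t') (g : dmor t x),
        eta x (dcomp f h) g = eta y f (dcomp h g)].

Definition duals (X : subcat A) : subcat A := fun t' =>
  exists2 t, X t & bc_dual t t'.

(* The dual of M is only determined up to isomorphism in D(A). *)
Definition Prod_dual (M : dgmod A) : subcat A := fun t =>
  exists2 M', bc_dual M M' & Prod M' t.

End Duality.

(* Main.v *)
From HB Require Import structures.
From Stdlib Require Import Setoid Morphisms.
Require Import Defs.
From mathcomp Require Import all_boot all_order all_algebra.
From mathcomp Require Import generic_quotient ring_quotient.
From mathcomp Require Import boolp classical_sets zify.

(** The objects of Tb are those with bounded cohomology: for Y bounded, the sum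
    of all shifts Y[n] is also their product, so that a map from a compact object
    to it has almost all components zero.

    Let t be in Tbp.  Testing t against the dual A^* shows that t is bounded, say
    with top degree m.  Killing the top cohomology repeatedly by cones of maps
    from free modules gives maps f_n : t -> s_n with cone(f_n) in thick(Add A)
    and s_n concentrated in degrees <= m - n.  As A is bounded, the amplitude of
    s_n is bounded independently of n, so the product Y of the s_n[m - n] is
    bounded, hence lies in Tb.  Since t is in Tbp, Hom(t, Y[n - m]) = 0 for large
    n, so f_n = 0 and t[1] is a direct summand of cone(f_n).

    The case of Tbi is dual, with characters of the lowest cohomology in place of
    cocycles in the top one, and products of copies of A^* in place of free
    modules; A^* represents Hom_Z(H^0(-), Q/Z) because Q/Z is injective. *)

Set Implicit Arguments.
Unset Strict Implicit.
Unset Printing Implicit Defensive.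

Import Order.TTheory GRing.Theory Num.Theory.
Local Open Scope ring_scope.

Arguments dgh_fun {k A M N} _ i _.

(** * Cocycles, homotopies and cones *)

Section Basics.
Variables (k : comPzRingType) (A : dgalg k).
Implicit Types M N L : dgmod A.

(** Morphisms of D(A) are formal words modulo a generated congruence, so an equality of words shows
    no homotopy by itself. A calculus of fractions is therefore built from cones: words act on
    fractions, the action respects [deq], and its value at an identity fraction is an honest
    homotopy. From this come Hom(A, X) = H^0(X), the description of products and coproducts of D(A)
    by degreewise ones, and the splitting of the cone of a zero map. Both hypotheses on A enter
    through the amplitude of the s_n. If W bounds the negative degrees of H(A), a free cell attached
    in degree j has cohomology only in [j - W, j]: connectivity protects the degrees already killed,
    and the lower end, once it leaves that of t, trails the top degree by W. The opposite inclusions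
    are formal: both bounded classes are thick and closed under the relevant powers, so it suffices
    to place A in the first and the duals of per(A) in the second. *)

Lemma dgm_dD M i j (e : i + 1 = j) : {morph @dgm_d k A M i j e : x y / x + y}.
Proof. exact: (is_linearD (dgm_d_linear e)). Qed.
Lemma dgm_dN M i j (e : i + 1 = j) : {morph @dgm_d k A M i j e : x / - x}.
Proof. exact: (is_linearN (dgm_d_linear e)). Qed.
Lemma dgm_d0 M i j (e : i + 1 = j) : @dgm_d k A M i j e 0 = 0.
Proof. exact: (is_linear0 (dgm_d_linear e)). Qed.
Lemma dgm_dB M i j (e : i + 1 = j) : {morph @dgm_d k A M i j e : x y / x - y}.
Proof. by move=> x y; rewrite dgm_dD dgm_dN. Qed.
Lemma dgm_dZ M i j (e : i + 1 = j) c : {morph @dgm_d k A M i j e : x / c *: x}.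
Proof. exact: (is_linearZ (dgm_d_linear e)). Qed.

Lemma dgh_funD M N (f : dghom M N) i : {morph f i : x y / x + y}.
Proof. exact: (is_linearD (@dgh_linear _ _ _ _ f i)). Qed.
Lemma dgh_funN M N (f : dghom M N) i : {morph f i : x / - x}.
Proof. exact: (is_linearN (@dgh_linear _ _ _ _ f i)). Qed.
Lemma dgh_fun0 M N (f : dghom M N) i : f i 0 = 0.
Proof. exact: (is_linear0 (@dgh_linear _ _ _ _ f i)). Qed.
Lemma dgh_funB M N (f : dghom M N) i : {morph f i : x y / x - y}.
Proof. by move=> x y; rewrite dgh_funD dgh_funN. Qed.

Lemma dgm_actDl M i j l (e : i + j = l) (a : A j) (x y : M i) :
  dgm_act e (x + y) a = dgm_act e x a + dgm_act e y a.
Proof. exact: (is_linearD (dgm_act_linearl e a)). Qed.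
Lemma dgm_actNl M i j l (e : i + j = l) (a : A j) (x : M i) :
  dgm_act e (- x) a = - dgm_act e x a.
Proof. exact: (is_linearN (dgm_act_linearl e a)). Qed.
Lemma dgm_act0l M i j l (e : i + j = l) (a : A j) :
  dgm_act e (0 : M i) a = 0.
Proof. exact: (is_linear0 (dgm_act_linearl e a)). Qed.
Lemma dgm_actBl M i j l (e : i + j = l) (a : A j) (x y : M i) :
  dgm_act e (x - y) a = dgm_act e x a - dgm_act e y a.
Proof. by rewrite dgm_actDl dgm_actNl. Qed.
Lemma dgm_actZl M i j l (e : i + j = l) c (a : A j) (x : M i) :
  dgm_act e (c *: x) a = c *: dgm_act e x a.
Proof. exact: (is_linearZ (dgm_act_linearl e a)). Qed.
Lemma dgm_actDr M i j l (e : i + j = l) (a b : A j) (x : M i) :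
  dgm_act e x (a + b) = dgm_act e x a + dgm_act e x b.
Proof. exact: (is_linearD (dgm_act_linearr e x)). Qed.
Lemma dgm_actZr M i j l (e : i + j = l) c (a : A j) (x : M i) :
  dgm_act e x (c *: a) = c *: dgm_act e x a.
Proof. exact: (is_linearZ (dgm_act_linearr e x)). Qed.

(** Presents a degree as a successor, so that the differential into it is taken along [erefl] and
    the differential of a cone computes. *)
Lemma degS (P : int -> Prop) : (forall m, P (m + 1)) -> forall n, P n.
Proof. by move=> PS n; rewrite -(subrK 1 n). Qed.

Definition cocyc M n (x : M n) := dgm_d (erefl (n + 1)) x = 0.
Definition bound M n (x : M n) :=
  exists m (e : m + 1 = n) (y : M m), x = dgm_d e y.

Lemma cocycE M n p (e : n + 1 = p) (x : M n) : cocyc x <-> dgm_d e x = 0.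
Proof. by case: p / e. Qed.

(** The source degree and its equation, quantified in [bound], are both determined because identity
    proofs in [int] are unique; any convenient presentation may thus be used. *)
Lemma boundE M m n (e : m + 1 = n) (x : M n) :
  bound x <-> exists y, x = dgm_d e y.
Proof.
split=> [[m' [e' [y ->]]]|[y ->]]; last by exists m, e, y.
have em : m' = m by lia.
by subst m'; exists y; rewrite (eq_irrelevance e e').
Qed.

Lemma boundS M m (x : M (m + 1)) :
  bound x <-> exists y : M m, x = dgm_d erefl y.
Proof. exact: boundE. Qed.

Lemma bound_d M m n (e : m + 1 = n) (y : M m) : bound (dgm_d e y).
Proof. by exists m, e, y. Qed.

Lemma bound0 M n : bound (0 : M n).
Proof. by exists (n - 1), (subrK 1 n), 0; rewrite dgm_d0. Qed.

Lemma boundN M n (x : M n) : bound x -> bound (- x).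
Proof. by case=> m [e [y ->]]; rewrite -dgm_dN; apply: bound_d. Qed.

Lemma boundD M n (x y : M n) : bound x -> bound y -> bound (x + y).
Proof.
case=> m [e [x' ->]] /(boundE e)[y' ->]; rewrite -dgm_dD; exact: bound_d.
Qed.

Lemma boundB M n (x y : M n) : bound x -> bound y -> bound (x - y).
Proof. by move=> bx /boundN; apply: boundD. Qed.

Lemma bound_cocyc M n (x : M n) : bound x -> cocyc x.
Proof. by case=> m [e [y ->]]; rewrite /cocyc dgm_dd. Qed.

Lemma cocyc0 M n : cocyc (0 : M n).
Proof. exact: dgm_d0. Qed.

Lemma cocycN M n (x : M n) : cocyc x -> cocyc (- x).
Proof. by rewrite /cocyc dgm_dN => ->; rewrite oppr0. Qed.

Lemma cocycD M n (x y : M n) : cocyc x -> cocyc y -> cocyc (x + y).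
Proof. by rewrite /cocyc dgm_dD => -> ->; rewrite addr0. Qed.

Lemma cocycB M n (x y : M n) : cocyc x -> cocyc y -> cocyc (x - y).
Proof. by move=> cx /cocycN; apply: cocycD. Qed.

Lemma dgh_cocyc M N (f : dghom M N) n (x : M n) : cocyc x -> cocyc (f n x).
Proof. by rewrite /cocyc -dgh_d => ->; rewrite dgh_fun0. Qed.

Lemma dgh_bound M N (f : dghom M N) n (x : M n) : bound x -> bound (f n x).
Proof. by case=> m [e [y ->]]; rewrite dgh_d; apply: bound_d. Qed.

Lemma cohom_zeroP M n :
  cohom_zero_at M n <-> forall x : M n, cocyc x -> bound x.
Proof.
split=> H; first by move=> x cx; apply/(boundE (subrK 1 n))/(H _ _ _ erefl).
by move=> m p em ep x /(cocycE ep) /H /(boundE em).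
Qed.

Definition acyclic M := forall n, cohom_zero_at M n.

Definition inj_at M N (s : dghom M N) n :=
  forall x : M n, cocyc x -> bound (s n x) -> bound x.
Definition surj_at M N (s : dghom M N) n :=
  forall y : N n, cocyc y -> exists2 x : M n, cocyc x & bound (y - s n x).

Lemma quasi_isoP M N (s : dghom M N) :
  quasi_iso s <-> forall n, inj_at s n /\ surj_at s n.
Proof.
split=> H.
  move=> n; have [Hi Hs] := H _ _ _ (subrK 1 n) erefl; split.
    by move=> x cx /(boundE (subrK 1 n))[y sxy]; apply/(boundE (subrK 1 n))/(Hi x y).
  move=> y /Hs[x [z [cx ->]]]; exists x => //.
  by rewrite addrAC subrr add0r; apply: bound_d.
move=> m n p em ep; have [Hi Hs] := H n; split.
  by move=> x y /cocycE cx sxy; apply/(boundE em)/Hi => //; rewrite sxy; apply: bound_d.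
move=> y /cocycE/Hs[x cx /(boundE em)[z yz]]; exists x, z; split.
  exact/cocycE.
by rewrite -yz addrC subrK.
Qed.

Lemma quasi_iso_inj M N (s : dghom M N) n (x : M n) :
  quasi_iso s -> cocyc x -> bound (s n x) -> bound x.
Proof. by move=> /quasi_isoP qs; apply: (qs n).1. Qed.

Lemma quasi_iso_surj M N (s : dghom M N) n (y : N n) :
  quasi_iso s -> cocyc y -> exists2 x : M n, cocyc x & bound (y - s n x).
Proof. by move=> /quasi_isoP qs; apply: (qs n).2. Qed.

Lemma quasi_iso_id M : quasi_iso (dghom_id M).
Proof.
apply/quasi_isoP => n; split=> [x//|y cy]; exists y => //=.
by rewrite subrr; apply: bound0.
Qed.

Lemma quasi_iso_comp M N L (g : dghom N L) (f : dghom M N) :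
  quasi_iso g -> quasi_iso f -> quasi_iso (dghom_comp g f).
Proof.
move=> qg qf; apply/quasi_isoP => n; split=> [x cx|z cz] /=.
  move=> /(quasi_iso_inj qg (dgh_cocyc _ cx)).
  exact: quasi_iso_inj.
have [y cy bzy] := quasi_iso_surj qg cz.
have [x cx byx] := quasi_iso_surj qf cy; exists x => //=.
rewrite -(subrKA (g n y)) -dgh_funB; apply: boundD => //.
exact: dgh_bound.
Qed.

Lemma quasi_iso_cancelr M N L (g : dghom N L) (f : dghom M N) :
  quasi_iso (dghom_comp g f) -> quasi_iso f -> quasi_iso g.
Proof.
move=> qgf qf; apply/quasi_isoP => n; split=> [y cy bgy|z cz] /=.
  have [x cx byx] := quasi_iso_surj qf cy.
  rewrite -(subrK (f n x) y); apply: boundD => //; apply: dgh_bound.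
  apply: quasi_iso_inj qgf cx _ => /=.
  rewrite -[f n x](subKr y) dgh_funB; apply: boundB => //.
  exact: dgh_bound.
have [x cx bzx] := quasi_iso_surj qgf cz.
by exists (f n x) => //; apply: dgh_cocyc.
Qed.

Lemma homotopic_eq M N (f g : dghom M N) :
  (forall i x, f i x = g i x) -> homotopic f g.
Proof.
move=> fg; exists (fun _ _ _ _ => 0); split.
- by move=> i j e c x y; rewrite scaler0 addr0.
- by move=> *; rewrite dgm_act0l.
- by move=> i j l e e' x; rewrite fg subrr dgm_d0 addr0.
Qed.

Lemma homotopic_refl M N (f : dghom M N) : homotopic f f.
Proof. exact: homotopic_eq. Qed.

Lemma homotopic_sym M N (f g : dghom M N) : homotopic f g -> homotopic g f.
Proof.
case=> h [hL hA hd]; exists (fun i j e x => - h i j e x); split.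
- by move=> i j e c x y; rewrite hL opprD scalerN.
- by move=> i j i' j' l e e' el el' x a; rewrite (hA _ _ _ _ _ e _ _ el') dgm_actNl.
- by move=> i j l e e' x; rewrite dgm_dN -opprD -hd opprB.
Qed.

Lemma homotopic_add M N (f f' g g' : dghom M N) :
  homotopic f g -> homotopic f' g' ->
  homotopic (dghom_add f f') (dghom_add g g').
Proof.
case=> h [hL hA hd] [h' [hL' hA' hd']].
exists (fun i j e x => h i j e x + h' i j e x); split.
- by move=> i j e c x y; rewrite hL hL' scalerDr addrACA.
- move=> i j i' j' l e e' el el' x a.
  by rewrite (hA _ _ _ _ _ e _ _ el') (hA' _ _ _ _ _ e _ _ el') dgm_actDl.
- move=> i j l e e' x /=.
  by rewrite dgm_dD addrACA -hd -hd' opprD addrACA.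
Qed.

Lemma homotopic_trans M N (f g h : dghom M N) :
  homotopic f g -> homotopic g h -> homotopic f h.
Proof.
case=> u [uL uA ud] [v [vL vA vd]].
exists (fun i j e x => u i j e x + v i j e x); split.
- by move=> i j e c x y; rewrite uL vL scalerDr addrACA.
- move=> i j i' j' l e e' el el' x a.
  by rewrite (uA _ _ _ _ _ e _ _ el') (vA _ _ _ _ _ e _ _ el') dgm_actDl.
- move=> i j l e e' x /=.
  by rewrite dgm_dD addrACA -ud -vd subrKA.
Qed.

Lemma homotopic_compr M N L (g g' : dghom N L) (f : dghom M N) :
  homotopic g g' -> homotopic (dghom_comp g f) (dghom_comp g' f).
Proof.
case=> h [hL hA hd]; exists (fun i j e x => h i j e (f i x)); split.
- by move=> i j e c x y; rewrite dgh_linear hL.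
- by move=> i j i' j' l e e' el el' x a; rewrite dgh_act (hA _ _ _ _ _ e _ _ el').
- by move=> i j l e e' x /=; rewrite dgh_d; apply: hd.
Qed.

Lemma homotopic_compl M N L (g : dghom N L) (f f' : dghom M N) :
  homotopic f f' -> homotopic (dghom_comp g f) (dghom_comp g f').
Proof.
case=> h [hL hA hd]; exists (fun i j e x => g j (h i j e x)); split.
- by move=> i j e c x y; rewrite hL dgh_linear.
- by move=> i j i' j' l e e' el el' x a; rewrite (hA _ _ _ _ _ e _ _ el') dgh_act.
- by move=> i j l e e' x /=; rewrite -dgh_funB (hd _ _ _ e e') dgh_funD dgh_d.
Qed.

Lemma homotopic_shift n M N (f g : dghom M N) :
  homotopic f g -> homotopic (dghom_shift n f) (dghom_shift n g).
Proof.
case=> h [hL hA hd].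
exists (fun i j e (x : M (i + n)) =>
  ksign k n *: h (i + n) (j + n) (shift_deg1 n e) x : dgshift n N j); split.
- by move=> i j e c x y; rewrite hL scalerDr !scalerA mulrC.
- move=> i j i' j' l e e' el el' x a /=; rewrite /dgshift_act.
  by rewrite (hA _ _ _ _ _ (shift_deg1 n e) _ _ (shift_deg n el')) dgm_actZl.
- move=> i j l e e' x /=; rewrite /dgshift_d dgm_dZ scalerA ksignMK scale1r.
  rewrite (is_linearZ (hL _ _ _)) scalerA ksignMK scale1r.
  exact: hd.
Qed.

Lemma homotopic_bound M N (f g : dghom M N) n (x : M n) :
  homotopic f g -> cocyc x -> bound (f n x - g n x).
Proof.
case=> h [hL hA hd] cx; rewrite (hd _ _ _ (subrK 1 n) erefl) cx.
by rewrite (is_linear0 (hL _ _ _)) addr0; apply: bound_d.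
Qed.

Lemma quasi_iso_homotopic M N (f g : dghom M N) :
  homotopic f g -> quasi_iso f -> quasi_iso g.
Proof.
move=> fg qf; apply/quasi_isoP => n; split=> [x cx bgx|y cy].
  apply: (quasi_iso_inj qf cx); rewrite -(subrK (g n x) (f n x)).
  by apply: boundD => //; apply: homotopic_bound.
have [x cx bx] := quasi_iso_surj qf cy; exists x => //.
by rewrite -(subrKA (f n x)); apply: boundD => //; apply: homotopic_bound.
Qed.

(** Degrees such as [i + b + a] and [i + (b + a)] are equal but not convertible, so iterated shifts
    can only be compared through a transport. *)
Definition dcast M i j (e : i = j) (x : M i) : M j :=
  eq_rect i (fun l => dgm_sort M l : Type) x j e.

Lemma dcast_id M i (e : i = i) (x : M i) : dcast e x = x.
Proof. by rewrite (eq_irrelevance e erefl). Qed.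

Lemma dcast_linear M i j (e : i = j) : linear (@dcast M i j e).
Proof. by case: j / e. Qed.

Lemma dcast_act M i j l i' l' (e : i + j = l) (ei : i = i') (el : l = l')
    (e' : i' + j = l') (x : M i) (a : A j) :
  dcast el (dgm_act e x a) = dgm_act e' (dcast ei x) a.
Proof. by case: i' / ei e'; case: l' / el => e'; rewrite (eq_irrelevance e e'). Qed.

Lemma dcast_d M i j i' j' (e : i + 1 = j) (ei : i = i') (ej : j = j')
    (e' : i' + 1 = j') (x : M i) :
  dcast ej (dgm_d e x) = dgm_d e' (dcast ei x).
Proof. by case: i' / ei e'; case: j' / ej => e'; rewrite (eq_irrelevance e e'). Qed.

Lemma dcast_trans M i j l (e : i = j) (e' : j = l) (e'' : i = l) (x : M i) :
  dcast e' (dcast e x) = dcast e'' x.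
Proof. by case: l / e' e''; case: j / e => e''; rewrite !dcast_id. Qed.

Lemma dcast_dgh M N (f : dghom M N) i j (e : i = j) (x : M i) :
  f j (dcast e x) = dcast e (f i x).
Proof. by case: j / e. Qed.

Lemma ksignK M i n (x : M i) : ksign k n *: (ksign k n *: x) = x.
Proof. by rewrite scalerA ksignMK scale1r. Qed.

Lemma shift_cocyc n M i (x : M (i + n)) : cocyc (x : dgshift n M i) <-> cocyc x.
Proof.
rewrite /cocyc /= /dgshift_d; split=> [/(congr1 ( *:%R (ksign k n)))|].
  by rewrite ksignK scaler0 => /cocycE.
by move/(cocycE (shift_deg1 n erefl)) => ->; rewrite scaler0.
Qed.

Lemma shift_bound n M i (x : M (i + n)) : bound (x : dgshift n M i) <-> bound x.
Proof.
split.
  by case=> m [e [y ->]]; rewrite /= /dgshift_d -dgm_dZ; apply: bound_d.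
move/(boundE (shift_deg1 n (subrK 1 i))) => [y ->].
exists (i - 1), (subrK 1 i), (ksign k n *: y).
by rewrite /= /dgshift_d dgm_dZ ksignK.
Qed.

Lemma cohom_zero_shift n M i :
  cohom_zero_at (dgshift n M) i <-> cohom_zero_at M (i + n).
Proof.
split=> /cohom_zeroP H; apply/cohom_zeroP => x cx.
  exact/shift_bound/H/shift_cocyc.
exact/shift_bound/H/shift_cocyc.
Qed.

Section Cone.
Variables (M N : dgmod A) (f : dghom M N).

(** The homotopy is the graded inclusion of [M] as second summand of the cone. *)
Lemma cone_in_null : homotopic (dghom_comp (cone_in f) f) (dghom_zero _ _).
Proof.
exists (fun i j e (x : M i) => ((0, dcast (esym e) x) : dgcone f j)); split.
- move=> i j e c x y; congr (_, _); first by rewrite /= scaler0 addr0.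
  exact: dcast_linear.
- move=> i j i' j' l e e' el el' x a /=.
  by rewrite /dgcone_act dgm_act0l; congr (_, _); apply: dcast_act.
- move=> i j l e e'; case: i / e e' => e'; case: l / e' => x /=.
  rewrite subr0 dgm_d0 add0r.
  by congr (_, _); rewrite /= ?addr0 // addNr.
Qed.

Lemma cone_cocyc n (y : N n) (x : M (n + 1)) :
  cocyc ((y, x) : dgcone f n) <->
  cocyc x /\ dgm_d erefl y + f _ x = 0.
Proof.
split; rewrite /cocyc /=; first by case=> -> /eqP; rewrite oppr_eq0 => /eqP ->.
by case=> -> ->; rewrite oppr0.
Qed.

Lemma cone_bound m (y : N (m + 1)) (x : M (m + 1 + 1)) :
  bound ((y, x) : dgcone f (m + 1)) <->
  exists (w : N m) (u : M (m + 1)),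
    y = dgm_d erefl w + f _ u /\ x = - dgm_d erefl u.
Proof.
split=> [/boundS[[w u] [-> ->]]|[w [u [-> ->]]]]; first by exists w, u.
by apply/boundS; exists (w, u).
Qed.

(** The long exact sequence in a single degree: injectivity of H^(n+1)(f) makes [x] a coboundary,
    after which surjectivity of H^n(f) corrects [y]. *)
Lemma cone_cohom_zero n :
  surj_at f n -> inj_at f (n + 1) -> cohom_zero_at (dgcone f) n.
Proof.
move: n; apply: degS => m sf fi; apply/cohom_zeroP => -[y x].
move=> /cone_cocyc[cx dyx]; apply/cone_bound.
have /boundS[x' xx'] : bound x.
  apply: fi cx _; rewrite -[f _ x](addKr (dgm_d erefl y)) dyx addr0.
  exact/boundN/bound_d.
have [|x'' cx'' /boundS[w yw]] := sf (y + f _ x').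
  by rewrite /cocyc dgm_dD -dgh_d -xx'.
exists w, (x'' - x'); split.
  by rewrite -yw dgh_funB subrKA addrK.
by rewrite dgm_dB cx'' sub0r opprK.
Qed.

Lemma cone_acyclic : quasi_iso f -> acyclic (dgcone f).
Proof.
by move=> /quasi_isoP qf n; apply: cone_cohom_zero; [case: (qf n)|case: (qf (n+1))].
Qed.

Lemma cone_in_quasi_iso : acyclic M -> quasi_iso (cone_in f).
Proof.
move=> aM; apply/quasi_isoP; apply: degS => m; split=> /=.
  move=> y cy /cone_bound[w [u [-> /esym/eqP]]].
  rewrite oppr_eq0 => /eqP cu.
  apply: boundD; [exact: bound_d|apply: dgh_bound].
  by have /cohom_zeroP := aM (m + 1); apply.
move=> [y x] /cone_cocyc[cx dyx].
have /boundS[x' xx'] : bound x by have /cohom_zeroP := aM (m + 1 + 1); apply.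
exists (y + f _ x'); first by rewrite /cocyc dgm_dD -dgh_d -xx'.
apply/boundS; exists (0, - x') => /=; congr (_, _) => /=.
  by rewrite dgm_d0 add0r dgh_funN opprD addNKr.
by rewrite subr0 dgm_dN opprK.
Qed.

Lemma cone_out_quasi_iso : acyclic N -> quasi_iso (cone_out f).
Proof.
move=> aN; apply/quasi_isoP; apply: degS => m; split=> /=.
  move=> [y x] /cone_cocyc[cx dyx] /= /shift_bound/boundS[x' xx'].
  have /boundS[w yw] : bound (y + f _ x').
    have /cohom_zeroP := aN (m + 1); apply.
    by rewrite /cocyc dgm_dD -dgh_d -xx'.
  apply/cone_bound; exists w, (- x').
  by rewrite -yw dgh_funN addrK dgm_dN opprK.
move=> x /shift_cocyc cx.
have /boundS[w xw] : bound (f _ x).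
  have /cohom_zeroP := aN (m + 1 + 1); apply.
  exact: dgh_cocyc.
exists (- w, x); last by rewrite subrr; apply: bound0.
by apply/cone_cocyc; rewrite dgm_dN -xw addNr.
Qed.

End Cone.

End Basics.

(** * Calculus of fractions *)

Section Fractions.
Variables (k : comPzRingType) (A : dgalg k).
Implicit Types M N L X Y Z : dgmod A.

(** A homotopy depends only on the difference of its two ends, so it can be reused for any other
    pair with the same difference. *)
Lemma homotopic_diff M N (f g f' g' : dghom M N) :
  (forall i x, f i x - g i x = f' i x - g' i x) ->
  homotopic f g -> homotopic f' g'.
Proof.
move=> E [h [hL hA hd]]; exists h; split=> // i j l e e' x.
by rewrite -E; apply: hd.
Qed.

Section Sum.
Variables M N : dgmod A.

Definition dgsum_d i j (e : i + 1 = j) (x : M i * N i) : M j * N j :=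
  (dgm_d e x.1, dgm_d e x.2).
Definition dgsum_act i j l (e : i + j = l) (x : M i * N i) (a : A j) :
  M l * N l := (dgm_act e x.1 a, dgm_act e x.2 a).

Definition dgsum : dgmod A.
Proof.
exists (fun i => (M i * N i)%type : lmodType k) dgsum_d dgsum_act.
- by move=> i j e c x y; congr (_, _); rewrite /= dgm_dD dgm_dZ.
- by move=> i j l e a c x y; congr (_, _); rewrite /= dgm_actDl dgm_actZl.
- by move=> i j l e a c x y; congr (_, _); rewrite /= dgm_actDr dgm_actZr.
- by move=> i e [x y]; congr (_, _); rewrite /= dgm_act1.
- by move=> h i j hi ij hij e1 e2 e3 e4 x a b; congr (_, _); apply: dgm_actA.
- by move=> i j l e e' x; rewrite /dgsum_d /= !dgm_dd.
- move=> i j l i1 j1 l1 e el ei ej e1 e2 x a.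
  by congr (_, _); rewrite /= (dgm_leibniz e el ei ej e1 e2).
Defined.

Definition dghom_pair Y (f : dghom Y M) (g : dghom Y N) : dghom Y dgsum.
Proof.
exists (fun i y => (f i y, g i y) : dgsum i).
- by move=> i c x y; congr (_, _); rewrite /= dgh_linear.
- by move=> i j e x; congr (_, _); rewrite /= dgh_d.
- by move=> i j l e x a; congr (_, _); rewrite /= dgh_act.
Defined.

Definition dghom_inl : dghom M dgsum := dghom_pair (dghom_id M) (dghom_zero M N).
Definition dghom_inr : dghom N dgsum := dghom_pair (dghom_zero N M) (dghom_id N).

End Sum.

(* The homotopy pushout, i.e. the cone of (a, - b) : Y -> Z1 (+) Z2. *)
Lemma ore Y Z1 Z2 (a : dghom Y Z1) (b : dghom Y Z2) :
  quasi_iso a ->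
  exists Z (c : dghom Z1 Z) (d : dghom Z2 Z),
    quasi_iso d /\ homotopic (dghom_comp c a) (dghom_comp d b).
Proof.
move=> qa; pose f := dghom_pair a (dghom_opp b).
pose c := dghom_comp (cone_in f) (dghom_inl Z1 Z2).
pose d := dghom_comp (cone_in f) (dghom_inr Z1 Z2).
exists (dgcone f), c, d; split; last first.
  apply: homotopic_diff (cone_in_null f) => i y.
  rewrite subr0; congr (_, _) => /=; rewrite ?subr0 ?oppr0 ?addr0 //.
  by congr (_, _); rewrite /= ?subr0 ?sub0r.
apply/quasi_isoP; apply: degS => m; split=> /=.
  move=> z2 cz2 /(@cone_bound _ _ _ _ f)[[w1 w2] [u [[/= /esym/eqP]]]].
  rewrite addr_eq0 => /eqP dw1 -> /esym/eqP; rewrite oppr_eq0 => /eqP cu.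
  have /boundS[u' uu'] : bound u.
    apply: quasi_iso_inj qa cu _; rewrite -[a _ u]opprK -dw1.
    exact/boundN/bound_d.
  by rewrite /= uu' dgh_d -dgm_dN -dgm_dD; apply: bound_d.
move=> [[z1 z2] y] /(@cone_cocyc _ _ _ _ f)[cy [/= dz1 dz2]].
have /boundS[y' yy'] : bound y.
  apply: quasi_iso_inj qa cy _; rewrite -[a _ y](addKr (dgm_d erefl z1)) dz1.
  by rewrite addr0; apply/boundN/bound_d.
have [|y'' cy'' /boundS[w zw]] := quasi_iso_surj (y := z1 + a _ y') qa _.
  by rewrite /cocyc dgm_dD -dgh_d -yy'.
pose u := y'' - y'.
have du : dgm_d erefl u = - y by rewrite dgm_dB cy'' sub0r yy'.
exists (z2 + b _ u).
  by rewrite /cocyc dgm_dD -dgh_d du dgh_funN dz2.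
apply/(@cone_bound _ _ _ _ f); exists (w, 0), u; split; last first.
  by rewrite subr0 du opprK.
congr (_, _) => /=; rewrite ?dgm_d0 ?add0r ?subr0.
  by rewrite -zw dgh_funB subrKA addrK.
by rewrite opprD addrA subrr add0r.
Qed.

(** The null-homotopy of [u] after [f] supplies the component on the shifted copy of [M]. *)
Lemma cone_desc M N X (f : dghom M N) (u : dghom N X) :
  homotopic (dghom_comp u f) (dghom_zero M X) ->
  exists v : dghom (dgcone f) X, forall i y, v i (y, 0) = u i y.
Proof.
case=> h [hL hA hd].
unshelve eexists.
  exists (fun i (z : dgcone f i) => u i z.1 + h (i + 1) i erefl z.2).
  - move=> i c [y x] [y' x'] /=.
    by rewrite hL dgh_linear scalerDr addrACA.
  - move=> i j e; case: j / e => -[y x] /=.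
    rewrite dgm_dD dgh_funD dgh_d -addrA; congr (_ + _).
    rewrite (is_linearN (hL _ _ _)).
    have /= := hd _ _ _ erefl erefl x; rewrite subr0 => ->.
    by rewrite addrK.
  - move=> i j l e [y x] a /=.
    by rewrite dgh_act (hA _ _ _ _ _ erefl _ _ e) dgm_actDl.
by move=> i y /=; rewrite (is_linear0 (hL _ _ _)) addr0.
Qed.

(** [x] extends to a map [v] on the acyclic cone of [s]. Then [cone_in v] is a quasi-isomorphism
    that makes [v], hence [x], null-homotopic. *)
Lemma ore_cancel M N Y (s : dghom M N) (x : dghom N Y) :
  quasi_iso s -> homotopic (dghom_comp x s) (dghom_zero M Y) ->
  exists Z (l : dghom Y Z),
    quasi_iso l /\ homotopic (dghom_comp l x) (dghom_zero N Z).
Proof.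
move=> qs /cone_desc[v vx]; exists (dgcone v), (cone_in v); split.
  exact/cone_in_quasi_iso/cone_acyclic.
have := homotopic_compr (cone_in s) (cone_in_null v).
by apply: homotopic_diff => i y; rewrite /= vx.
Qed.

Lemma ore_cancel_eq M N Y (s : dghom M N) (x y : dghom N Y) :
  quasi_iso s -> homotopic (dghom_comp x s) (dghom_comp y s) ->
  exists Z (l : dghom Y Z),
    quasi_iso l /\ homotopic (dghom_comp l x) (dghom_comp l y).
Proof.
move=> qs xy; have [||Z [l [ql lxy]]] :=
  @ore_cancel _ _ _ s (dghom_add x (dghom_opp y)) => //.
  by apply: homotopic_diff xy => i z; rewrite /= subr0.
exists Z, l; split=> //; apply: homotopic_diff lxy => i z.
by rewrite /= subr0 dgh_funB.
Qed.

(** * Fractions into a fixed object *)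

Section Copoints.
Variable X : dgmod A.

(* A fraction [cp_den^-1 cp_num] from M to X. *)
Record copoint M := Copoint {
  cp_obj : dgmod A;
  cp_den : dghom X cp_obj;
  cp_qi : quasi_iso cp_den;
  cp_num : dghom M cp_obj
}.

Definition ceq M (p q : copoint M) : Prop :=
  exists Z (a : dghom (cp_obj p) Z) (b : dghom (cp_obj q) Z),
  [/\ quasi_iso a, quasi_iso b,
      homotopic (dghom_comp a (cp_den p)) (dghom_comp b (cp_den q))
    & homotopic (dghom_comp a (cp_num p)) (dghom_comp b (cp_num q))].

Lemma ceq_num M Y (l : dghom X Y) (ql ql' : quasi_iso l) (x x' : dghom M Y) :
  homotopic x x' -> ceq (Copoint ql x) (Copoint ql' x').
Proof.
move=> xx'; exists Y, (dghom_id Y), (dghom_id Y); split.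
- exact: quasi_iso_id.
- exact: quasi_iso_id.
- exact: homotopic_refl.
- exact: homotopic_compl.
Qed.

Lemma ceq_refl M (p : copoint M) : ceq p p.
Proof. by case: p => Y l ql x; apply: ceq_num; apply: homotopic_refl. Qed.

Lemma ceq_sym M (p q : copoint M) : ceq p q -> ceq q p.
Proof.
by case=> Z [a [b [qa qb e e']]]; exists Z, b, a; split=> //; apply: homotopic_sym.
Qed.

Lemma ceq_trans M (p q r : copoint M) : ceq p q -> ceq q r -> ceq p r.
Proof.
case=> Z [a [b [qa qb e e']]] [Z' [a' [b' [qa' qb' f f']]]].
have [W [c [d [qd cd]]]] := ore a' qb.
have qc : quasi_iso c.
  apply: (quasi_iso_cancelr _ qb); apply: quasi_iso_homotopic (homotopic_sym cd) _.
  exact: quasi_iso_comp.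
exists W, (dghom_comp c a), (dghom_comp d b'); split.
- exact: quasi_iso_comp.
- exact: quasi_iso_comp.
- apply: homotopic_trans (homotopic_compl c e) _.
  apply: homotopic_trans (homotopic_compr (cp_den q) cd) _.
  exact: (homotopic_compl d f).
- apply: homotopic_trans (homotopic_compl c e') _.
  apply: homotopic_trans (homotopic_compr (cp_num q) cd) _.
  exact: (homotopic_compl d f').
Qed.

Lemma ceq_refine M Y Z (c : dghom Y Z) (l : dghom X Y) (ql : quasi_iso l)
    (x : dghom M Y) (l' : dghom X Z) (ql' : quasi_iso l') (x' : dghom M Z) :
  quasi_iso c -> homotopic (dghom_comp c l) l' ->
  homotopic (dghom_comp c x) x' -> ceq (Copoint ql x) (Copoint ql' x').
Proof.
move=> qc cl cx; exists Z, c, (dghom_id Z); split=> //.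
exact: quasi_iso_id.
Qed.

Lemma ceq_same M Y (l : dghom X Y) (ql ql' : quasi_iso l) (x x' : dghom M Y) :
  ceq (Copoint ql x) (Copoint ql' x') ->
  exists Z (c : dghom Y Z),
    quasi_iso c /\ homotopic (dghom_comp c x) (dghom_comp c x').
Proof.
case=> Z [a [b /= [qa qb /(ore_cancel_eq ql)[W [t [qt tab]]] e]]].
exists W, (dghom_comp t a); split; first exact: quasi_iso_comp.
apply: homotopic_trans (homotopic_compl t e) _.
exact: homotopic_sym (homotopic_compr x' tab).
Qed.

Lemma ceq_common M N (p : copoint M) (q : copoint N) :
  exists Z (l : dghom X Z) (ql : quasi_iso l) x y,
    ceq p (Copoint ql x) /\ ceq q (Copoint ql y).
Proof.
case: p q => Y l ql x [Y' l' ql' x'].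
have [Z [c [d [qd cd]]]] := ore l' ql.
have qdl : quasi_iso (dghom_comp d l') by apply: quasi_iso_comp.
exists Z, (dghom_comp d l'), qdl, (dghom_comp c x), (dghom_comp d x'); split.
  apply: (@ceq_refine _ _ _ c) => //=; last exact: homotopic_refl.
  apply: (quasi_iso_cancelr _ ql).
  exact: quasi_iso_homotopic (homotopic_sym cd) _.
by apply: (@ceq_refine _ _ _ d) => //=; apply: homotopic_refl.
Qed.

Definition pull M N (f : dghom M N) (p : copoint N) : copoint M :=
  Copoint (cp_qi p) (dghom_comp (cp_num p) f).

Lemma pull_ceq M N (f : dghom M N) p q : ceq p q -> ceq (pull f p) (pull f q).
Proof.
case=> Z [a [b [qa qb e e']]]; exists Z, a, b; split=> //.
exact: (homotopic_compr f e').
Qed.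

Lemma pull_surj M N (s : dghom M N) (p : copoint M) :
  quasi_iso s -> exists q, ceq (pull s q) p.
Proof.
case: p => Y l ql x qs; have [Z [c [d [qd cd]]]] := ore x qs.
exists (Copoint (quasi_iso_comp qd ql) c); apply: ceq_sym.
apply: (@ceq_refine _ _ _ d) => //=; first exact: homotopic_refl.
exact: homotopic_sym.
Qed.

Lemma ceq_refine2 M Y Z (l : dghom X Y) (ql ql' : quasi_iso l) (x x' : dghom M Y)
    (c : dghom Y Z) :
  quasi_iso c -> homotopic (dghom_comp c x) (dghom_comp c x') ->
  ceq (Copoint ql x) (Copoint ql' x').
Proof.
move=> qc cxx'; exists Z, c, c; split=> //; exact: homotopic_refl.
Qed.

Lemma pull_inj M N (s : dghom M N) (p q : copoint N) :
  quasi_iso s -> ceq (pull s p) (pull s q) -> ceq p q.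
Proof.
move=> qs pq; have [Z [l [ql [x [y [px qy]]]]]] := ceq_common p q.
apply: (ceq_trans px (ceq_trans _ (ceq_sym qy))).
have : ceq (pull s (Copoint ql x)) (pull s (Copoint ql y)).
  apply: ceq_trans (pull_ceq s (ceq_sym px)) _.
  exact: ceq_trans pq (pull_ceq s qy).
case/ceq_same => W [c [qc]].
case/(@ore_cancel_eq _ _ _ s (dghom_comp c x) (dghom_comp c y) qs).
move=> V [t [qt txy]].
apply: (@ceq_refine2 _ _ V _ _ _ _ _ (dghom_comp t c)) => //.
exact: quasi_iso_comp.
Qed.

(** For a quasi-isomorphism [s], [pull s] is bijective on classes of fractions. The preimage is
    picked by choice, so it is meaningful only up to [ceq]. *)
Definition pinv M N (s : dghom M N) (qs : quasi_iso s) (p : copoint M) :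
  copoint N := projT1 (cid (pull_surj p qs)).

Lemma pinvK M N (s : dghom M N) (qs : quasi_iso s) p : ceq (pull s (pinv qs p)) p.
Proof. exact: projT2 (cid (pull_surj p qs)). Qed.

(** The sum is specified by its value over every common denominator at once, which makes it
    independent of the representatives. *)
Lemma padd_ex M (p q : copoint M) :
  exists r, forall Y (l : dghom X Y) (ql : quasi_iso l) x y,
    ceq p (Copoint ql x) -> ceq q (Copoint ql y) ->
    ceq r (Copoint ql (dghom_add x y)).
Proof.
have [Z [m [qm [u [v [pu qv]]]]]] := ceq_common p q.
exists (Copoint qm (dghom_add u v)) => Y l ql x y px qy.
have [W [c [d [qd cd]]]] := ore m ql.
have qc : quasi_iso c.
  apply: (quasi_iso_cancelr _ ql).
  apply: quasi_iso_homotopic (homotopic_sym cd) _.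
  exact: quasi_iso_comp.
have qdm : quasi_iso (dghom_comp d m) by apply: quasi_iso_comp.
have refc M' (z : dghom M' Y) :
    ceq (Copoint ql z) (Copoint qdm (dghom_comp c z)).
  by apply: (@ceq_refine _ _ _ c) => //=; apply: homotopic_refl.
have refd M' (z : dghom M' Z) :
    ceq (Copoint qm z) (Copoint qdm (dghom_comp d z)).
  by apply: (@ceq_refine _ _ _ d) => //=; apply: homotopic_refl.
have [T1 [t1 [qt1 e1]]] : exists T1 (t : dghom W T1), quasi_iso t /\
    homotopic (dghom_comp t (dghom_comp d u)) (dghom_comp t (dghom_comp c x)).
  apply: (@ceq_same _ _ _ qdm qdm).
  apply: ceq_trans (ceq_sym (refd _ u)) _.
  exact: ceq_trans (ceq_sym pu) (ceq_trans px (refc _ x)).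
have [T2 [t2 [qt2 e2]]] : exists T2 (t : dghom W T2), quasi_iso t /\
    homotopic (dghom_comp t (dghom_comp d v)) (dghom_comp t (dghom_comp c y)).
  apply: (@ceq_same _ _ _ qdm qdm).
  apply: ceq_trans (ceq_sym (refd _ v)) _.
  exact: ceq_trans (ceq_sym qv) (ceq_trans qy (refc _ y)).
(* [t1] identifies the two numerators of [p] and [t2] those of [q]; an Ore square over them gives a
   single map that does both. *)
have [T [s1 [s2 [qs2 s12]]]] := ore t2 qt1.
apply: ceq_trans (refd _ _) (ceq_trans _ (ceq_sym (refc _ _))).
apply: (@ceq_refine2 _ _ T _ _ _ _ _ (dghom_comp s2 t2)).
  exact: quasi_iso_comp.
have := homotopic_add
  (homotopic_trans (homotopic_sym (homotopic_compr (dghom_comp d u) s12))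
    (homotopic_trans (homotopic_compl s1 e1) (homotopic_compr (dghom_comp c x) s12)))
  (homotopic_compl s2 e2).
by apply: homotopic_diff => i z; rewrite /= !dgh_funD.
Qed.

Definition padd M (p q : copoint M) : copoint M := projT1 (cid (padd_ex p q)).

Lemma paddE M (p q : copoint M) Y (l : dghom X Y) (ql : quasi_iso l) x y :
  ceq p (Copoint ql x) -> ceq q (Copoint ql y) ->
  ceq (padd p q) (Copoint ql (dghom_add x y)).
Proof. exact: (projT2 (cid (padd_ex p q))). Qed.

Lemma padd_ceq M (p p' q q' : copoint M) :
  ceq p p' -> ceq q q' -> ceq (padd p q) (padd p' q').
Proof.
move=> pp' qq'; have [Z [l [ql [x [y [px qy]]]]]] := ceq_common p q.
apply: ceq_trans (paddE px qy) (ceq_sym (paddE _ _)).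
  exact: ceq_trans (ceq_sym pp') px.
exact: ceq_trans (ceq_sym qq') qy.
Qed.

Lemma paddC M (p q : copoint M) : ceq (padd p q) (padd q p).
Proof.
have [Z [l [ql [x [y [px qy]]]]]] := ceq_common p q.
apply: ceq_trans (paddE px qy) (ceq_trans _ (ceq_sym (paddE qy px))).
by apply: ceq_num; apply: homotopic_eq => i z /=; rewrite addrC.
Qed.

Lemma paddA M (p q r : copoint M) :
  ceq (padd p (padd q r)) (padd (padd p q) r).
Proof.
have [Y [m [qm [x [y [px qy]]]]]] := ceq_common p q.
case: r => Y' l' ql' z; have [Z [c [d [qd cd]]]] := ore l' qm.
have qdl : quasi_iso (dghom_comp d l') by apply: quasi_iso_comp.
have qc : quasi_iso c.
  by apply: (quasi_iso_cancelr _ qm); apply: quasi_iso_homotopic (homotopic_sym cd) _.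
have px' : ceq p (Copoint qdl (dghom_comp c x)).
  apply: (ceq_trans px); apply: (@ceq_refine _ _ _ c) => //=.
  exact: homotopic_refl.
have qy' : ceq q (Copoint qdl (dghom_comp c y)).
  apply: (ceq_trans qy); apply: (@ceq_refine _ _ _ c) => //=.
  exact: homotopic_refl.
have rz' : ceq (Copoint ql' z) (Copoint qdl (dghom_comp d z)).
  by apply: (@ceq_refine _ _ _ d) => //=; apply: homotopic_refl.
apply: ceq_trans (paddE px' (paddE qy' rz')) _.
apply: ceq_trans _ (ceq_sym (paddE (paddE px' qy') rz')).
by apply: ceq_num; apply: homotopic_eq => i v /=; rewrite addrA.
Qed.

End Copoints.
End Fractions.

(** * The action of morphisms of D(A) on fractions *)

Section Eval.
Variables (k : comPzRingType) (A : dgalg k).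
Implicit Types M N L X Y Z : dgmod A.

(* A morphism of D(A) acts on the fractions with target X; invariance of this
   action under [deq] is what makes equalities in D(A) detectable. *)
Fixpoint eval X M N (f : dmor M N) : copoint X N -> copoint X M :=
  match f with
  | dloc _ _ g => pull g
  | dinv _ _ _ qs => pinv qs
  | dcomp _ _ _ g f => fun p => eval f (eval g p)
  | dadd _ _ f g => fun p => padd (eval f p) (eval g p)
  end.

Lemma pinv_ceq X M N (s : dghom M N) (qs : quasi_iso s) (p : copoint X M) q :
  ceq (pull s q) p -> ceq (pinv qs p) q.
Proof.
by move=> qp; apply: (pull_inj qs); apply: ceq_trans (pinvK qs p) (ceq_sym qp).
Qed.

Lemma eval_ceq X M N (f : dmor M N) (p q : copoint X N) :
  ceq p q -> ceq (eval f p) (eval f q).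
Proof.
elim: f p q => {M N} [M N g|M N s qs|M N L g IHg f IHf|M N f IHf g IHg] p q pq /=.
- exact: pull_ceq.
- by apply: pinv_ceq; apply: ceq_trans (pinvK qs q) (ceq_sym pq).
- exact/IHf/IHg.
- by apply: padd_ceq; [apply: IHf|apply: IHg].
Qed.

Lemma pull_padd X M N (f : dghom M N) (p q : copoint X N) :
  ceq (pull f (padd p q)) (padd (pull f p) (pull f q)).
Proof.
have [Z [l [ql [x [y [px qy]]]]]] := ceq_common p q.
apply: ceq_trans (pull_ceq f (paddE px qy)) _.
apply: ceq_sym; apply: ceq_trans (paddE (pull_ceq f px) (pull_ceq f qy)) _.
by apply: ceq_num; apply: homotopic_eq.
Qed.

Lemma paddACA X M (p q r s : copoint X M) :
  ceq (padd (padd p q) (padd r s)) (padd (padd p r) (padd q s)).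
Proof.
apply: ceq_trans (ceq_sym (paddA _ _ _)) _.
apply: ceq_trans _ (paddA _ _ _); apply: padd_ceq; first exact: ceq_refl.
apply: ceq_trans (paddA _ _ _) _; apply: ceq_trans _ (ceq_sym (paddA _ _ _)).
by apply: padd_ceq; [apply: paddC|apply: ceq_refl].
Qed.

Lemma eval_padd X M N (f : dmor M N) (p q : copoint X N) :
  ceq (eval f (padd p q)) (padd (eval f p) (eval f q)).
Proof.
elim: f p q => {M N} [M N g|M N s qs|M N L g IHg f IHf|M N f IHf g IHg] p q /=.
- exact: pull_padd.
- apply: pinv_ceq; apply: ceq_trans (pull_padd _ _ _) _.
  by apply: padd_ceq; apply: pinvK.
- by apply: ceq_trans (eval_ceq _ (IHg _ _)) (IHf _ _).
- by apply: ceq_trans (padd_ceq (IHf _ _) (IHg _ _)) (paddACA _ _ _ _).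
Qed.

Definition pzero X M : copoint X M := Copoint (quasi_iso_id X) (dghom_zero M X).

Lemma pzeroE X M Y (l : dghom X Y) (ql : quasi_iso l) (x : dghom M Y) :
  homotopic x (dghom_zero M Y) -> ceq (Copoint ql x) (pzero X M).
Proof.
move=> x0; apply: ceq_sym; apply: (@ceq_refine _ _ _ _ _ _ l) => //.
  exact: homotopic_eq.
apply: homotopic_trans _ (homotopic_sym x0).
by apply: homotopic_eq => i z; rewrite /= dgh_fun0.
Qed.

Lemma eval_pzero X M N (f : dmor M N) : ceq (eval f (pzero X N)) (pzero X M).
Proof.
elim: f => {M N} [M N g|M N s qs|M N L g IHg f IHf|M N f IHf g IHg] /=.
- exact/pzeroE/homotopic_eq.
- exact/pinv_ceq/pzeroE/homotopic_eq.
- by apply: ceq_trans (eval_ceq _ IHg) IHf.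
- apply: ceq_trans (paddE IHf IHg) (pzeroE _ _).
  by apply: homotopic_eq => i z; rewrite /= addr0.
Qed.

(** Every generating relation of [deq] holds for the induced maps on classes of fractions. This
    turns a derivation of [deq] into a statement about dg maps. *)
Lemma eval_deq X M N (f g : dmor M N) (p : copoint X N) :
  deq f g -> ceq (eval f p) (eval g p).
Proof.
move=> fg; elim: fg p => {M N f g}.
- by move=> M N f p; apply: ceq_refl.
- by move=> M N f g _ IH p; apply: ceq_sym.
- by move=> M N f g h _ IH _ IH' p; apply: ceq_trans (IH p) (IH' p).
- move=> M N L g g' f f' _ IHg _ IHf p /=.
  by apply: ceq_trans (IHf _) (eval_ceq _ (IHg _)).
- by move=> M N f f' g g' _ IH _ IH' p /=; apply: padd_ceq.
- by move=> M N L P h g f p; apply: ceq_refl.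
- move=> M N f p /=; apply: eval_ceq; case: p => Y l ql x.
  by apply: ceq_num; apply: homotopic_eq.
- by move=> M N f p /=; case: (eval f p) => Y l ql x; apply/ceq_num/homotopic_eq.
- by move=> M N f g h p; apply: paddA.
- by move=> M N f g p; apply: paddC.
- move=> M N f p /=; case E: (eval f p) => [Y l ql x].
  have /= H := @paddE _ _ X M (Copoint ql x) (pull (dghom_zero M N) p) Y l ql x
    (dghom_zero M Y) (ceq_refl _).
  apply: ceq_trans (H _) _; last first.
    by apply: ceq_num; apply: homotopic_eq => i z; rewrite /= addr0.
  case: p {E H} => Y' l' ql' x'.
  apply: ceq_trans (pzeroE _ _) (ceq_sym (pzeroE _ _)); last exact: homotopic_refl.
  by apply: homotopic_eq => i z; rewrite /= dgh_fun0.
- move=> M N f p /=; apply: ceq_trans (ceq_sym (eval_padd _ _ _)) _.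
  case: p => Y l ql x.
  apply: ceq_trans (eval_ceq _ (paddE (ceq_refl _) (ceq_refl _))) _.
  apply: ceq_trans (eval_ceq _ (pzeroE _ _)) _.
    by apply: homotopic_eq => i z; rewrite /= dgh_funN subrr.
  apply: ceq_trans (eval_pzero _ _) (ceq_sym (pzeroE _ _)).
  by apply: homotopic_eq => i z; rewrite /= dgh_fun0.
- by move=> M N L g g' f p; apply: eval_padd.
- by move=> M N L g f f' p; apply: ceq_refl.
- by move=> M N f g fg [Y l ql x] /=; apply/ceq_num/homotopic_compl.
- by move=> M N L g f [Y l ql x]; apply/ceq_num/homotopic_eq.
- move=> M N f g [Y l ql x] /=.
  apply: ceq_trans _ (ceq_sym (paddE (ceq_refl _) (ceq_refl _))).
  by apply: ceq_num; apply: homotopic_eq => i z; rewrite /= dgh_funD.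
- move=> M N s qs p /=; apply: ceq_trans (pinvK _ _) (ceq_sym _).
  by case: p => Y l ql x; apply/ceq_num/homotopic_eq.
- move=> M N s qs p /=; apply: pinv_ceq.
  by case: p => Y l ql x; apply/ceq_num/homotopic_eq.
Qed.

(** On the identity fraction of [N] the two sides evaluate to fractions with denominator 1, and
    equality of these fractions is the asserted homotopy. *)
Lemma dloc_left M N (f g : dghom M N) : deq (dloc f) (dloc g) ->
  exists Z (l : dghom N Z),
    quasi_iso l /\ homotopic (dghom_comp l f) (dghom_comp l g).
Proof.
move=> fg; have /= := eval_deq (Copoint (quasi_iso_id N) (dghom_id N)) fg.
by move/ceq_same => [Z [l [ql lfg]]]; exists Z, l.
Qed.

End Eval.

#[export] Hint Resolve deq_refl : core.

#[export] Instance deq_equivalence (k : comPzRingType) (A : dgalg k)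
  (M N : dgmod A) : Equivalence (@deq k A M N).
Proof.
split; [exact: deq_refl|exact: deq_sym|move=> f g h; exact: deq_trans].
Qed.

#[export] Instance dcomp_proper (k : comPzRingType) (A : dgalg k)
  (M N L : dgmod A) : Proper (@deq k A N L ==> @deq k A M N ==> @deq k A M L)
    (@dcomp k A M N L).
Proof. by move=> g g' gg' f f' ff'; apply: deq_comp. Qed.

#[export] Instance dadd_proper (k : comPzRingType) (A : dgalg k)
  (M N : dgmod A) : Proper (@deq k A M N ==> @deq k A M N ==> @deq k A M N)
    (@dadd k A M N).
Proof. by move=> g g' gg' f f' ff'; apply: deq_add. Qed.

#[export] Instance dopp_proper (k : comPzRingType) (A : dgalg k)
  (M N : dgmod A) : Proper (@deq k A M N ==> @deq k A M N) (@dopp k A M N).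
Proof. by move=> f f' ff'; rewrite /dopp ff'. Qed.

Reserved Notation "g \oD f" (at level 40, left associativity).
Notation "f =D g" := (deq f g) (at level 70).
Notation "g \oD f" := (dcomp g f).
Notation "f +D g" := (dadd f g) (at level 50, left associativity).

(** * Morphisms of the derived category *)

Section DerivedHom.
Variables (k : comPzRingType) (A : dgalg k).
Implicit Types M N L X Y Z : dgmod A.

Lemma dcompA M N L X (h : dmor L X) (g : dmor N L) (f : dmor M N) :
  h \oD (g \oD f) =D h \oD g \oD f.
Proof. exact: deq_compA. Qed.

Lemma dadd0l M N (f : dmor M N) : dzero M N +D f =D f.
Proof. by rewrite deq_addC deq_add0. Qed.

Lemma dadd_idem M N (f : dmor M N) : f +D f =D f -> f =D dzero M N.
Proof.
by move=> ff; rewrite -(deq_add0 f) -{1}(deq_addN f) deq_addA ff deq_addN.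
Qed.

Lemma dcomp0l M N L (f : dmor M N) : dzero N L \oD f =D dzero M L.
Proof. by apply: dadd_idem; rewrite -deq_compDl deq_add0. Qed.

Lemma dcomp0r M N L (g : dmor N L) : g \oD dzero M N =D dzero M L.
Proof. by apply: dadd_idem; rewrite -deq_compDr deq_add0. Qed.

Lemma dopp_unique M N (f g : dmor M N) : f +D g =D dzero M N -> g =D dopp f.
Proof.
move=> fg; rewrite -(dadd0l g) -(deq_addN f) (deq_addC f) -deq_addA fg.
by rewrite deq_add0.
Qed.

Lemma dcompNr M N L (g : dmor N L) (f : dmor M N) :
  g \oD dopp f =D dopp (g \oD f).
Proof. by apply: dopp_unique; rewrite -deq_compDr deq_addN dcomp0r. Qed.

Lemma dcompNl M N L (g : dmor N L) (f : dmor M N) :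
  dopp g \oD f =D dopp (g \oD f).
Proof. by rewrite /dopp deq_compA. Qed.

Lemma dsub_eq0 M N (f g : dmor M N) : f +D dopp g =D dzero M N <-> f =D g.
Proof.
split=> [fg|->]; last exact: deq_addN.
rewrite -(deq_add0 f) -(deq_addN g) (deq_addC g) deq_addA fg.
exact: dadd0l.
Qed.

Lemma dloc_eq M N (f g : dghom M N) :
  (forall i x, f i x = g i x) -> dloc f =D dloc g.
Proof. by move=> fg; apply/deq_loc/homotopic_eq. Qed.

Lemma dinv_l M N L (s : dghom M N) (qs : quasi_iso s) (f : dmor L M) g :
  dloc s \oD f =D g <-> f =D dinv qs \oD g.
Proof.
by split=> [<-|->]; rewrite dcompA ?deq_invl ?deq_invr deq_comp1l.
Qed.

Lemma dinv_r M N L (s : dghom M N) (qs : quasi_iso s) (f : dmor N L) g :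
  f \oD dloc s =D g <-> f =D g \oD dinv qs.
Proof.
by split=> [<-|->]; rewrite -dcompA ?deq_invl ?deq_invr deq_comp1r.
Qed.

Lemma qiso_cancell M N L (s : dghom M N) (qs : quasi_iso s) (f g : dmor L M) :
  dloc s \oD f =D dloc s \oD g -> f =D g.
Proof. by move/(dinv_l qs) => ->; rewrite dcompA deq_invl deq_comp1l. Qed.

Lemma qiso_cancelr M N L (s : dghom M N) (qs : quasi_iso s) (f g : dmor N L) :
  f \oD dloc s =D g \oD dloc s -> f =D g.
Proof. by move/(dinv_r qs) => ->; rewrite -dcompA deq_invr deq_comp1r. Qed.

Lemma diso_qiso M N (s : dghom M N) : quasi_iso s -> diso (dloc s).
Proof. by move=> qs; exists (dinv qs); rewrite deq_invl deq_invr; split. Qed.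

Lemma diso_strict M N (f : dghom M N) (g : dghom N M) :
  (forall i x, g i (f i x) = x) -> (forall i y, f i (g i y) = y) ->
  diso (dloc f).
Proof.
move=> gf fg; exists (dloc g); rewrite -!deq_loc_comp.
by split; apply: dloc_eq.
Qed.

Lemma diso_id M : diso (did M).
Proof. by exists (did M); rewrite deq_comp1l. Qed.

Lemma diso_comp M N L (g : dmor N L) (f : dmor M N) :
  diso g -> diso f -> diso (g \oD f).
Proof.
case=> g' [g'g gg'] [f' [f'f ff']]; exists (f' \oD g'); split.
  by rewrite dcompA -(dcompA f') g'g deq_comp1r.
by rewrite dcompA -(dcompA g) ff' deq_comp1r.
Qed.

Lemma diso_cancell M N L (s : dmor M N) (f g : dmor L M) :
  diso s -> s \oD f =D s \oD g -> f =D g.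
Proof.
case=> t [ts st] e; rewrite -(deq_comp1l f) -ts -dcompA e dcompA ts.
exact: deq_comp1l.
Qed.

Lemma diso_cancelr M N L (s : dmor M N) (f g : dmor N L) :
  diso s -> f \oD s =D g \oD s -> f =D g.
Proof.
case=> t [ts st] e; rewrite -(deq_comp1r f) -st dcompA e -dcompA st.
exact: deq_comp1r.
Qed.

(** Induction on the word: an Ore square moves an inverse past a map in a composite, and supplies
    the common denominator of a sum. *)
Lemma left_fraction M N (f : dmor M N) :
  exists Y (l : dghom N Y) (x : dghom M Y),
    quasi_iso l /\ dloc l \oD f =D dloc x.
Proof.
elim: f => {M N} [M N g|M N s qs|M N L g [Y' [m [y [qm mg]]]] f [Y [l [x [ql lf]]]]
  |M N f [Y [l [x [ql lf]]]] g [Y' [m [y [qm mg]]]]].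
- exists N, (dghom_id N), g; split; first exact: quasi_iso_id.
  exact: deq_comp1l.
- exists N, s, (dghom_id N); split=> //; exact: deq_invr.
- have [Z [c [d [qd /deq_loc cd]]]] := ore y ql.
  exists Z, (dghom_comp d m), (dghom_comp c x); split; first exact: quasi_iso_comp.
  rewrite !deq_loc_comp -dcompA (dcompA _ g) mg dcompA.
  by rewrite !deq_loc_comp in cd; rewrite -cd -dcompA lf.
- have [Z [c [d [qd /deq_loc cd]]]] := ore m ql.
  exists Z, (dghom_comp d m), (dghom_add (dghom_comp c x) (dghom_comp d y)).
  split; first exact: quasi_iso_comp.
  rewrite deq_loc_add deq_compDr -{1}cd !deq_loc_comp -!dcompA lf.
  by rewrite mg.
Qed.

End DerivedHom.

(** * Shifts and right fractions *)

Section Shifts.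
Variables (k : comPzRingType) (A : dgalg k).
Implicit Types M N L X Y Z : dgmod A.

Lemma shift_merge_deg (a b c i : int) : b + a = c -> i + b + a = i + c.
Proof. by move=> <-; rewrite addrA. Qed.

Lemma ksign_shift a b c (V : lmodType k) (x : V) : b + a = c ->
  ksign k b *: (ksign k a *: x) = ksign k c *: x.
Proof. by move=> <-; rewrite scalerA ksignD. Qed.

Definition shift_merge a b c (e : b + a = c) M :
  dghom (dgshift b (dgshift a M)) (dgshift c M).
Proof.
exists (fun i (x : M (i + b + a)) => dcast (shift_merge_deg i e) x : dgshift c M i).
- by move=> i; exact: (@dcast_linear _ _ M _ _ (shift_merge_deg i e)).
- move=> i j e' x /=; rewrite /dgshift_d /= /dgshift_d (ksign_shift _ e).
  rewrite (is_linearZ (@dcast_linear _ _ M _ _ _)); congr (_ *: _).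
  exact: dcast_d.
- move=> i j l e' x y /=; exact: dcast_act.
Defined.

Definition shift_split a b c (e : b + a = c) M :
  dghom (dgshift c M) (dgshift b (dgshift a M)).
Proof.
exists (fun i (x : M (i + c)) =>
  dcast (esym (shift_merge_deg i e)) x : dgshift b (dgshift a M) i).
- by move=> i; exact: (@dcast_linear _ _ M _ _ (esym (shift_merge_deg i e))).
- move=> i j e' x /=; rewrite /dgshift_d /= /dgshift_d (ksign_shift _ e).
  rewrite (is_linearZ (@dcast_linear _ _ M _ _ _)); congr (_ *: _).
  exact: dcast_d.
- move=> i j l e' x y /=; exact: dcast_act.
Defined.

Lemma shift_mergeK a b c (e : b + a = c) M i x :
  shift_split e M i (shift_merge e M i x) = x.
Proof. by rewrite /= (dcast_trans _ _ erefl). Qed.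

Lemma shift_splitK a b c (e : b + a = c) M i x :
  shift_merge e M i (shift_split e M i x) = x.
Proof. by rewrite /= (dcast_trans _ _ erefl). Qed.

Definition unshift0 M : dghom (dgshift 0 M) M.
Proof.
exists (fun i (x : M (i + 0)) => dcast (addr0 i) x).
- by move=> i; exact: (@dcast_linear _ _ M _ _ (addr0 i)).
- move=> i j e x /=; rewrite /dgshift_d /ksign expr0 scale1r.
  exact: dcast_d.
- move=> i j l e x y /=; exact: dcast_act.
Defined.

Definition reshift0 M : dghom M (dgshift 0 M).
Proof.
exists (fun i (x : M i) => dcast (esym (addr0 i)) x : dgshift 0 M i).
- by move=> i; exact: (@dcast_linear _ _ M _ _ (esym (addr0 i))).
- move=> i j e x /=; rewrite /dgshift_d /ksign expr0 scale1r.
  exact: dcast_d.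
- move=> i j l e x y /=; exact: dcast_act.
Defined.

Lemma unshift0K M i x : reshift0 M i (unshift0 M i x) = x.
Proof. by rewrite /= (dcast_trans _ _ erefl). Qed.

Lemma reshift0K M i x : unshift0 M i (reshift0 M i x) = x.
Proof. by rewrite /= (dcast_trans _ _ erefl). Qed.

Definition unshift a b (e : b + a = 0) M : dghom (dgshift b (dgshift a M)) M :=
  dghom_comp (unshift0 M) (shift_merge e M).
Definition reshift a b (e : b + a = 0) M : dghom M (dgshift b (dgshift a M)) :=
  dghom_comp (shift_split e M) (reshift0 M).

Lemma unshiftK a b (e : b + a = 0) M i x : reshift e M i (unshift e M i x) = x.
Proof.
rewrite -[RHS](shift_mergeK e) -[X in _ = shift_split e M i X]unshift0K //.
Qed.

Lemma reshiftK a b (e : b + a = 0) M i x : unshift e M i (reshift e M i x) = x.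
Proof. by rewrite -[RHS]reshift0K -[X in _ = unshift0 M i X](shift_splitK e). Qed.

Lemma diso_merge a b c (e : b + a = c) M : diso (dloc (shift_merge e M)).
Proof. exact: (diso_strict (@shift_mergeK _ _ _ e M) (@shift_splitK _ _ _ e M)). Qed.
Lemma diso_split a b c (e : b + a = c) M : diso (dloc (shift_split e M)).
Proof. exact: (diso_strict (@shift_splitK _ _ _ e M) (@shift_mergeK _ _ _ e M)). Qed.
Lemma diso_unshift a b (e : b + a = 0) M : diso (dloc (unshift e M)).
Proof. exact: (diso_strict (@unshiftK _ _ e M) (@reshiftK _ _ e M)). Qed.
Lemma diso_reshift a b (e : b + a = 0) M : diso (dloc (reshift e M)).
Proof. exact: (diso_strict (@reshiftK _ _ e M) (@unshiftK _ _ e M)). Qed.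

Lemma unshift_dghom a b (e : b + a = 0) M N (f : dghom M N) i x :
  f i (unshift e M i x) = unshift e N i (dghom_shift b (dghom_shift a f) i x).
Proof. by rewrite /= !dcast_dgh. Qed.

Lemma quasi_iso_strict M N (f : dghom M N) (g : dghom N M) :
  (forall i x, g i (f i x) = x) -> (forall i y, f i (g i y) = y) ->
  quasi_iso f.
Proof.
move=> gf fg; apply/quasi_isoP => n; split=> [x cx|y cy].
  by move/(dgh_bound g); rewrite gf.
by exists (g n y); [apply: dgh_cocyc|rewrite fg subrr; apply: bound0].
Qed.

Lemma dshift_deq n M N (f g : dmor M N) : f =D g -> dshift n f =D dshift n g.
Proof.
elim=> {M N f g} /=.
- by [].
- by move=> M N f g _ ->.
- by move=> M N f g h _ -> _ ->.
- by move=> M N L g g' f f' _ -> _ ->.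
- by move=> M N f f' g g' _ -> _ ->.
- by move=> *; apply: deq_compA.
- by move=> M N f; rewrite -[X in _ =D X]deq_comp1l; apply: deq_comp => //; apply: dloc_eq.
- by move=> M N f; rewrite -[X in _ =D X]deq_comp1r; apply: deq_comp => //; apply: dloc_eq.
- by move=> *; apply: deq_addA.
- by move=> *; apply: deq_addC.
- move=> M N f; rewrite -[X in _ =D X]deq_add0; apply: deq_add => //.
  exact: dloc_eq.
- move=> M N f.
  have -> : dloc (dghom_shift n (dghom_opp (dghom_id N))) \oD dshift n f
      =D dopp (dshift n f).
    by apply: deq_comp => //; apply: dloc_eq.
  by rewrite deq_addN; apply: dloc_eq.
- by move=> *; apply: deq_compDl.
- by move=> *; apply: deq_compDr.
- by move=> M N f g fg; apply/deq_loc/homotopic_shift.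
- by move=> M N L g f; rewrite -deq_loc_comp; apply: dloc_eq.
- by move=> M N f g; rewrite -deq_loc_add; apply: dloc_eq.
- by move=> M N s qs; rewrite deq_invl; apply: dloc_eq.
- by move=> M N s qs; rewrite deq_invr; apply: dloc_eq.
Qed.

Lemma dshift_zero n M N : dshift n (dzero M N) =D dzero _ _.
Proof. exact: dloc_eq. Qed.

Lemma dshift_id n M : dshift n (did M) =D did _.
Proof. exact: dloc_eq. Qed.

Lemma diso_dshift n M N (f : dmor M N) : diso f -> diso (dshift n f).
Proof.
case=> g [gf fg]; exists (dshift n g).
by split; rewrite -(dshift_id n); [rewrite -(dshift_deq n gf)|rewrite -(dshift_deq n fg)].
Qed.

(** Naturality is checked on the generators of words; for a formal inverse it follows by cancelling
    the quasi-isomorphism on both sides. *)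
Lemma unshift_nat a b (e : b + a = 0) M N (f : dmor M N) :
  dloc (unshift e N) \oD dshift b (dshift a f) =D f \oD dloc (unshift e M).
Proof.
elim: f => {M N} [M N g|M N s qs|M N L g IHg f IHf|M N f IHf g IHg].
- rewrite -!deq_loc_comp; apply: dloc_eq => i x.
  by rewrite /= !dcast_dgh.
- apply: (qiso_cancell qs); rewrite !dcompA deq_invr deq_comp1l -deq_loc_comp.
  apply: (qiso_cancelr (quasi_iso_shift b (quasi_iso_shift a qs))).
  rewrite -dcompA deq_invl deq_comp1r -deq_loc_comp; apply: dloc_eq => i x.
  by rewrite /= !dcast_dgh.
- by rewrite /= dcompA IHg -dcompA IHf dcompA.
- by rewrite /= deq_compDr deq_compDl IHf IHg.
Qed.

Lemma dhom_zero_iso M N M' N' (a : dmor M M') (b : dmor N N') :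
  diso a -> diso b -> dhom_zero M N -> dhom_zero M' N'.
Proof.
move=> ia [b' [b'b bb']] z f; apply: (diso_cancelr ia).
by rewrite dcomp0l -(deq_comp1l f) -bb' -!dcompA (z (b' \oD _)) dcomp0r.
Qed.

(** Up to the natural isomorphism [unshift], a map between the shifts is the shift by [n] of its own
    shift by [- n], and the latter is essentially a map from [M] to [N]. *)
Lemma dhom_zero_shift n M N : dhom_zero M N -> dhom_zero (dgshift n M) (dgshift n N).
Proof.
move=> z f; have e : n + (- n) = 0 by rewrite subrr.
have e' : - n + n = 0 by rewrite addNr.
apply: (diso_cancelr (diso_unshift e (dgshift n M))).
rewrite dcomp0l -(unshift_nat e f).
have z' := dhom_zero_iso (diso_reshift e' M) (diso_reshift e' N) z.
by rewrite (dshift_deq n (z' (dshift (- n) f))) dshift_zero dcomp0r.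
Qed.

Lemma dhom_zero_adj n m M N : n + m = 0 ->
  dhom_zero M (dgshift n N) <-> dhom_zero (dgshift m M) N.
Proof.
move=> e; have e' : m + n = 0 by rewrite addrC.
split=> [/(@dhom_zero_shift m)|/(@dhom_zero_shift n)].
  exact: dhom_zero_iso (diso_id _) (diso_unshift _ _).
exact: dhom_zero_iso (diso_unshift _ _) (diso_id _).
Qed.

(** Cones produce maps into shifted objects. This lemma and the next move them back by one degree,
    so that cones also supply denominators on the source side. *)
Lemma homotopic_unshift W M N (f : dghom M N) (g : dghom W (dgshift 1 M)) :
  homotopic (dghom_comp (dghom_shift 1 f) g) (dghom_zero _ _) ->
  homotopic (dghom_comp f (dghom_comp (unshift (addNr 1) M) (dghom_shift (- 1) g)))
    (dghom_zero _ _).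
Proof.
move=> /(@homotopic_shift _ _ (- 1))/(homotopic_compl (unshift (addNr 1) N)).
apply: homotopic_diff => i x.
transitivity (f i (unshift (addNr 1) M i (dghom_shift (- 1) g i x)) - 0) => //.
by rewrite unshift_dghom; congr (_ - _); apply: dgh_fun0.
Qed.

Lemma quasi_iso_unshift W M (g : dghom W (dgshift 1 M)) : quasi_iso g ->
  quasi_iso (dghom_comp (unshift (addNr 1) M) (dghom_shift (- 1) g)).
Proof.
move=> qg; apply: quasi_iso_comp; last exact: quasi_iso_shift.
exact: (quasi_iso_strict (@unshiftK _ _ _ M) (@reshiftK _ _ _ M)).
Qed.

Lemma cone_out_null M N (f : dghom M N) :
  homotopic (dghom_comp (dghom_shift 1 f) (cone_out f)) (dghom_zero _ _).
Proof.
exists (fun i j e (z : dgcone f i) => dcast (esym e) z.1 : dgshift 1 N j); split.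
- by move=> i j e c x y; exact: (@dcast_linear _ _ N _ _ (esym e) c x.1 y.1).
- move=> i j i' j' l e e' el el' x a /=; exact: dcast_act.
- move=> i j l e e'; case: i / e e' => e'; case: l / e' => -[y x] /=.
  rewrite subr0 /dgshift_d /ksign expr1 scaleN1r.
  by rewrite (eq_irrelevance (shift_deg1 1 erefl) erefl) addKr.
Qed.

Lemma cone_lift M N L (f : dghom M N) (l : dghom N L) :
  homotopic (dghom_comp l f) (dghom_zero M L) ->
  exists v : dghom (dgshift 1 M) (dgcone l), forall i x, (v i x).2 = f (i + 1) x.
Proof.
case=> h [hL hA hd].
unshelve eexists.
  exists (fun i (x : M (i + 1)) => (- h (i + 1) i erefl x, f (i + 1) x) : dgcone l i).
  - move=> i c x y; congr (_, _); last exact: dgh_linear.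
    by rewrite /= hL opprD scalerN.
  - move=> i j e; case: j / e => x /=; rewrite /dgshift_d /ksign expr1 scaleN1r.
    rewrite (eq_irrelevance (shift_deg1 1 erefl) erefl).
    rewrite (is_linearN (hL _ _ _)) opprK dgh_funN dgh_d dgm_dN.
    congr (_, _); have /= := hd _ _ _ erefl erefl x.
    by rewrite subr0 => ->; rewrite addKr.
  - move=> i j m e x a /=; rewrite /dgshift_act dgh_act /dgcone_act /=.
    by rewrite (hA _ _ _ _ _ erefl _ _ e) dgm_actNl.
by [].
Qed.

(** The null-homotopy of [l] after [f] lifts [f] to a map [v] from M[1] to the acyclic cone of [l].
    So [cone_out v] is a quasi-isomorphism onto M[2], and f[2], which factors through v[1], becomes
    null-homotopic on it; two shifts back give [r]. *)
Lemma dloc_right0 M N (f : dghom M N) : dloc f =D dzero M N ->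
  exists M' (r : dghom M' M),
    quasi_iso r /\ homotopic (dghom_comp f r) (dghom_zero M' N).
Proof.
case/dloc_left => Y [l [ql lf]].
have [|v vf] := @cone_lift _ _ _ f l.
  by apply: homotopic_diff lf => i x; rewrite /= dgh_fun0.
have qv : quasi_iso (cone_out v) := cone_out_quasi_iso v (cone_acyclic ql).
exists _, (dghom_comp (unshift (addNr 1) M) (dghom_shift (- 1)
  (dghom_comp (unshift (addNr 1) (dgshift 1 M)) (dghom_shift (- 1) (cone_out v))))).
split; first by do 2!apply: quasi_iso_unshift.
apply: homotopic_unshift; apply: homotopic_unshift.
have := homotopic_compl (dghom_shift 1 (cone_out l)) (cone_out_null v).
by apply: homotopic_diff => i x /=; rewrite vf.
Qed.

(** Write f = l^-1 x. The map [g] ends in the acyclic cone of [l], so the cone of [g] is a model of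
    M[1], and its component in N[1] provides the numerator. *)
Lemma right_fraction M N (f : dmor M N) :
  exists M' (r : dghom M' M) (x : dghom M' N),
    quasi_iso r /\ f \oD dloc r =D dloc x.
Proof.
have [Y [l [x [ql lf]]]] := left_fraction f.
pose g := dghom_comp (cone_in l) x.
have qr : quasi_iso (cone_out g) := cone_out_quasi_iso g (cone_acyclic ql).
(* The sign is dictated by the square: the differential of the cone of [g] has l v + x w in its
   [Y]-component, so x w is homotopic to l (- v). *)
have [y yE] : exists y : dghom (dgcone g) (dgshift 1 N), forall i z,
    y i z = - z.1.2.
  unshelve eexists.
    exists (fun i (z : dgcone g i) => - z.1.2 : dgshift 1 N i).
    - by move=> i c z z' /=; rewrite opprD scalerN.
    - move=> i j e; case: j / e => -[[u v] w] /=.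
      rewrite /dgshift_d /ksign expr1 scaleN1r addr0 dgm_dN.
      by rewrite (eq_irrelevance (shift_deg1 1 erefl) erefl).
    - by move=> i j m e z a /=; rewrite -dgm_actNl.
  by [].
have H : homotopic (dghom_comp (dghom_shift 1 x) (cone_out g))
    (dghom_comp (dghom_shift 1 l) y).
  exists (fun i j e (z : dgcone g i) => dcast (esym e) z.1.1 : dgshift 1 Y j); split.
  - by move=> i j e c z z'; exact: (@dcast_linear _ _ Y _ _ (esym e) c z.1.1 z'.1.1).
  - move=> i j i' j' m e e' el el' z a /=; exact: dcast_act.
  - move=> i j m e e'; case: i / e e' => e'; case: m / e' => -[[u v] w] /=.
    rewrite /dgshift_d /ksign expr1 scaleN1r yE dgh_funN opprK /=.
    rewrite (eq_irrelevance (shift_deg1 1 erefl) erefl).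
    by rewrite -[_ + l _ v + _]addrA addKr; exact: addrC.
exists _, (dghom_comp (unshift (addNr 1) M) (dghom_shift (- 1) (cone_out g))),
  (dghom_comp (unshift (addNr 1) N) (dghom_shift (- 1) y)); split.
  exact: quasi_iso_unshift.
rewrite (deq_loc_comp (unshift (addNr 1) M)) (deq_loc_comp (unshift (addNr 1) N)).
rewrite dcompA -unshift_nat -dcompA; apply: deq_comp => //.
have : dshift 1 f \oD dloc (cone_out g) =D dloc y.
  apply: (qiso_cancell (quasi_iso_shift 1 ql)).
  rewrite -deq_loc_comp -(deq_loc H) deq_loc_comp dcompA; apply: deq_comp => //.
  exact: (dshift_deq 1 lf).
by move/(dshift_deq (- 1)).
Qed.

End Shifts.

(** * Exact sequences of a cone *)

Section Exactness.
Variables (k : comPzRingType) (A : dgalg k).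
Implicit Types M N L X Y Z : dgmod A.

(** Subtracting dh + hd, for any graded A-linear [h], gives a homotopic dg map. This replaces a map
    that is null-homotopic on a submodule, or modulo one, by a map that vanishes there strictly. *)
Lemma perturb M N (x : dghom M N) (h : forall i j, j + 1 = i -> M i -> N j) :
  (forall i j e, linear (h i j e)) ->
  (forall i j i' j' l (e : j + 1 = i) (e' : j' + 1 = i')
     (el : i + l = i') (el' : j + l = j') (z : M i) (a : A l),
     h i' j' e' (dgm_act el z a) = dgm_act el' (h i j e z) a) ->
  exists y : dghom M N, homotopic x y /\
    forall i j l (e : j + 1 = i) (e' : i + 1 = l) z,
      y i z = x i z - (dgm_d e (h i j e z) + h l i e' (dgm_d e' z)).
Proof.
move=> hL hA; pose F i (z : M i) : N i := x i z -
  (dgm_d (subrK 1 i) (h i (i - 1) (subrK 1 i) z) + h (i + 1) i erefl (dgm_d erefl z)).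
have FE i j l (e : j + 1 = i) (e' : i + 1 = l) z :
    F i z = x i z - (dgm_d e (h i j e z) + h l i e' (dgm_d e' z)).
  have ej : j = i - 1 by rewrite -e addrK.
  subst j l; rewrite /F; congr (_ - (_ + _)).
  by rewrite (eq_irrelevance e (subrK 1 i)).
unshelve eexists.
  exists F.
  - move=> i c z z'; rewrite /F dgh_linear hL dgm_dD dgm_dZ dgm_dD dgm_dZ hL.
    rewrite scalerBr scalerDr [RHS]addrACA -opprD; congr (_ - _).
    exact: addrACA.
  - move=> i j e z; rewrite (FE _ _ _ e erefl) (FE _ _ _ (subrK 1 i) e).
    rewrite dgm_dd (is_linear0 (hL _ _ _)) addr0 dgm_dB dgm_dD dgm_dd add0r.
    by rewrite dgh_d.
  - move=> i j l e z a.
    have e1 : i - 1 + j = l - 1 by rewrite -e addrAC.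
    have e2 : i + 1 + j = l + 1 by rewrite -e addrAC.
    rewrite /F dgm_actBl dgm_actDl dgh_act; congr (_ - _).
    rewrite (hA _ _ _ _ _ (subrK 1 i) _ _ e1).
    have e3 : i - 1 + (j + 1) = l by lia.
    have e4 : i + (j + 1) = l + 1 by rewrite -e addrA.
    rewrite (dgm_leibniz e1 _ (subrK 1 i) erefl e e3).
    rewrite (dgm_leibniz e _ erefl erefl e2 e4) (is_linearD (hL _ _ _)).
    rewrite (is_linearZ (hL _ _ _)) (hA _ _ _ _ _ erefl _ _ e).
    rewrite (hA _ _ _ _ _ (subrK 1 i) _ _ e3) addrACA -[RHS]addr0.
    congr (_ + _); rewrite -scalerDl.
    have -> : ksign k (i - 1) + ksign k i = 0; last by rewrite scale0r.
    have -> : ksign k i = ksign k (i - 1) * ksign k 1 by rewrite -ksignD subrK.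
    by rewrite [ksign k 1]/ksign expr1 mulrN1 subrr.
split=> [|i j l e e' z]; last exact: FE.
exists h; split=> // i j l e e' z /=.
by rewrite (FE _ _ _ e e') opprB addrC subrK.
Qed.

Lemma cone_factor_out M N X (f : dghom M N) (x : dghom (dgcone f) X) :
  (forall i y, x i (y, 0) = 0) ->
  exists u : dghom (dgshift 1 M) X, forall i z, x i z = u i z.2.
Proof.
move=> x0.
have xE i (z : dgcone f i) : x i z = x i (0, z.2).
  case: z => y m /=; rewrite -[LHS]subr0 -(x0 _ y) -dgh_funB; congr (x i _).
  by congr (_, _); rewrite /= ?subrr ?subr0.
unshelve eexists.
  exists (fun i (m : M (i + 1)) => x i (0, m)).
  - move=> i c m m' /=; rewrite -dgh_linear; congr (x i _).
    by congr (_, _); rewrite /= scaler0 addr0.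
  - move=> i j e; case: j / e => m /=.
    rewrite -dgh_d [RHS]xE /= /dgshift_d /ksign expr1 scaleN1r.
    by rewrite (eq_irrelevance (shift_deg1 1 erefl) erefl).
  - move=> i j l e m a; rewrite -dgh_act; congr (x l _).
    by congr (_, _); rewrite /= dgm_act0l.
exact: xE.
Qed.

Lemma cone_factor_in T M N (f : dghom M N) (x : dghom T (dgcone f)) :
  (forall i t, (x i t).2 = 0) ->
  exists u : dghom T N, forall i t, x i t = (u i t, 0).
Proof.
move=> x0; unshelve eexists.
  exists (fun i t => (x i t).1).
  - by move=> i c t t' /=; rewrite dgh_linear.
  - move=> i j e t; rewrite dgh_d; case: j / e => /=.
    by rewrite x0 dgh_fun0 addr0.
  - by move=> i j l e t a; rewrite dgh_act.
by move=> i t /=; rewrite -(x0 i t); case: (x i t).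
Qed.

Lemma left_fraction0 M N L Y (s : dmor M N) (g : dghom L M) (l : dghom N Y)
    (x : dghom M Y) :
  quasi_iso l -> dloc l \oD s =D dloc x -> s \oD dloc g =D dzero _ _ ->
  exists Y' (l' : dghom N Y') (x' : dghom M Y'), [/\ quasi_iso l',
    dloc l' \oD s =D dloc x' & homotopic (dghom_comp x' g) (dghom_zero _ _)].
Proof.
move=> ql lx sg0; have : dloc (dghom_comp x g) =D dloc (dghom_zero L Y).
  by rewrite deq_loc_comp -lx -dcompA sg0 dcomp0r.
case/dloc_left => Y' [m [qm mxg]].
exists Y', (dghom_comp m l), (dghom_comp m x); split.
- exact: quasi_iso_comp.
- by rewrite !deq_loc_comp -dcompA lx.
- by apply: homotopic_diff mxg => i z /=; rewrite dgh_fun0.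
Qed.

(** The null-homotopy on [N], extended by zero to the cone, perturbs a representative of [g] into a
    map vanishing on [N]; this one factors through the quotient M[1]. *)
Lemma cone_exact_out M N X (f : dghom M N) (g : dmor (dgcone f) X) :
  g \oD dloc (cone_in f) =D dzero N X ->
  exists u : dmor (dgshift 1 M) X, g =D u \oD dloc (cone_out f).
Proof.
move=> gin; have [Y0 [l0 [x0 [ql0 lg0]]]] := left_fraction g.
have [Y [l [x [ql lg [h [hL hA hd]]]]]] := left_fraction0 ql0 lg0 gin.
pose h' i j e (z : dgcone f i) : Y j := h i j e z.1.
have [||x' [xx' x'E]] := @perturb _ _ x h'.
- by move=> i j e c z z'; rewrite /h' hL.
- by move=> i j i' j' m e e' el el' z a; rewrite /h' (hA _ _ _ _ _ e _ _ el').
have [i y|u uE] := @cone_factor_out _ _ _ _ x'.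
  rewrite (x'E _ _ _ (subrK 1 i) erefl) /h' /= (dgh_fun0 f) addr0.
  by rewrite -(hd _ _ _ (subrK 1 i) erefl) subr0 subrr.
exists (dinv ql \oD dloc u); rewrite -dcompA; apply/dinv_l.
rewrite lg (deq_loc xx') -deq_loc_comp; exact: dloc_eq.
Qed.

(* With [cone_exact_out], this gives exactness of Hom(-, X) at two consecutive
   terms of the triangle, which suffices to split it when f = 0. *)
Lemma cone_exact_shift M N X (f : dghom M N) (g : dmor (dgshift 1 M) X) :
  g \oD dloc (cone_out f) =D dzero _ X ->
  exists u : dmor (dgshift 1 N) X, g =D u \oD dloc (dghom_shift 1 f).
Proof.
move=> gin; have [Y0 [l0 [x0 [ql0 lg0]]]] := left_fraction g.
have [Y [l [x [ql lg [h [hL hA hd]]]]]] := left_fraction0 ql0 lg0 gin.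
(* On [N] the composite with [cone_out] is zero, so the null-homotopy anticommutes with the
   differentials there and is a dg map on N[1]. Its values on [M] form the homotopy from [x] to [u]
   after f[1]. *)
have [u uE] : exists u : dghom (dgshift 1 N) Y,
    forall i y, u i y = h (i + 1) i erefl (y, 0).
  unshelve eexists.
    exists (fun i (y : N (i + 1)) => h (i + 1) i erefl ((y, 0) : dgcone f (i + 1))).
    - move=> i c y y'; rewrite -hL; congr (h _ _ _ _).
      by congr (_, _); rewrite /= scaler0 addr0.
    - move=> i j e; case: j / e => y.
      have := hd _ _ _ erefl erefl ((y, 0) : dgcone f (i + 1)).
      rewrite /= (dgh_fun0 x) subr0 => /esym/eqP; rewrite addr_eq0 => /eqP ->.
      rewrite /dgshift_d /ksign expr1 scaleN1r.
      rewrite (eq_irrelevance (shift_deg1 1 erefl) erefl).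
      rewrite -(is_linearN (hL _ _ _)); congr (h _ _ _ _).
      by congr (_, _); rewrite /= ?dgm_d0 ?dgh_fun0 ?addr0 // !oppr0.
    - move=> i j m e y a; rewrite -(hA _ _ _ _ _ _ _ (shift_deg 1 e)).
      congr (h _ _ _ _).
      by congr (_, _); rewrite /= dgm_act0l.
  by [].
exists (dinv ql \oD dloc u); rewrite -dcompA; apply/dinv_l.
rewrite lg -deq_loc_comp; apply: deq_loc.
exists (fun i j e (m : M (i + 1)) => h i j e ((0, m) : dgcone f i)); split.
- move=> i j e c m m'; rewrite -hL; congr (h _ _ _ _).
  by congr (_, _); rewrite /= scaler0 addr0.
- move=> i j i' j' m e e' el el' y a; rewrite -(hA _ _ _ _ _ _ _ el).
  by congr (h _ _ _ _); congr (_, _); rewrite /= dgm_act0l.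
move=> i j m e; case: m / => y /=; rewrite uE.
have := hd _ _ _ e erefl ((0, y) : dgcone f i); rewrite /= subr0 => ->.
rewrite -addrA; congr (_ + _).
rewrite -(is_linearN (hL _ _ _)) -(is_linearD (hL _ _ _)).
congr (h _ _ _ _); congr (_, _) => /=.
  by rewrite dgm_d0 add0r subrr.
rewrite subr0 /dgshift_d /ksign expr1 scaleN1r.
by rewrite (eq_irrelevance (shift_deg1 1 erefl) erefl).
Qed.

(** Dual to [cone_exact_out]: the null-homotopy, placed in the M[1]-component of the cone, perturbs
    a representative of [g] into one with values in [N]. *)
Lemma cone_exact_in T M N (f : dghom M N) (g : dmor T (dgcone f)) :
  dloc (cone_out f) \oD g =D dzero T _ ->
  exists u : dmor T N, g =D dloc (cone_in f) \oD u.
Proof.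
move=> outg; have [T0 [r0 [x0 [qr0 gr0]]]] := right_fraction g.
have : dloc (dghom_comp (cone_out f) x0) =D dzero _ _.
  by rewrite deq_loc_comp -gr0 dcompA outg dcomp0l.
case/dloc_right0 => T' [r [qr [h [hL hA hd]]]].
pose x := dghom_comp x0 r.
pose h' i j e (t : T' i) : dgcone f j := (0, h i j e t).
have [||x' [xx' x'E]] := @perturb _ _ x h'.
- by move=> i j e c z z'; rewrite /h' hL; congr (_, _); rewrite /= scaler0 addr0.
- move=> i j i' j' m e e' el el' z a; rewrite /h' (hA _ _ _ _ _ e _ _ el').
  by congr (_, _); rewrite /= dgm_act0l.
have [i t|u uE] := @cone_factor_in _ _ _ _ x'.
  rewrite (x'E _ _ _ (subrK 1 i) erefl) /h' /=.
  have := dgh_d (cone_out f) (subrK 1 i) (0, h i (i - 1) (subrK 1 i) t).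
  rewrite /= => ->.
  have := hd _ _ _ (subrK 1 i) erefl t.
  by rewrite /= subr0 => ->; rewrite subrr.
have qrr := quasi_iso_comp qr0 qr.
exists (dloc u \oD dinv qrr); rewrite dcompA; apply/dinv_r.
rewrite deq_loc_comp dcompA gr0 -!deq_loc_comp (deq_loc xx').
exact: dloc_eq.
Qed.

(** As [l] after [f] is null-homotopic, [l] extends over the cone and gives a left inverse [p'] of
    [cone_in]. The complementary idempotent [e] factors through [cone_out], and the factor [s] is a
    section because [cone_out] is an epimorphism. *)
Lemma cone_split M N (f : dghom M N) : dloc f =D dzero M N ->
  dsummand (dgshift 1 M) (dgcone f) /\ dsummand N (dgcone f).
Proof.
move=> f0; have [Y [l [ql lf]]] := dloc_left f0.
have [|v vE] := @cone_desc _ _ _ _ Y f l.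
  by apply: homotopic_diff lf => i x; rewrite /= dgh_fun0.
pose i' := dloc (cone_in f); pose p := dloc (cone_out f).
pose p' := dinv ql \oD dloc v.
have p'i' : p' \oD i' =D did N.
  rewrite -dcompA -deq_loc_comp.
  rewrite -[X in _ =D X](deq_invl ql); apply: deq_comp => //; exact: dloc_eq.
have pi' : p \oD i' =D dzero _ _ by rewrite -deq_loc_comp; apply: dloc_eq.
pose e := did (dgcone f) +D dopp (i' \oD p').
have ei' : e \oD i' =D dzero _ _.
  rewrite deq_compDl deq_comp1l dcompNl -dcompA p'i' deq_comp1r.
  exact: deq_addN.
have f10 X (g : dmor (dgshift 1 N) X) :
    g \oD dloc (dghom_shift 1 f) =D dzero _ _.
  by rewrite -[dloc _]/(dshift 1 (dloc f)) (dshift_deq 1 f0) dshift_zero dcomp0r.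
(* A map killed by [cone_out] factors through f[1], which is zero. *)
have epi X (g : dmor _ X) : g \oD p =D dzero _ _ -> g =D dzero _ _.
  by case/cone_exact_shift => u ->.
have [s sE] := cone_exact_out ei'.
have ps : p \oD s =D did _.
  apply/dsub_eq0/epi; rewrite deq_compDl -dcompA -sE /e deq_compDr deq_comp1r.
  rewrite dcompNr dcompA pi' dcomp0l dcompNl deq_comp1l -deq_addA.
  rewrite -[dopp (dzero _ _)](dadd0l _) deq_addN dadd0l.
  exact: deq_addN.
have p's : p' \oD s =D dzero _ _.
  apply: epi; rewrite -dcompA -sE /e deq_compDr deq_comp1r dcompNr dcompA.
  by rewrite p'i' deq_comp1l deq_addN.
have sum : (s \oD p) +D (i' \oD p') =D did _.
  rewrite -sE /e -deq_addA (deq_addC (dopp _)) deq_addN.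
  exact: deq_add0.
split; [exists N, s, p, i', p'|exists (dgshift 1 M), i', p', s, p]; split=> //.
by rewrite deq_addC.
Qed.

End Exactness.

(** * Thick subcategories *)

Section Thick.
Variables (k : comPzRingType) (A : dgalg k).
Implicit Types M N L X Y Z : dgmod A.

Lemma dhom_zero_cone_l M N X (f : dghom M N) :
  dhom_zero N X -> dhom_zero (dgshift 1 M) X -> dhom_zero (dgcone f) X.
Proof.
move=> zN zM g; have [u ->] := cone_exact_out (zN (g \oD dloc (cone_in f))).
by rewrite (zM u) dcomp0l.
Qed.

Lemma dhom_zero_cone_r X M N (f : dghom M N) :
  dhom_zero X N -> dhom_zero X (dgshift 1 M) -> dhom_zero X (dgcone f).
Proof.
move=> zN zM g; have [u ->] := cone_exact_in (zM (dloc (cone_out f) \oD g)).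
by rewrite (zN u) dcomp0r.
Qed.

Lemma dhom_zero_summand_l M N X : dsummand M N -> dhom_zero N X -> dhom_zero M X.
Proof.
case=> M' [i [p [i' [p' [pi _ _ _ _]]]]] z f.
by rewrite -(deq_comp1r f) -pi dcompA (z (f \oD p)) dcomp0l.
Qed.

Lemma dhom_zero_summand_r X M N : dsummand M N -> dhom_zero X N -> dhom_zero X M.
Proof.
case=> M' [i [p [i' [p' [pi _ _ _ _]]]]] z f.
by rewrite -(deq_comp1l f) -pi -dcompA (z (i \oD f)) dcomp0r.
Qed.

Lemma dhom_zero_id_l M X : did M =D dzero M M -> dhom_zero M X.
Proof. by move=> e f; rewrite -(deq_comp1r f) e dcomp0r. Qed.

Lemma dhom_zero_id_r X M : did M =D dzero M M -> dhom_zero X M.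
Proof. by move=> e f; rewrite -(deq_comp1l f) e dcomp0l. Qed.

Lemma dhom_zero_addn a b c M N : b + a = c ->
  dhom_zero M (dgshift b (dgshift a N)) <-> dhom_zero M (dgshift c N).
Proof.
move=> e; split; apply: dhom_zero_iso (diso_id M) _.
  exact: (diso_merge e).
exact: (diso_split e).
Qed.

(** A distinguished triangle is by definition isomorphic to that of a dg map, so closure under cones
    of dg maps suffices. *)
Lemma thick_of_cone (C : subcat A) :
  (forall t, did t =D dzero t t -> C t) ->
  (forall s t (f : dmor s t), diso f -> C s -> C t) ->
  (forall n t, C t -> C (dgshift n t)) ->
  (forall M N (f : dghom M N), C M -> C N -> C (dgcone f)) ->
  (forall s t, dsummand s t -> C t -> C s) -> is_thick C.
Proof.
move=> C0 Ci Cs Cc Cd; split=> // M N L u v w.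
case=> M' [N' [f [a [b [c [[ia ib [c' [cc c'c]]] _]]]]]] CM CN.
apply: (Ci _ _ c'); first by exists c.
by apply: Cc; [apply: Ci CM; exact: ia|apply: Ci CN; exact: ib].
Qed.

Lemma thick_cone (C : subcat A) M N (f : dghom M N) :
  is_thick C -> C M -> C N -> C (dgcone f).
Proof.
case=> _ _ _ Ct _; apply: (Ct _ _ _ (dloc f) (dloc (cone_in f)) (dloc (cone_out f))).
exists M, N, f, (did M), (did N), (did _); split.
  by split; apply: diso_id.
split; rewrite ?deq_comp1l ?deq_comp1r //.
by rewrite dshift_id deq_comp1l.
Qed.

(** The conditions of [bounded_left] and, below, [bounded_right] for a single test object; thickness
    then passes to the intersection over all test objects. *)
Definition ev_zero_from X : subcat A := fun t =>
  exists r : seq int, forall n, n \notin r -> dhom_zero t (dgshift n X).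
Definition ev_zero_to X : subcat A := fun t =>
  exists r : seq int, forall n, n \notin r -> dhom_zero X (dgshift n t).

Lemma ev_zero_from_shift m t X : ev_zero_from X t -> ev_zero_from X (dgshift m t).
Proof.
case=> r zr; exists (map (fun n => n + m) r) => n nr.
apply/(@dhom_zero_adj _ _ (- m)); first by rewrite addNr.
apply/(@dhom_zero_addn n (- m) (n - m)); first by rewrite addrC.
by apply: zr; apply: contra nr => nr; apply/mapP; exists (n - m); rewrite ?subrK.
Qed.

Lemma ev_zero_to_shift m t X : ev_zero_to X t -> ev_zero_to X (dgshift m t).
Proof.
case=> r zr; exists (map (fun n => n - m) r) => n nr.
apply/(@dhom_zero_addn m n (n + m)) => //.
by apply: zr; apply: contra nr => nr; apply/mapP; exists (n + m); rewrite ?addrK.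
Qed.

Lemma ev_zero_from_thick X : is_thick (ev_zero_from X).
Proof.
apply: thick_of_cone.
- by move=> t t0; exists [::] => n _; apply: dhom_zero_id_l.
- move=> s t f df [r zr]; exists r => n /zr.
  exact: dhom_zero_iso df (diso_id _).
- by move=> n t; apply: ev_zero_from_shift.
- move=> M N f /(@ev_zero_from_shift 1)[r zr] [r' zr'].
  exists (r ++ r') => n; rewrite mem_cat negb_or => /andP[nr nr'].
  by apply: dhom_zero_cone_l; [apply: zr'|apply: zr].
- by move=> s t st [r zr]; exists r => n /zr; apply: dhom_zero_summand_l.
Qed.

Lemma ev_zero_to_thick X : is_thick (ev_zero_to X).
Proof.
apply: thick_of_cone.
- move=> t t0; exists [::] => n _.
  apply/(@dhom_zero_adj _ _ n (- n)); first by rewrite subrr.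
  exact: dhom_zero_id_r.
- move=> s t f df [r zr]; exists r => n /zr.
  exact: dhom_zero_iso (diso_id _) (diso_dshift n df).
- by move=> n t; apply: ev_zero_to_shift.
- move=> M N f /(@ev_zero_to_shift 1)[r zr] [r' zr'].
  exists (r ++ r') => n; rewrite mem_cat negb_or => /andP[nr nr'].
  have e : n + - n = 0 by rewrite subrr.
  apply/(dhom_zero_adj _ _ e); apply: dhom_zero_cone_r; apply/(dhom_zero_adj _ _ e).
    exact: zr'.
  exact: zr.
- move=> s t st [r zr]; exists r => n /zr.
  have e : n + - n = 0 by rewrite subrr.
  move/(dhom_zero_adj _ _ e) => z; apply/(dhom_zero_adj _ _ e).
  exact: dhom_zero_summand_r z.
Qed.

Lemma bounded_left_thick (X : subcat A) : is_thick (bounded_left X).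
Proof.
have H x := ev_zero_from_thick x.
split.
- by move=> t t0 x Xx; case: (H x) => Z _ _ _ _; apply: Z.
- by move=> s t f df Cs x Xx; case: (H x) => _ Z _ _ _; apply: Z df (Cs x Xx).
- by move=> n t Ct x Xx; case: (H x) => _ _ Z _ _; apply: Z (Ct x Xx).
- move=> M N L u v w D CM CN x Xx; case: (H x) => _ _ _ Z _.
  exact: Z D (CM x Xx) (CN x Xx).
- by move=> s t st Ct x Xx; case: (H x) => _ _ _ _ Z; apply: Z st (Ct x Xx).
Qed.

Lemma bounded_right_thick (X : subcat A) : is_thick (bounded_right X).
Proof.
have H x := ev_zero_to_thick x.
split.
- by move=> t t0 x Xx; case: (H x) => Z _ _ _ _; apply: Z.
- by move=> s t f df Cs x Xx; case: (H x) => _ Z _ _ _; apply: Z df (Cs x Xx).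
- by move=> n t Ct x Xx; case: (H x) => _ _ Z _ _; apply: Z (Ct x Xx).
- move=> M N L u v w D CM CN x Xx; case: (H x) => _ _ _ Z _.
  exact: Z D (CM x Xx) (CN x Xx).
- by move=> s t st Ct x Xx; case: (H x) => _ _ _ _ Z; apply: Z st (Ct x Xx).
Qed.

(** All components of a map out of a self-coproduct vanish outside one and the same finite set, that
    of [M]; distinct summands would have no common finite set. *)
Lemma bounded_left_coproduct (X : subcat A) : coproduct_closed (bounded_left X).
Proof.
move=> I M S inj cS CM x Xx; have [r zr] := CM x Xx; exists r => n nr f.
have [h [_ hu]] := cS (dgshift n x) (fun i => dzero M _).
rewrite (hu f); last by move=> i; apply: zr.
by rewrite (hu (dzero _ _)) // => i; rewrite dcomp0l.
Qed.

Lemma bounded_right_product (X : subcat A) : product_closed (bounded_right X).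
Proof.
move=> I M P proj pP CM x Xx; have [r zr] := CM x Xx; exists r => n nr.
have e : n + - n = 0 by rewrite subrr.
(* The shift moves to the test object, since the universal property concerns [P] and not its
   shift. *)
apply/(dhom_zero_adj _ _ e) => f.
have [h [_ hu]] := pP (dgshift (- n) x) (fun i => dzero _ M).
rewrite (hu f); last first.
  by move=> i; apply: ((dhom_zero_adj _ _ e).1 (zr n nr)).
by rewrite (hu (dzero _ _)) // => i; rewrite dcomp0r.
Qed.

(** The complement has to be a zero object; the cone of an identity is one. *)
Lemma dsummand_refl M : dsummand M M.
Proof.
pose Z := dgcone (dghom_id M).
have z : did Z =D dzero Z Z.
  have q : quasi_iso (dghom_zero Z Z).
    apply/quasi_isoP => n; have /cohom_zeroP H : cohom_zero_at Z n.
      exact: cone_acyclic (quasi_iso_id M) n.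
    split=> [x cx _|y cy]; first exact: H.
    by exists 0; [apply: cocyc0|rewrite subr0; apply: H].
  apply: (qiso_cancell q); rewrite -!deq_loc_comp; exact: dloc_eq.
exists Z, (did M), (did M), (dzero _ _), (dzero _ _); split.
- exact: deq_comp1l.
- by rewrite dcomp0l z.
- exact: dcomp0l.
- exact: dcomp0r.
- by rewrite deq_comp1l dcomp0l deq_add0.
Qed.

End Thick.

(** * Products and direct sums *)

Section RestrictedProduct.
Variables (k : comPzRingType) (fin : bool) (I : Type) (V : I -> lmodType k).

(** [{classic I}] gives an arbitrary index type the decidable equality that membership in a list
    requires. *)
Definition rp_supp (x : forall i, V i) : Prop :=
  fin -> exists r : seq {classic I}, forall i : I, (i : {classic I}) \notin r -> x i = 0.

(* The product of the V i if [fin] is false, their direct sum if it is true. *)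
Record rprod := RProd { rp_fun :> forall i, V i; rp_suppP : rp_supp rp_fun }.

HB.instance Definition _ := gen_eqMixin rprod.
HB.instance Definition _ := gen_choiceMixin rprod.

Lemma rprod_eq (x y : rprod) : (forall i, x i = y i) -> x = y.
Proof.
case: x y => [x hx] [y hy] /= xy; have {}xy : x = y by apply: functional_extensionality_dep.
by subst y; rewrite (Prop_irrelevance hx hy).
Qed.

Lemma rp_supp0 : rp_supp (fun=> 0).
Proof. by exists [::]. Qed.

Lemma rp_supp2 (x y z : forall i, V i) :
  (forall i, x i = 0 -> y i = 0 -> z i = 0) ->
  rp_supp x -> rp_supp y -> rp_supp z.
Proof.
move=> H sx sy f; have [r xr] := sx f; have [s ys] := sy f; exists (r ++ s) => i.
by rewrite mem_cat negb_or => /andP[/xr xi /ys]; apply: H.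
Qed.

Definition rprod0 := RProd rp_supp0.

Definition rprod_add (x y : rprod) : rprod.
Proof.
exists (fun i => x i + y i); apply: rp_supp2 (rp_suppP x) (rp_suppP y) => i -> ->.
exact: addr0.
Defined.

Definition rprod_opp (x : rprod) : rprod.
Proof.
exists (fun i => - x i); apply: rp_supp2 (rp_suppP x) (rp_suppP x) => i -> _.
exact: oppr0.
Defined.

Definition rprod_scale (c : k) (x : rprod) : rprod.
Proof.
exists (fun i => c *: x i); apply: rp_supp2 (rp_suppP x) (rp_suppP x) => i -> _.
exact: scaler0.
Defined.

Lemma rprod_addA : associative rprod_add.
Proof. by move=> x y z; apply: rprod_eq => i /=; rewrite addrA. Qed.
Lemma rprod_addC : commutative rprod_add.
Proof. by move=> x y; apply: rprod_eq => i /=; rewrite addrC. Qed.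
Lemma rprod_add0 : left_id rprod0 rprod_add.
Proof. by move=> x; apply: rprod_eq => i /=; rewrite add0r. Qed.
Lemma rprod_addN : left_inverse rprod0 rprod_opp rprod_add.
Proof. by move=> x; apply: rprod_eq => i /=; rewrite addNr. Qed.

HB.instance Definition _ :=
  GRing.isZmodule.Build rprod rprod_addA rprod_addC rprod_add0 rprod_addN.

Lemma rprod_scaleA (a b : k) (x : rprod) :
  rprod_scale a (rprod_scale b x) = rprod_scale (a * b) x.
Proof. by apply: rprod_eq => i /=; rewrite scalerA. Qed.
Lemma rprod_scale1 : left_id 1 rprod_scale.
Proof. by move=> x; apply: rprod_eq => i /=; rewrite scale1r. Qed.
Lemma rprod_scaleDr : right_distributive rprod_scale +%R.
Proof. by move=> a x y; apply: rprod_eq => i /=; rewrite scalerDr. Qed.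
Lemma rprod_scaleDl (x : rprod) :
  {morph rprod_scale^~ x : a b / a + b}.
Proof. by move=> a b; apply: rprod_eq => i /=; rewrite scalerDl. Qed.

HB.instance Definition _ :=
  GRing.Zmodule_isLmodule.Build k rprod rprod_scaleA rprod_scale1
    rprod_scaleDr rprod_scaleDl.

Lemma rprodD (x y : rprod) i : (x + y) i = x i + y i. Proof. by []. Qed.
Lemma rprodN (x : rprod) i : (- x) i = - x i. Proof. by []. Qed.
Lemma rprodZ c (x : rprod) i : (c *: x) i = c *: x i. Proof. by []. Qed.

End RestrictedProduct.

Lemma rp_supp1 (k : comPzRingType) fin (I : Type) (V W : I -> lmodType k)
    (x : forall i, V i) (y : forall i, W i) :
  (forall i, x i = 0 -> y i = 0) -> rp_supp fin x -> rp_supp fin y.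
Proof. by move=> H sx f; have [r xr] := sx f; exists r => i /xr/H. Qed.

Section FiniteSum.
Variables (k : comPzRingType) (I : Type) (V : I -> lmodType k) (W : lmodType k).
Implicit Types u : forall i, V i -> W.

Definition fsupp (x : rprod true V) : seq {classic I} :=
  undup (projT1 (cid (rp_suppP x isT))).

Definition fsum u (x : rprod true V) : W := \sum_(i <- fsupp x) u i (x i).

Lemma fsuppP (x : rprod true V) (i : {classic I}) : i \notin fsupp x -> x i = 0.
Proof. by rewrite mem_undup => H; apply: (projT2 (cid (rp_suppP x isT))). Qed.

(** The list [fsupp x] is picked by choice and may contain zeros of [x]; any duplicate-free list
    covering the support can replace it. *)
Lemma fsumE u (x : rprod true V) (r : seq {classic I}) :
  (forall i, u i 0 = 0) -> uniq r ->
  (forall i : {classic I}, i \notin r -> x i = 0) ->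
  fsum u x = \sum_(i <- r) u i (x i).
Proof.
move=> u0 ur xr.
have E (s : seq {classic I}) : \sum_(i <- s) u i (x i) =
    \sum_(i <- [seq i <- s | x i != 0]) u i (x i).
  rewrite big_filter [RHS]big_mkcond; apply: eq_bigr => i _.
  by case: eqP => // ->; rewrite u0.
rewrite /fsum E [RHS]E; apply: (@perm_big _ _ _ {classic I}); apply: uniq_perm.
- exact/filter_uniq/undup_uniq.
- exact: filter_uniq.
- move=> i; rewrite !mem_filter; case: eqP => //= /eqP xi.
  have [|/fsuppP/eqP] := boolP (i \in fsupp x); last by rewrite (negPf xi).
  by have [//|/xr/eqP] := boolP (i \in r); rewrite (negPf xi).
Qed.

Lemma fsum_linear u : (forall i, linear (u i)) -> linear (fsum u).
Proof.
move=> uL c x y.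
have u0 i : u i 0 = 0 by apply: is_linear0.
pose r := undup (fsupp x ++ fsupp y).
have ur : uniq r by apply: undup_uniq.
have xr i : i \notin r -> x i = 0.
  by rewrite mem_undup mem_cat negb_or => /andP[/fsuppP].
have yr i : i \notin r -> y i = 0.
  by rewrite mem_undup mem_cat negb_or => /andP[_ /fsuppP].
rewrite (fsumE u0 ur xr) (fsumE u0 ur yr) (fsumE (r := r) u0 ur); last first.
  by move=> i ir; rewrite rprodD rprodZ xr // yr // scaler0 addr0.
rewrite scaler_sumr -big_split; apply: eq_bigr => i _.
exact: uL.
Qed.

End FiniteSum.

Lemma fsum_map (k : comPzRingType) (I : Type) (V V' : I -> lmodType k)
    (W W' : lmodType k) (u : forall i, V i -> W) (u' : forall i, V' i -> W')
    (f : W -> W') (x : rprod true V) (y : rprod true V') :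
  linear f -> (forall i, u i 0 = 0) -> (forall i, u' i 0 = 0) ->
  (forall i, f (u i (x i)) = u' i (y i)) -> f (fsum u x) = fsum u' y.
Proof.
move=> fL u0 u0' fu; pose r := undup (fsupp x ++ fsupp y).
have ur : uniq r by apply: undup_uniq.
rewrite (fsumE (r := r) u0 ur); last first.
  by move=> i; rewrite mem_undup mem_cat negb_or => /andP[h _]; apply: fsuppP.
rewrite (fsumE (r := r) u0' ur); last first.
  by move=> i; rewrite mem_undup mem_cat negb_or => /andP[_ h]; apply: fsuppP.
rewrite (big_morph f (is_linearD fL) (is_linear0 fL)).
by apply: eq_bigr => i _; apply: fu.
Qed.

Definition rp_map (k : comPzRingType) fin (I : Type) (V W : I -> lmodType k)
    (f : forall i, V i -> W i) (f0 : forall i, f i 0 = 0) (x : rprod fin V) :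
  rprod fin W := RProd (rp_supp1 (fun i (e : x i = 0) =>
    etrans (congr1 (f i) e) (f0 i)) (rp_suppP x)).

Arguments rp_map {k fin I V W} f f0 x.

Section DGProduct.
Variables (k : comPzRingType) (A : dgalg k) (fin : bool) (I : Type).
Implicit Types M N : I -> dgmod A.

Definition dgprod M : dgmod A.
Proof.
exists (fun j => rprod fin (fun i => M i j) : lmodType k)
  (fun i j e => rp_map (fun l => dgm_d e) (fun l => @dgm_d0 _ _ (M l) _ _ e))
  (fun i j l e x a => rp_map (fun m y => dgm_act e y a)
    (fun m => @dgm_act0l _ _ (M m) _ _ _ e a) x).
- by move=> i j e c x y; apply: rprod_eq => l /=; rewrite dgm_dD dgm_dZ.
- by move=> i j l e a c x y; apply: rprod_eq => m /=; rewrite dgm_actDl dgm_actZl.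
- by move=> i j l e x c a b; apply: rprod_eq => m /=; rewrite dgm_actDr dgm_actZr.
- by move=> i e x; apply: rprod_eq => m /=; rewrite dgm_act1.
- by move=> h i j hi ij hij e1 e2 e3 e4 x a b; apply: rprod_eq => m; apply: dgm_actA.
- by move=> i j l e e' x; apply: rprod_eq => m; apply: dgm_dd.
- move=> i j l i1 j1 l1 e el ei ej e1 e2 x a; apply: rprod_eq => m.
  exact: dgm_leibniz.
Defined.

Definition dgprod_proj M l : dghom (dgprod M) (M l).
Proof. by exists (fun i (x : dgprod M i) => rp_fun x l). Defined.

Definition dgprod_map M N (f : forall l, dghom (M l) (N l)) :
  dghom (dgprod M) (dgprod N).
Proof.
exists (fun i => rp_map (fun l => f l i) (fun l => dgh_fun0 (f l) i) : dgprod M i -> dgprod N i).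
- by move=> i c x y; apply: rprod_eq => l /=; rewrite dgh_linear.
- by move=> i j e x; apply: rprod_eq => l /=; rewrite dgh_d.
- by move=> i j l e x a; apply: rprod_eq => m /=; rewrite dgh_act.
Defined.

Definition put M l i (x : M l i) m : M m i :=
  if pselect (l = m) is left e then eq_rect l (fun m => dgm_sort (M m) i : Type) x m e
  else 0.

Lemma put_same M l i (x : M l i) : put x l = x.
Proof. by rewrite /put; case: pselect => // e; rewrite (Prop_irrelevance e erefl). Qed.

Lemma put_other M l i (x : M l i) m : l <> m -> put x m = 0.
Proof. by rewrite /put; case: pselect. Qed.

Lemma put_supp M l i (x : M l i) : rp_supp fin (put x).
Proof.
move=> _; exists [:: l] => m /negP ml; apply: put_other => lm; apply: ml.
by rewrite mem_seq1; apply/eqP.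
Qed.

Definition dgprod_inj M l : dghom (M l) (dgprod M).
Proof.
exists (fun i (x : M l i) => RProd (put_supp x) : dgprod M i).
- move=> i c x y; apply: rprod_eq => m /=; rewrite /put.
  by case: pselect => [e|_]; [subst m|rewrite scaler0 addr0].
- move=> i j e x; apply: rprod_eq => m /=; rewrite /put.
  by case: pselect => [e'|_]; [subst m|rewrite dgm_d0].
- move=> i j h e x a; apply: rprod_eq => m /=; rewrite /put.
  by case: pselect => [e'|_]; [subst m|rewrite dgm_act0l].
Defined.

Lemma dgprod_cocyc M i (x : dgprod M i) : cocyc x <-> forall l, cocyc (x l).
Proof.
split=> [cx l|cx]; first exact: (congr1 (fun y : rprod _ _ => y l) cx).
by apply: rprod_eq => l; apply: cx.
Qed.

Lemma dgprod_boundP M i (x : dgprod M i) : bound x <-> forall l, bound (x l).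
Proof.
split=> [bx l|bx]; first exact: (dgh_bound (dgprod_proj M l) bx).
(* The primitive is chosen zero wherever the component is, to keep its support finite. *)
have H l : exists y, x l = dgm_d (subrK 1 i) y /\ (x l = 0 -> y = 0).
  have [y xy] := (boundE (subrK 1 i) _).1 (bx l).
  have [xl|xl] := pselect (x l = 0); last by exists y.
  by exists 0; rewrite dgm_d0.
pose y l := projT1 (cid (H l)).
have yP l : x l = dgm_d (subrK 1 i) (y l) /\ (x l = 0 -> y l = 0).
  exact: projT2 (cid (H l)).
have sy : rp_supp fin y by apply: rp_supp1 (rp_suppP x) => l; case: (yP l).
apply/(boundE (subrK 1 i)); exists (RProd sy); apply: rprod_eq => l.
by case: (yP l).
Qed.

Lemma dgprod_cohom_zero M n :
  (forall l, cohom_zero_at (M l) n) -> cohom_zero_at (dgprod M) n.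
Proof.
move=> H; apply/cohom_zeroP => x /dgprod_cocyc cx; apply/dgprod_boundP => l.
by have /cohom_zeroP := H l; apply.
Qed.

Lemma dgprod_map_quasi_iso M N (f : forall l, dghom (M l) (N l)) :
  (forall l, quasi_iso (f l)) -> quasi_iso (dgprod_map f).
Proof.
move=> qf; apply/quasi_isoP => n; split.
  move=> x /dgprod_cocyc cx /dgprod_boundP bfx; apply/dgprod_boundP => l.
  exact: (quasi_iso_inj (qf l) (cx l) (bfx l)).
move=> y /dgprod_cocyc cy.
(* Again the lift is zero wherever [y l] is, for the sake of the support. *)
have H l : exists x : M l n, [/\ cocyc x, bound (y l - f l n x) & y l = 0 -> x = 0].
  have [x cx bx] := quasi_iso_surj (qf l) (cy l).
  have [yl|yl] := pselect (y l = 0); last by exists x.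
  exists 0; split=> //; first exact: cocyc0.
  by rewrite yl dgh_fun0 subrr; apply: bound0.
pose x l := projT1 (cid (H l)).
have xP l : [/\ cocyc (x l), bound (y l - f l n (x l)) & y l = 0 -> x l = 0].
  exact: projT2 (cid (H l)).
have sx : rp_supp fin x by apply: rp_supp1 (rp_suppP y) => l; case: (xP l).
exists (RProd sx : dgprod M n).
  by apply/dgprod_cocyc => l; case: (xP l).
by apply/dgprod_boundP => l; case: (xP l).
Qed.

End DGProduct.

(** * Products and coproducts in D(A) *)

Section Product.
Variables (k : comPzRingType) (A : dgalg k) (I : Type).
Implicit Types (M N : I -> dgmod A) (Y : dgmod A).

Lemma rp_supp_true (V : I -> lmodType k) (x : forall i, V i) : rp_supp false x.
Proof. by []. Qed.

Definition dgprod_pair Y M (f : forall l, dghom Y (M l)) : dghom Y (dgprod false M).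
Proof.
exists (fun i y => RProd (rp_supp_true (fun l => f l i y)) : dgprod false M i).
- by move=> i c x y; apply: rprod_eq => l /=; rewrite dgh_linear.
- by move=> i j e x; apply: rprod_eq => l /=; rewrite dgh_d.
- by move=> i j l e x a; apply: rprod_eq => m /=; rewrite dgh_act.
Defined.

(** The product of the denominators of componentwise left fractions is a quasi-isomorphism, so these
    combine into one fraction. For uniqueness, a right fraction turns the difference into a strict
    map; its components become null-homotopic after quasi-isomorphisms, and the homotopies combine
    likewise. *)
Lemma dgprod_is_product M :
  is_product (fun l => dloc (dgprod_proj false M l)).
Proof.
move=> Y g.
have H l : exists t : {Z & (dghom (M l) Z * dghom Y Z)%type},
    quasi_iso (tagged t).1 /\ dloc (tagged t).1 \oD g l =D dloc (tagged t).2.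
  have [Z [s [x [qs sx]]]] := left_fraction (g l).
  by exists (Tagged (fun Z => (dghom (M l) Z * dghom Y Z)%type) (s, x)).
pose t l := projT1 (cid (H l)); have tP l := projT2 (cid (H l)).
pose Z l := tag (t l); pose s l : dghom (M l) (Z l) := (tagged (t l)).1.
pose x l : dghom Y (Z l) := (tagged (t l)).2.
have qs l : quasi_iso (s l) := (tP l).1.
have sx l : dloc (s l) \oD g l =D dloc (x l) := (tP l).2.
have qS : quasi_iso (dgprod_map false s) by apply: dgprod_map_quasi_iso.
exists (dinv qS \oD dloc (dgprod_pair x)).
have projE l : dloc (dgprod_proj false M l) \oD (dinv qS \oD dloc (dgprod_pair x))
    =D g l.
  apply: (qiso_cancell (qs l)); rewrite sx dcompA -deq_loc_comp dcompA.
  rewrite (_ : dloc (dghom_comp _ _) =D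
    dloc (dgprod_proj false Z l) \oD dloc (dgprod_map false s)).
    rewrite -(dcompA _ (dloc (dgprod_map false s))) deq_invr deq_comp1r.
    by rewrite -deq_loc_comp; apply: dloc_eq.
  by rewrite -deq_loc_comp; apply: dloc_eq.
split=> // h' h'E; apply/dsub_eq0.
set h := dadd _ _.
have h0 l : dloc (dgprod_proj false M l) \oD h =D dzero _ _.
  by rewrite deq_compDr h'E dcompNr projE deq_addN.
move: h h0 => h h0 {h' h'E projE}.
have [Y' [r [u [qr hr]]]] := right_fraction h.
apply: (qiso_cancelr qr); rewrite hr dcomp0l.
have G l : exists t : {Z & dghom (M l) Z}, quasi_iso (tagged t) /\
   homotopic (dghom_comp (tagged t) (dghom_comp (dgprod_proj false M l) u))
     (dghom_zero _ _).
  have : dloc (dghom_comp (dgprod_proj false M l) u) =D dloc (dghom_zero _ _).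
    by rewrite deq_loc_comp -hr dcompA h0 dcomp0l.
  case/dloc_left=> W [v [qv vu]]; exists (Tagged (fun Z => dghom (M l) Z) v).
  by split=> //; apply: homotopic_diff vu => i y; rewrite /= dgh_fun0.
pose w l := tagged (projT1 (cid (G l))); have wP l := projT2 (cid (G l)).
have qw : quasi_iso (dgprod_map false w).
  by apply: dgprod_map_quasi_iso => l; case: (wP l).
apply: (qiso_cancell qw); rewrite dcomp0r -deq_loc_comp.
apply: deq_loc.
pose h1 l := projT1 (cid (wP l).2).
have h1P l := projT2 (cid (wP l).2).
exists (fun i j e y => RProd (rp_supp_true (fun l => h1 l i j e y)) : dgprod _ _ _).
split.
- by move=> i j e c y z; apply: rprod_eq => l; case: (h1P l) => L _ _; apply: L.
- move=> i j i' j' m e e' el el' y a; apply: rprod_eq => l.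
  by case: (h1P l) => _ L _; apply: L.
- move=> i j m e e' y; apply: rprod_eq => l.
  by case: (h1P l) => _ _ L; apply: L.
Qed.

Definition dgsum_copair M Y (f : forall l, dghom (M l) Y) : dghom (dgprod true M) Y.
Proof.
exists (fun i (x : dgprod true M i) => fsum (fun l => f l i) x).
- by move=> i; apply: fsum_linear => l; apply: dgh_linear.
- move=> i j e x; symmetry; apply: fsum_map.
  + exact: dgm_d_linear.
  + by move=> l; apply: dgh_fun0.
  + by move=> l; apply: dgh_fun0.
  + by move=> l; rewrite /= dgh_d.
- move=> i j m e x a; symmetry.
  apply: (fsum_map (f := fun y => dgm_act e y a)).
  + exact: dgm_act_linearl.
  + by move=> l; apply: dgh_fun0.
  + by move=> l; apply: dgh_fun0.
  + by move=> l; rewrite /= dgh_act.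
Defined.

Lemma fsum_put M Y i (f : forall l, M l i -> Y i) l (x : M l i) :
  (forall l, f l 0 = 0) ->
  fsum f (dgprod_inj true M l i x) = f l x.
Proof.
move=> f0; rewrite (fsumE (r := [:: l : {classic I}]) f0) //.
  by rewrite big_seq1 /= put_same.
move=> m /negP lm; rewrite /= put_other // => e.
by apply: lm; rewrite mem_seq1; apply/eqP.
Qed.

Lemma dgsum_copair_inj M Y (f : forall l, dghom (M l) Y) l i (x : M l i) :
  dgsum_copair f i (dgprod_inj true M l i x) = f l i x.
Proof. by apply: (fsum_put (f := fun l => f l i)) => m; apply: dgh_fun0. Qed.

Lemma dghom_sum_ext M Y (f g : dghom (dgprod true M) Y) :
  (forall l i x, f i (dgprod_inj true M l i x) = g i (dgprod_inj true M l i x)) ->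
  forall i x, f i x = g i x.
Proof.
move=> fg i x; have -> : x = fsum (fun l => dgprod_inj true M l i) x.
  apply: rprod_eq => m.
  pose r := undup (m :: fsupp x : seq {classic I}).
  have xr (l : {classic I}) : l \notin r -> x l = 0.
    by rewrite mem_undup inE negb_or => /andP[_ lx]; apply: fsuppP lx.
  have e0 l : dgprod_inj true M l i 0 = 0 by apply: dgh_fun0.
  rewrite (fsumE e0 (undup_uniq _) xr).
  rewrite -[RHS]/(dgprod_proj true M m i _).
  rewrite (big_morph _ (dgh_funD (dgprod_proj true M m) (i:=i)) (dgh_fun0 (dgprod_proj true M m) i)).
  have mr : (m : {classic I}) \in r by rewrite mem_undup mem_head.
  rewrite (bigD1_seq (m : {classic I}) mr (undup_uniq _)) /=.
  rewrite put_same big1 ?addr0 // => l /eqP lm.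
  by rewrite put_other.
rewrite /fsum (big_morph _ (dgh_funD f (i:=i)) (dgh_fun0 f i)).
rewrite (big_morph _ (dgh_funD g (i:=i)) (dgh_fun0 g i)).
by apply: eq_bigr => l _; apply: fg.
Qed.

(** The argument for products with left and right fractions exchanged. *)
Lemma dgsum_is_coproduct M :
  is_coproduct (fun l => dloc (dgprod_inj true M l)).
Proof.
move=> Y g.
have H l : exists t : {Z & (dghom Z (M l) * dghom Z Y)%type},
    quasi_iso (tagged t).1 /\ g l \oD dloc (tagged t).1 =D dloc (tagged t).2.
  have [Z [s [x [qs sx]]]] := right_fraction (g l).
  by exists (Tagged (fun Z => (dghom Z (M l) * dghom Z Y)%type) (s, x)).
pose t l := projT1 (cid (H l)); have tP l := projT2 (cid (H l)).
pose Z l := tag (t l); pose s l : dghom (Z l) (M l) := (tagged (t l)).1.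
pose x l : dghom (Z l) Y := (tagged (t l)).2.
have qs l : quasi_iso (s l) := (tP l).1.
have sx l : g l \oD dloc (s l) =D dloc (x l) := (tP l).2.
have qS : quasi_iso (dgprod_map true s) by apply: dgprod_map_quasi_iso.
have injE l i z : dgprod_map true s i (dgprod_inj true Z l i z) =
    dgprod_inj true M l i (s l i z).
  apply: rprod_eq => m /=; rewrite /put.
  by case: pselect => [e|_]; [subst m|rewrite dgh_fun0].
exists (dloc (dgsum_copair x) \oD dinv qS).
have gE l : (dloc (dgsum_copair x) \oD dinv qS) \oD dloc (dgprod_inj true M l) =D g l.
  apply: (qiso_cancelr (qs l)); rewrite sx -!dcompA -deq_loc_comp.
  rewrite (_ : dloc (dghom_comp _ _) =D
    dloc (dgprod_map true s) \oD dloc (dgprod_inj true Z l)).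
    rewrite (dcompA (dinv qS)) deq_invl deq_comp1l.
    by rewrite -deq_loc_comp; apply: dloc_eq => i z; apply: dgsum_copair_inj.
  by rewrite -deq_loc_comp; apply: dloc_eq => i z; rewrite [RHS]injE.
split=> // h' h'E; apply/dsub_eq0.
set h := dadd _ _.
have h0 l : h \oD dloc (dgprod_inj true M l) =D dzero _ _.
  by rewrite deq_compDl h'E dcompNl gE deq_addN.
move: h h0 => h h0 {h' h'E gE}.
have [Y' [r [u [qr hr]]]] := left_fraction h.
apply: (qiso_cancell qr); rewrite hr dcomp0r.
have G l : exists t : {Z & dghom Z (M l)}, quasi_iso (tagged t) /\
   homotopic (dghom_comp (dghom_comp u (dgprod_inj true M l)) (tagged t))
     (dghom_zero _ _).
  have : dloc (dghom_comp u (dgprod_inj true M l)) =D dloc (dghom_zero _ _).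
    by rewrite deq_loc_comp -hr -dcompA h0 dcomp0r.
  case/dloc_right0=> W [v [qv vu]]; exists (Tagged (fun Z => dghom Z (M l)) v).
  by split.
pose w l := tagged (projT1 (cid (G l))); have wP l := projT2 (cid (G l)).
have qw : quasi_iso (dgprod_map true w).
  by apply: dgprod_map_quasi_iso => l; case: (wP l).
apply: (qiso_cancelr qw); rewrite dcomp0l -deq_loc_comp.
pose v l := dghom_comp (dghom_comp u (dgprod_inj true M l)) (w l).
transitivity (dloc (dgsum_copair v)).
  apply: dloc_eq; apply: dghom_sum_ext => l i z.
  rewrite dgsum_copair_inj /=; congr (u i _); apply: rprod_eq => m /=; rewrite /put.
  by case: pselect => [e|_]; [subst m|rewrite dgh_fun0].
pose h1 l := projT1 (cid (wP l).2).
have h1P l := projT2 (cid (wP l).2).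
have h10 i j e l : h1 l i j e 0 = 0.
  by have [L _ _] := h1P l; apply: (is_linear0 (L i j e)).
apply: deq_loc; exists (fun i j e => fsum (fun l => h1 l i j e)); split.
- by move=> i j e; apply: fsum_linear => l; case: (h1P l) => L _ _; apply: L.
- move=> i j i' j' m e e' el el' y a; symmetry.
  apply: (fsum_map (f := fun y => dgm_act el' y a)) => //.
    exact: dgm_act_linearl.
  move=> l; case: (h1P l) => _ L _; symmetry; exact: L.
- move=> i j m e e' y; rewrite subr0 /=.
  have -> : fsum (fun l => v l i) y = fsum (fun l z => dgm_d e (h1 l i j e z) +
      h1 l m i e' (dgm_d e' z)) y.
    apply: (fsum_map (f := id)) => // [l|l|l].
    + exact: dgh_fun0.
    + by rewrite h10 !dgm_d0 h10 addr0.
    + case: (h1P l) => _ _ /(_ i j m e e' (y l)) <-.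
      by rewrite subr0.
  have -> : dgm_d e (fsum (fun l => h1 l i j e) y) =
      fsum (fun l z => dgm_d e (h1 l i j e z)) y.
    apply: fsum_map => // [|l]; first exact: dgm_d_linear.
    by rewrite h10 dgm_d0.
  have -> : fsum (fun l => h1 l m i e') (dgm_d e' y) =
      fsum (fun l z => h1 l m i e' (dgm_d e' z)) y.
    by apply: (fsum_map (f := id)) => // l; rewrite dgm_d0 h10.
  by rewrite /fsum -big_split.
Qed.

End Product.

(** * Compact objects *)

Section Points.
Variables (k : comPzRingType) (A : dgalg k).
Implicit Types X Y Z : dgmod A.

(** The Leibniz rule for the product of 1 with itself reads d 1 = d 1 + d 1. *)
Lemma dga_d_one j (e : 0 + 1 = j) : dga_d e (dga_one A) = 0.
Proof.
have e1 : j + 0 = j by rewrite addr0.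
have e2 : 0 + j = j by rewrite add0r.
have := dga_leibniz (addr0 0) e e e e1 e2 (dga_one A) (dga_one A).
rewrite dga_mul1r dga_mul1r dga_mul1l /ksign expr0 scale1r => /eqP.
by rewrite -subr_eq0 opprD addNKr oppr_eq0 => /eqP.
Qed.

Lemma one_cocyc : cocyc (dga_one A : dgreg A 0).
Proof. exact: dga_d_one. Qed.

Section Twisted.
Variables (X : dgmod A) (m : int) (x : X m).

Lemma twist_deg (i : int) : m + (i + - m) = i.
Proof. by rewrite addrC subrK. Qed.

Hypothesis cx : cocyc x.

(** The map a |-> x a needs no sign, since the sign in the differential of A[-m] is the Leibniz sign
    (-1)^m. *)
Definition twisted_point : dghom (dgshift (- m) (dgreg A)) X.
Proof.
exists (fun i (a : A (i + - m)) => dgm_act (twist_deg i) x a).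
- by move=> i; apply: dgm_act_linearr.
- move=> i j e a; rewrite /= /dgshift_d /=.
  have e1 : m + 1 + (i + - m) = j by rewrite -e; lia.
  have e2 : m + (j - m) = j by apply: twist_deg.
  rewrite (dgm_leibniz _ _ erefl (shift_deg1 (- m) e) e1 e2) cx dgm_act0l add0r.
  rewrite dgm_actZr /ksign abszN; congr (_ *: dgm_act _ _ _); exact: eq_irrelevance.
- move=> i j l e a b; symmetry; exact: dgm_actA.
Defined.

End Twisted.

(** The case m = 0, kept apart because the trivial shift of A is not convertible to A. *)
Definition reg_point X (x : X 0) (cx : cocyc x) : dghom (dgreg A) X.
Proof.
exists (fun i (a : A i) => dgm_act (add0r i) x a).
- by move=> i; apply: dgm_act_linearr.
- move=> i j e a.
  have e1 : 0 + 1 + i = j by rewrite -e; lia.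
  rewrite (dgm_leibniz _ e erefl e e1 (add0r j)) cx dgm_act0l add0r.
  by rewrite /ksign expr0 scale1r.
- move=> i j l e a b; symmetry; exact: dgm_actA.
Defined.

Lemma point_one X (x : X 0) (cx : cocyc x) : reg_point cx 0 (dga_one A) = x.
Proof. exact: dgm_act1. Qed.

Lemma point_homotopic X (x x' : X 0) (cx : cocyc x) (cx' : cocyc x') :
  bound (x - x') -> homotopic (reg_point cx) (reg_point cx').
Proof.
move=> /(boundE (addNr 1))[w xw].
have eh (i j : int) : j + 1 = i -> - 1 + i = j by lia.
exists (fun i j e (a : A i) => dgm_act (eh i j e) w a); split.
- by move=> i j e; apply: dgm_act_linearr.
- by move=> i j i' j' l e e' el el' a b; symmetry; apply: dgm_actA.
move=> i j l e e' a /=; rewrite -dgm_actBl xw.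
have e2 : - 1 + l = i by lia.
rewrite (dgm_leibniz (eh i j e) e (addNr 1) e' (add0r i) e2).
rewrite /ksign expr1 scaleN1r (eq_irrelevance (eh l i e') e2).
by rewrite subrK.
Qed.

(** A is free on a cocycle of degree 0: the unit lifts along the denominator [r] up to a coboundary,
    and the lift defines a section of [r] in D(A). Together with [point_deq] this identifies Hom(A,
    X) with H^0(X). *)
Lemma point_rep X (f : dmor (dgreg A) X) :
  exists (x : X 0) (cx : cocyc x), f =D dloc (reg_point cx).
Proof.
have [G [r [u [qr fr]]]] := right_fraction f.
have [y cy by1] := quasi_iso_surj qr one_cocyc.
exists (u 0 y), (dgh_cocyc u cy).
have ry : dloc r \oD dloc (reg_point cy) =D did (dgreg A).
  rewrite -deq_loc_comp.
  transitivity (dloc (reg_point (dgh_cocyc r cy))).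
    by apply: dloc_eq => i a; rewrite /= dgh_act.
  transitivity (dloc (reg_point one_cocyc)).
    by apply/deq_sym/deq_loc/point_homotopic.
  by apply: dloc_eq => i a; apply: dga_mul1l.
rewrite -[X in X =D _]deq_comp1r -ry dcompA fr -deq_loc_comp.
by apply: dloc_eq => i a; rewrite /= dgh_act.
Qed.

Lemma point_deq X (x x' : X 0) (cx : cocyc x) (cx' : cocyc x') :
  dloc (reg_point cx) =D dloc (reg_point cx') <-> bound (x - x').
Proof.
split; last by move=> b; apply/deq_loc/point_homotopic.
case/dloc_left => Z [l [ql /(fun h => homotopic_bound h one_cocyc)]].
rewrite [X in X - _](congr1 (l 0) (point_one cx)).
rewrite [X in _ - X](congr1 (l 0) (point_one cx')) -dgh_funB => b.
by apply: quasi_iso_inj ql _ b; apply: cocycB.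
Qed.

Lemma point_zero X (x : X 0) (cx : cocyc x) :
  dloc (reg_point cx) =D dzero _ _ <-> bound x.
Proof.
have z : dzero (dgreg A) X =D dloc (reg_point (cocyc0 X 0)).
  by apply: dloc_eq => i a; rewrite /= dgm_act0l.
rewrite z; split; first by move/point_deq; rewrite subr0.
by move=> b; apply/point_deq; rewrite subr0.
Qed.

Lemma dhom_zero_reg X : dhom_zero (dgreg A) X <-> cohom_zero_at X 0.
Proof.
split=> [z|/cohom_zeroP H f]; last first.
  by have [x [cx ->]] := point_rep f; apply/point_zero/H.
by apply/cohom_zeroP => x cx; apply/(point_zero cx)/z.
Qed.

Lemma dhom_zero_reg_shift X n :
  dhom_zero (dgreg A) (dgshift n X) <-> cohom_zero_at X n.
Proof. by rewrite dhom_zero_reg cohom_zero_shift add0r. Qed.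

Lemma uniq_NoDup (I : eqType) (r : seq I) : uniq r -> List.NoDup r.
Proof.
elim: r => [|x r IH] /=; first by constructor.
case/andP=> xr ur; constructor; last exact: IH.
by move=> xi; case/negP: xr; elim: r xi {IH ur} => //= y r IH [->|/IH];
  rewrite inE ?eqxx // => ->; rewrite orbT.
Qed.

Lemma coproduct_transport (I : Type) (X : I -> dgmod A) C C'
    (inj : forall i, dmor (X i) C) (inj' : forall i, dmor (X i) C')
    (f : dmor C C') :
  is_coproduct inj -> diso f -> (forall i, f \oD inj i =D inj' i) ->
  is_coproduct inj'.
Proof.
move=> cI [f' [f'f ff']] fi Y g; have [h [hE hu]] := cI Y g.
exists (h \oD f'); split=> [i|h' h'E].
  by rewrite -fi -dcompA (dcompA f') f'f deq_comp1l.
rewrite -[X in X =D _]deq_comp1r -ff' dcompA; apply: deq_comp => //.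
by apply: hu => i; rewrite -dcompA fi.
Qed.

(** A map from A to a direct sum is given by a cocycle of degree 0, which has finitely many nonzero
    components. *)
Lemma dcompact_reg : dcompact (dgreg A).
Proof.
move=> I X C inj cI sum.
(* The given coproduct [C] is a retract, through [t] and [t'], of the concrete direct sum, where
   components make sense. *)
pose S := dgprod true X; pose incl l := dloc (dgprod_inj true X l).
have [t [tE _]] := cI S incl.
have [t' [t'E _]] := @dgsum_is_coproduct k A I X C inj.
have t't : t' \oD t =D did C.
  have [h [_ hu]] := cI C inj; transitivity h; first apply: hu => i.
    by rewrite -dcompA tE.
  by symmetry; apply: hu => i; apply: deq_comp1l.
split.
  move=> f; have [c [cc tf]] := point_rep (t \oD f).
  have cl l : cocyc (c l) by have /dgprod_cocyc := cc; apply.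
  pose r := fsupp c; have ur : uniq r by apply: undup_uniq.
  exists r, (fun l => dloc (reg_point (cl l))); split.
    exact: (@uniq_NoDup {classic I}).
  pose G s := foldr (fun l h => dghom_add
    (dghom_comp (dgprod_inj true X l) (reg_point (cl l))) h) (dghom_zero _ S) s.
  have GE s : t' \oD dloc (G s) =D sum s (fun l => dloc (reg_point (cl l))).
    elim: s => [|l s IH] /=; first exact: dcomp0r.
    rewrite deq_loc_add deq_compDr IH deq_loc_comp dcompA t'E.
    exact: deq_refl.
  rewrite -GE -[X in X =D _]deq_comp1l -t't -dcompA tf; apply: deq_comp => //.
  apply: dloc_eq => i a; apply: rprod_eq => m /=.
  have GsE (s : seq {classic I}) : uniq s -> rp_fun (G s i a) m =
      if (m : {classic I}) \in s then dgm_act (add0r i) (c m) a else 0.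
    elim: s => [|l s IH] //= /andP[ls us]; rewrite inE IH // /put.
    case: pselect => [e|lm]; last first.
      by rewrite add0r; case: eqP => // /esym.
    by subst m; rewrite eqxx /= (negPf ls) addr0.
  rewrite GsE //; case: ifP => // /negbT mr; have -> : c m = 0 by apply: fsuppP mr.
  by rewrite dgm_act0l.
move=> r g; pose pr i : dmor C (X i) := dloc (dgprod_proj true X i) \oD t.
have prE i : pr i \oD inj i =D did _.
  rewrite -dcompA tE -deq_loc_comp; apply: dloc_eq => j x /=.
  exact: put_same.
have prN i l : l <> i -> pr i \oD inj l =D dzero _ _.
  move=> li; rewrite -dcompA tE -deq_loc_comp; apply: dloc_eq => j x /=.
  exact: put_other.
have prS i s : ~ List.In i s -> pr i \oD sum s g =D dzero _ _.
  elim: s => [|l s IH] /=; first by rewrite dcomp0r.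
  move=> /not_orP[li ni]; rewrite deq_compDr IH // dcompA prN // dcomp0l.
  exact: deq_add0.
move=> nr sr i ir; rewrite -(dcomp0r _ (pr i)) -sr {sr}.
elim: r nr ir => [|l s IH] //= nr; inversion nr; subst => -[li|is_].
  by subst l; rewrite deq_compDr dcompA prE deq_comp1l prS // deq_add0.
rewrite deq_compDr -IH // dcompA prN ?dcomp0l ?dadd0l //.
by move=> li; subst l.
Qed.

(** In each degree only finitely many factors have cohomology, so a cocycle of the product differs
    by a coboundary from its restriction to those factors. *)
Lemma dgsum_prod_quasi_iso (I : Type) (X : I -> dgmod A) :
  (forall j, exists r : seq {classic I},
     forall i : I, (i : {classic I}) \notin r -> cohom_zero_at (X i) j) ->
  exists s : dghom (dgprod true X) (dgprod false X),
    quasi_iso s /\ forall j x i, rp_fun (s j x) i = rp_fun x i.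
Proof.
move=> H.
exists (dgprod_pair (fun i => dgprod_proj true X i)); split=> //.
apply/quasi_isoP => n; split.
  move=> x /dgprod_cocyc cx /dgprod_boundP bx.
  exact/dgprod_boundP.
move=> y /dgprod_cocyc cy; have [r rz] := H n.
pose x i := if (i : {classic I}) \in r then y i else 0.
have sx : rp_supp true x.
  by exists r => i /negPf ir; rewrite /x ir.
exists (RProd sx : dgprod true X n).
  apply/dgprod_cocyc => i /=; rewrite /x; case: ifP => _ //; exact: cocyc0.
apply/dgprod_boundP => i; rewrite rprodD rprodN /= /x.
case: ifP => [_|/negbT ir]; first by rewrite subrr; apply: bound0.
by rewrite subr0; have /cohom_zeroP := rz i ir; apply.
Qed.

Definition cohom_bounded Y :=
  exists r : seq int, forall n, n \notin r -> cohom_zero_at Y n.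

(* As Y is bounded, the product of all shifts Y[n] is also their direct sum, so
   a map from c to it has only finitely many nonzero components. *)
Lemma compact_ev_zero c Y : dcompact c -> cohom_bounded Y -> ev_zero_to c Y.
Proof.
move=> cc [r rz]; pose X (n : int) := dgshift n Y.
have [j|s [qs sE]] := @dgsum_prod_quasi_iso int X.
  (* Y[n] can have cohomology in degree j only if j + n lies in [r]. *)
  exists (map (fun n => n - j) r) => n nr; apply/cohom_zero_shift/rz.
  by apply: contra nr => nr; apply/mapP; exists (j + n) => //; rewrite addrAC subrr add0r.
pose inj l := dloc (dgprod_inj false X l).
have cI : is_coproduct inj.
  apply: (coproduct_transport (@dgsum_is_coproduct k A int X) (diso_qiso qs)).
  move=> l; rewrite -deq_loc_comp; apply: dloc_eq => i x.
  by apply: rprod_eq => m; rewrite sE.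
(* [f n] is nonzero whenever some map is, so that its vanishing forces Hom(c, Y[n]) = 0. *)
have H n : exists f : dmor c (X n), f =D dzero _ _ -> dhom_zero c (X n).
  have [z|/existsNP[f nf]] := pselect (dhom_zero c (X n)).
    by exists (dzero _ _).
  by exists f.
pose f n := projT1 (cid (H n)); have fP n := projT2 (cid (H n)).
have [g [gE _]] := @dgprod_is_product k A int X c f.
have [s' [u [_ gu]]] := (cc int X _ inj cI).1 g.
exists s' => n ns; apply: fP; rewrite -/(f n) -gE gu.
elim: s' ns {gu} => [|l s' IH] /=; first by rewrite dcomp0r.
rewrite inE negb_or => /andP[/eqP nl /IH e]; rewrite deq_compDr e deq_add0.
rewrite dcompA (_ : dloc _ \oD inj l =D dzero _ _) ?dcomp0l //.
rewrite -deq_loc_comp; apply: dloc_eq => i x.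
exact: (@put_other _ _ _ X _ _ x _ (nesym nl)).
Qed.

Lemma TbP Y : Tb Y <-> cohom_bounded Y.
Proof.
split=> [/(_ _ dcompact_reg)[r rz]|bY c cc]; last exact: compact_ev_zero.
by exists r => n /rz/dhom_zero_reg_shift.
Qed.

End Points.

(** * Injectivity of Q/Z *)

Section RationalCircle.
Local Open Scope quotient_scope.
(** [QZ] is declared as a bare [zmodType]; this names the quotient type underneath, to which [\pi]
    and [repr] apply. *)
Local Notation quotQZ :=
  (Quotient.quot (GRing.ZmodClosed.clone rat (@Num.int_num_subdef rat) _)).

Definition qz (r : rat) : QZ := \pi_quotQZ r.

Lemma qz_surj (q : QZ) : exists r : rat, q = qz r.
Proof. by exists (repr (q : quotQZ)); rewrite /qz reprK. Qed.

Lemma qzD : {morph qz : r s / r + s}.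
Proof. by move=> r s; rewrite /qz !piE. Qed.

Lemma qz_eq0 (r : rat) : qz r = 0 <-> r \is a Num.int.
Proof.
have q0 : (0 : QZ) = \pi_quotQZ 0 by rewrite piE.
by rewrite q0 (rwP eqP) -Quotient.idealrBE subr0.
Qed.

Lemma qzMz (r : rat) (n : int) : qz r *~ n = qz (r *~ n).
Proof.
have qz0 : qz 0 = 0 by apply/qz_eq0; rewrite rpred0.
have qzN x : qz (- x) = - qz x.
  by apply/eqP; rewrite -addr_eq0 -qzD addNr qz0.
have qzMn x (m : nat) : qz (x *+ m) = qz x *+ m.
  by elim: m => [|m IH]; rewrite ?mulr0n // !mulrS qzD IH.
by case: n => m; rewrite ?NegzE ?mulrNz -?pmulrn ?qzN qzMn.
Qed.

(** If r / n is an integer, then (r + 1) / n is not, as n > 1; it divides the same class because 1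
    vanishes in Q/Z. *)
Lemma qz_divide (b : QZ) (n : nat) : (1 < n)%N ->
  exists2 q : QZ, q != 0 & q *~ n = b.
Proof.
move=> n1; have [r ->] := qz_surj b.
have n0 : n%:R != 0 :> rat by rewrite pnatr_eq0 -lt0n ltnW.
have dn (s : rat) : qz (s / n%:R) *~ n = qz s.
  by rewrite qzMz -mulrzr -mulrA mulVf // mulr1.
have [q0|] := eqVneq (qz (r / n%:R)) 0; last by exists (qz (r / n%:R)).
have q1 : qz 1 = 0 by apply/qz_eq0; rewrite rpred1.
exists (qz ((r + 1) / n%:R)); last by rewrite dn qzD q1 addr0.
rewrite mulrDl qzD q0 add0r mul1r; apply/eqP/qz_eq0 => /intrP[m].
move/(congr1 ( *%R n%:R)); rewrite mulfV // => /eqP.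
rewrite -[n%:R]/((n%:Z)%:~R) -intrM -[1]/(1%:~R) eqr_int => /eqP e.
have : (n%:Z %| (1 : int)%R)%Z by rewrite e dvdz_mulr.
by rewrite dvdzE /= dvdn1 => /eqP n1'; rewrite n1' in n1.
Qed.

Lemma qz_half : exists q : QZ, q != 0.
Proof. by have [q q0 _] := @qz_divide 0 2 isT; exists q. Qed.

End RationalCircle.

Local Open Scope classical_set_scope.

Section CharacterExtension.
Variable V : zmodType.
Implicit Types (G : set (V * QZ)) (x y v : V) (a b q : QZ).

(** The graph of a homomorphism from a subgroup of [V] to Q/Z. With graphs instead of functions on
    varying domains, a chain has its union as upper bound. *)
Definition partial_char G : Prop :=
  [/\ G (0, 0), forall x y a b, G (x, a) -> G (y, b) -> G (x - y, a - b)
    & forall a, G (0, a) -> a = 0].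

Section Step.
Variables (G : set (V * QZ)) (gG : partial_char G).

Lemma pchar0 : G (0, 0). Proof. by case: gG. Qed.
Lemma pcharB x y a b : G (x, a) -> G (y, b) -> G (x - y, a - b).
Proof. by case: gG => _ H _; apply: H. Qed.
Lemma pcharN x a : G (x, a) -> G (- x, - a).
Proof. by move/(pcharB pchar0); rewrite !sub0r. Qed.
Lemma pcharD x y a b : G (x, a) -> G (y, b) -> G (x + y, a + b).
Proof. by move=> Gx /pcharN/(pcharB Gx); rewrite !opprK. Qed.
Lemma pcharMz x a (n : int) : G (x, a) -> G (x *~ n, a *~ n).
Proof.
move=> Gx; have H (m : nat) : G (x *+ m, a *+ m).
  elim: m => [|m IH]; rewrite ?mulr0n ?mulrS; first exact: pchar0.
  exact: pcharD.
by case: n => m; rewrite ?NegzE ?mulrNz; [|apply: pcharN]; apply: H.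
Qed.
Lemma pchar_fun x a b : G (x, a) -> G (x, b) -> a = b.
Proof.
move=> Ga /(pcharB Ga); rewrite subrr; case: gG => _ _ H /H /eqP.
by rewrite subr_eq0 => /eqP.
Qed.

(* If no multiple of v is in the domain any q works; otherwise q is a quotient of
   a prescribed value by the least such multiple n0 > 1, unique up to 1/n0. *)
Lemma pchar_step v : (forall a, ~ G (v, a)) ->
  exists q, q != 0 /\ exists G', [/\ partial_char G', G `<=` G' & G' (v, q)].
Proof.
move=> vG.
(* If [q] agrees with [G] on the multiples of [v] in its domain, the subgroup generated by [G] and
   (v, q) is still single-valued. *)
suff [q [q0 qP]] : exists q, q != 0 /\
    forall (n : int) b, G (v *~ n, b) -> b = q *~ n.
  exists q; split=> //.
  exists [set z | exists (n : int) y b,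
    [/\ G (y, b), z.1 = y + v *~ n & z.2 = b + q *~ n]].
  split; last 1 first.
  - by exists 1, 0, 0; rewrite !add0r; split=> //; apply: pchar0.
  - split.
    + by exists 0, 0, 0; rewrite !mulr0z !addr0; split=> //; apply: pchar0.
    + move=> x y a b [n [x' [a' [Gx /= -> ->]]]] [m [y' [b' [Gy /= -> ->]]]].
      exists (n - m), (x' - y'), (a' - b'); split=> /=; first exact: pcharB.
        by rewrite mulrzBr opprD addrACA.
      by rewrite mulrzBr opprD addrACA.
    + move=> a [n [y [b [Gy /= /esym/eqP]]]].
      rewrite addrC addr_eq0 => /eqP vn ->.
      by rewrite -(qP n (- b)) ?subrr // vn; apply: pcharN.
  - by move=> [x a] Gx; exists 0, x, a; rewrite !mulr0z !addr0.
have [[m [m0 [b Gm]]]|N] := pselect (exists m : nat, (0 < m)%N /\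
    exists b, G (v *~ m, b)); last first.
  have [q q0] := qz_half; exists q; split=> // n b Gn.
  suff n0 : n = 0.
    rewrite n0 mulr0z in Gn *; exact: pchar_fun Gn pchar0.
  apply: contra_notP N => /eqP n0; exists `|n|%N; rewrite absz_gt0; split=> //.
  case: (intP n) Gn n0 => [//|m|m] Gn _; first by exists b.
  exists (- b); rewrite abszN; move/pcharN: Gn.
  by rewrite -mulrNz opprK.
have exm : exists m : nat, (0 < m)%N && `[< exists b, G (v *~ m, b) >].
  by exists m; rewrite m0; apply/asboolP; exists b.
case: (ex_minnP exm) => n0 /andP[n0_gt0 /asboolP[b0 Gn0]] n0_min.
(* n0 = 1 would put [v] in the domain; n0 > 1 is what leaves room for a nonzero [q]. *)
have n1 : (1 < n0)%N.
  rewrite ltn_neqAle n0_gt0 andbT eq_sym; apply/eqP => e1.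
  by apply: (vG b0); rewrite -[v]mulr1z; move: Gn0; rewrite e1.
have [q q0 qb] := qz_divide b0 n1; exists q; split=> // n c Gn.
(* The remainder of n modulo n0 also gives a multiple of [v] in the domain, so it is zero by
   minimality of n0. *)
have Gt : G (v *~ (n %% n0)%Z, c - b0 *~ (n %/ n0)%Z).
  have -> : v *~ (n %% n0)%Z = v *~ n - v *~ n0 *~ (n %/ n0)%Z.
    rewrite -mulrzA -mulrzBr; congr (_ *~ _).
    by rewrite {2}(divz_eq n n0) [n0%:Z * _]mulrC addrAC subrr add0r.
  by apply: pcharB => //; apply: pcharMz.
have n0z : n0%:Z != 0 by rewrite -lt0n.
have t0 : (n %% n0)%Z = 0.
  have tge : 0 <= (n %% n0)%Z by apply: modz_ge0.
  have tlt : (n %% n0)%Z < n0 by apply: ltz_pmod.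
  case: (n %% n0)%Z Gt tge tlt => // t Gt _ tlt.
  case: t Gt tlt => // t Gt tlt.
  have /n0_min : (0 < t.+1)%N && `[< exists b, G (v *~ t.+1, b) >].
    by apply/asboolP; eexists; exact: Gt.
  by rewrite leqNgt -ltz_nat tlt.
have : c - b0 *~ (n %/ n0)%Z = 0.
  by rewrite t0 mulr0z in Gt; apply: pchar_fun Gt pchar0.
move/eqP; rewrite subr_eq0 => /eqP ->; rewrite -qb -mulrzA.
by congr (_ *~ _); rewrite [in RHS](divz_eq n n0) t0 addr0 mulrC.
Qed.

End Step.

Lemma char_extend G : partial_char G ->
  exists chi : V -> QZ, {morph chi : x y / x + y} /\
    forall x a, G (x, a) -> chi x = a.
Proof.
move=> gG; pose P (B : set (V * QZ)) := B = set0 \/ (partial_char B /\ G `<=` B).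
have [F FP tF|B [PB Bmax]] := @Zorn_bigcup _ P.
  have [[X FX nX]|N] := pselect (exists2 X, F X & X <> set0); last first.
    left; apply/seteqP; split=> // z [X FX Xz].
    by case: N; exists X => // X0; rewrite X0 in Xz.
  right; have [//|[gX GX]] := FP _ FX.
  have nonempty Y z : F Y -> Y z -> partial_char Y.
    by move=> /FP[->|[]].
  split; last by move=> z /GX Xz; exists X.
  split.
  - by exists X => //; apply: pchar0.
  - move=> x y a b [Y FY Yx] [Z FZ Zy].
    have [YZ|ZY] := tF _ _ FY FZ.
      by exists Z => //; apply: (pcharB (nonempty _ _ FZ Zy)) => //; apply: YZ.
    by exists Y => //; apply: (pcharB (nonempty _ _ FY Yx)) => //; apply: ZY.
  - move=> a [Y FY Ya]; apply: (pchar_fun (nonempty _ _ FY Ya) Ya).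
    exact: pchar0 (nonempty _ _ FY Ya).
have [gB GB] : partial_char B /\ G `<=` B.
  case: PB => // B0; exfalso; apply: (Bmax G); last by right; split.
  by rewrite B0; split=> // /(_ _ (pchar0 gG)).
have tot x : exists a, B (x, a).
  apply: contrapT => /forallNP N.
  have [q [_ [B' [gB' BB' B'x]]]] := pchar_step gB N.
  apply: (Bmax B'); last by right; split=> //; apply: subset_trans GB BB'.
  by split=> // H; apply: (N q); apply: H.
pose chi x := projT1 (cid (tot x)).
have chiP x : B (x, chi x) := projT2 (cid (tot x)).
exists chi; split=> [x y|x a /GB Ba]; last exact: pchar_fun (chiP x) Ba.
by apply: (pchar_fun gB (chiP _)); apply: pcharD.
Qed.

(** Q/Z is a cogenerator: the zero character on [B] extends by one step to [v], with a nonzero value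
    there, and then to all of [V]. *)
Lemma char_separate (B : V -> Prop) v :
  B 0 -> (forall x y, B x -> B y -> B (x - y)) -> ~ B v ->
  exists chi : V -> QZ, [/\ {morph chi : x y / x + y},
    forall x, B x -> chi x = 0 & chi v <> 0].
Proof.
move=> B0 BB vB; pose G := [set z : V * QZ | B z.1 /\ z.2 = 0].
have gG : partial_char G.
  split=> [|x y a b [Bx /= ->] [By /= ->]|a []//]; first by split.
  by split; [apply: BB|rewrite /= subrr].
have [a [] //|q [q0 [G' [gG' GG' Gv]]]] := @pchar_step G gG v.
have [chi [chiD chiE]] := char_extend gG'; exists chi; split=> // [x Bx|].
  by apply/chiE/GG'.
by rewrite (chiE _ _ Gv); apply/eqP.
Qed.

End CharacterExtension.

(** Injectivity of Q/Z: [chi] kills the kernel of [u], so it descends to the image and extends from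
    there. *)
Lemma char_lift (V W : zmodType) (u : V -> W) (chi : V -> QZ) :
  {morph u : x y / x + y} -> {morph chi : x y / x + y} ->
  (forall x, u x = 0 -> chi x = 0) ->
  exists psi : W -> QZ, {morph psi : x y / x + y} /\ forall x, psi (u x) = chi x.
Proof.
move=> uD cD uc.
have morphB (U U' : zmodType) (f : U -> U') : {morph f : x y / x + y} ->
    {morph f : x y / x - y}.
  move=> fD x y; apply/eqP; rewrite -subr_eq opprK.
  by rewrite eq_sym -fD subrK.
have morph0 (U U' : zmodType) (f : U -> U') : {morph f : x y / x + y} -> f 0 = 0.
  by move=> fD; rewrite -(subrr (0 : U)) (morphB _ _ f fD) subrr.
pose G := [set z : W * QZ | exists x, z.1 = u x /\ z.2 = chi x].
have gG : partial_char G.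
  split.
  - by exists 0; rewrite (morph0 _ _ u) // (morph0 _ _ chi).
  - move=> x y a b [x' [/= -> ->]] [y' [/= -> ->]].
    by exists (x' - y'); rewrite (morphB _ _ u) // (morphB _ _ chi).
  - by move=> a [x [/= /esym/uc e ->]].
have [psi [psiD psiE]] := char_extend gG; exists psi; split=> // x.
by apply: psiE; exists x.
Qed.

Local Close Scope classical_set_scope.

(** * The Brown-Comenetz dual of A *)

Section CharacterModule.
Variables (k : comPzRingType) (V : lmodType k).

Record charmod := CharMod {
  charmod_fun :> V -> QZ;
  charmodD : {morph charmod_fun : x y / x + y}
}.

HB.instance Definition _ := gen_eqMixin charmod.
HB.instance Definition _ := gen_choiceMixin charmod.

Lemma charmod_eq (f g : charmod) : (forall x, f x = g x) -> f = g.
Proof.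
case: f g => [f hf] [g hg] /= fg; have {}fg : f = g by apply/funext.
by subst g; rewrite (Prop_irrelevance hf hg).
Qed.

Lemma charmod0r (f : charmod) : f 0 = 0.
Proof. by apply: (addIr (f 0)); rewrite -charmodD !add0r. Qed.
Lemma charmodN (f : charmod) x : f (- x) = - f x.
Proof. by apply/eqP; rewrite -addr_eq0 -charmodD addNr charmod0r. Qed.

Definition charmod_zero : charmod.
Proof. by exists (fun=> 0) => x y; rewrite addr0. Defined.
Definition charmod_add (f g : charmod) : charmod.
Proof. by exists (fun x => f x + g x) => x y; rewrite !charmodD addrACA. Defined.
Definition charmod_opp (f : charmod) : charmod.
Proof. by exists (fun x => - f x) => x y; rewrite charmodD opprD. Defined.
Definition charmod_scale (c : k) (f : charmod) : charmod.
Proof. by exists (fun x => f (c *: x)) => x y; rewrite scalerDr charmodD. Defined.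

Lemma charmod_addA : associative charmod_add.
Proof. by move=> f g h; apply: charmod_eq => x /=; rewrite addrA. Qed.
Lemma charmod_addC : commutative charmod_add.
Proof. by move=> f g; apply: charmod_eq => x /=; rewrite addrC. Qed.
Lemma charmod_add0 : left_id charmod_zero charmod_add.
Proof. by move=> f; apply: charmod_eq => x /=; rewrite add0r. Qed.
Lemma charmod_addN : left_inverse charmod_zero charmod_opp charmod_add.
Proof. by move=> f; apply: charmod_eq => x /=; rewrite addNr. Qed.

HB.instance Definition _ := GRing.isZmodule.Build charmod
  charmod_addA charmod_addC charmod_add0 charmod_addN.

Lemma charmod_scaleA (a b : k) (f : charmod) :
  charmod_scale a (charmod_scale b f) = charmod_scale (a * b) f.
Proof. by apply: charmod_eq => x /=; rewrite scalerA mulrC. Qed.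
Lemma charmod_scale1 : left_id 1 charmod_scale.
Proof. by move=> f; apply: charmod_eq => x /=; rewrite scale1r. Qed.
Lemma charmod_scaleDr : right_distributive charmod_scale +%R.
Proof. by move=> a f g; apply: charmod_eq. Qed.
Lemma charmod_scaleDl (f : charmod) : {morph charmod_scale^~ f : a b / a + b}.
Proof. by move=> a b; apply: charmod_eq => x /=; rewrite scalerDl charmodD. Qed.

HB.instance Definition _ := GRing.Zmodule_isLmodule.Build k charmod
  charmod_scaleA charmod_scale1 charmod_scaleDr charmod_scaleDl.

End CharacterModule.

Definition charmod_comp (k : comPzRingType) (V W : lmodType k) (f : charmod W)
  (u : V -> W) (uL : linear u) : charmod V.
Proof. by exists (fun x => f (u x)) => x y; rewrite (is_linearD uL) charmodD. Defined.

Lemma ksignS (k : comPzRingType) (i : int) : ksign k (i + 1) = - ksign k i.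
Proof. by rewrite ksignD [ksign k 1]/ksign expr1 mulrN1. Qed.

Section Dual.
Variables (k : comPzRingType) (A : dgalg k).
Implicit Types X Y : dgmod A.

Lemma dual_deg1 (i j : int) : i + 1 = j -> - j + 1 = - i.
Proof. by lia. Qed.

Lemma dual_deg (i j l : int) : i + j = l -> j + - l = - i.
Proof. by lia. Qed.

(* The sign (-1)^(i + 1) in d makes the Leibniz rule hold with the action
   (f b)(a) = f (b a) free of signs. *)
Definition dual_d i j (e : i + 1 = j) (f : charmod (A (- i))) : charmod (A (- j)) :=
  ksign k (i + 1) *: charmod_comp f (dga_d_linear (dual_deg1 e)).
Definition dual_act i j l (e : i + j = l) (f : charmod (A (- i))) (b : A j) :
    charmod (A (- l)) :=
  charmod_comp f (dga_mul_linearr (dual_deg e) b).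

Definition dgdual : dgmod A.
Proof.
exists (fun i => charmod (A (- i)) : lmodType k) dual_d dual_act.
- move=> i j e c f g; apply: charmod_eq => a.
  pose D (x : A (- j)) := dga_d (dual_deg1 e) (ksign k (i + 1) *: x).
  rewrite -[LHS]/(f (c *: D a) + g (D a)) -[RHS]/(f (D (c *: a)) + g (D a)).
  congr (f _ + _); rewrite /D !(is_linearZ (dga_d_linear _)) !scalerA.
  by rewrite mulrC.
- move=> i j l e b c f g; apply: charmod_eq => a.
  pose D x := dga_mul (dual_deg e) b x.
  rewrite -[LHS]/(f (c *: D a) + g (D a)) -[RHS]/(f (D (c *: a)) + g (D a)).
  by rewrite /D (is_linearZ (dga_mul_linearr _ _)).
- move=> i j l e f c b b'; apply: charmod_eq => a.
  pose D (x : A j) (y : A (- l)) := dga_mul (dual_deg e) x y.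
  rewrite -[LHS]/(f (D (c *: b + b') a)) -[RHS]/(f (D b (c *: a)) + f (D b' a)).
  rewrite /D (is_linearZ (dga_mul_linearr _ _)) -charmodD.
  by rewrite (is_linearD (dga_mul_linearl _ _)) (is_linearZ (dga_mul_linearl _ _)).
- by move=> i e f; apply: charmod_eq => a /=; rewrite dga_mul1l.
- move=> h i j hi ij hij e1 e2 e3 e4 f a b; apply: charmod_eq => c /=.
  congr (charmod_fun f _); symmetry; exact: dga_mulA.
- move=> i j l e e' f; apply: charmod_eq => a.
  rewrite -[LHS]/(f (dga_d (dual_deg1 e) (ksign k (i + 1) *:
    dga_d (dual_deg1 e') (ksign k (j + 1) *: a)))).
  by rewrite (is_linearZ (dga_d_linear _)) dga_dd scaler0; apply: charmod0r.
- move=> i j l i1 j1 l1 e el ei ej e1 e2 f b; apply: charmod_eq => a.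
  rewrite -[LHS]/(f (dga_mul (dual_deg e) b (dga_d (dual_deg1 el) (ksign k (l + 1) *: a)))).
  rewrite -[RHS]/(f (dga_d (dual_deg1 ei) (ksign k (i + 1) *: dga_mul (dual_deg e1) b a)) +
    f (dga_mul (dual_deg e2) (dga_d ej b) (ksign k i *: a))).
  rewrite -charmodD; congr (charmod_fun f _).
  rewrite !(is_linearZ (dga_d_linear _)) !(is_linearZ (dga_mul_linearr _ _)).
  rewrite (dga_leibniz (dual_deg e1) (dual_deg1 ei) ej (dual_deg1 el) (dual_deg e2)
    (dual_deg e)) scalerDr scalerA -addrA addrCA -scalerDl.
  have -> : ksign k (i + 1) + ksign k i = 0 by rewrite ksignS addNr.
  by rewrite scale0r addr0; congr (_ *: _); rewrite -e !ksignS ksignD mulNr.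
Defined.

(** A cocycle [f] of the dual vanishes on coboundaries, hence by hypothesis on all cocycles of
    degree [- n]; it therefore factors through d, and the factor extends because Q/Z is
    injective. *)
Lemma dual_cohom_zero n : cohom_zero_at (dgreg A) (- n) -> cohom_zero_at dgdual n.
Proof.
move/cohom_zeroP => H; apply/cohom_zeroP => f cf.
have e : n - 1 + 1 = n := subrK 1 n.
have fd0 (a : A (- (n + 1))) : f (dga_d (dual_deg1 erefl) a) = 0.
  have := congr1 (fun g : charmod _ => g (ksign k (n + 1) *: a)) cf.
  rewrite -[LHS]/(f (dga_d (dual_deg1 erefl) (ksign k (n + 1) *:
    (ksign k (n + 1) *: a)))) -[RHS]/(0 : QZ).
  by rewrite scalerA ksignMK scale1r.
have [|||psi [psiD psiE]] := @char_lift _ _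
  (dga_d (dual_deg1 e) : A (- n) -> A (- (n - 1))) f.
- exact: (is_linearD (dga_d_linear _)).
- exact: charmodD.
- move=> a da; have /(boundE (dual_deg1 erefl))[b ->] : bound (a : dgreg A (- n)).
    by apply: H; apply/(cocycE (dual_deg1 e)).
  exact: fd0.
pose g : dgdual (n - 1) := CharMod psiD.
apply/(boundE e); exists (ksign k n *: g); apply: charmod_eq => a.
rewrite -[RHS]/(psi (ksign k n *: dga_d (dual_deg1 e) (ksign k (n - 1 + 1) *: a))).
rewrite -(is_linearZ (dga_d_linear _)) scalerA e ksignMK scale1r.
by rewrite psiE.
Qed.

(** The unit in degrees such as [m + - m], which equal 0 without being convertible to it. *)
Definition one_at j (e : 0 = j) : A j := dcast (M := dgreg A) e (dga_one A).

Lemma d_one_at j l (e : 0 = j) (e' : j + 1 = l) : dga_d e' (one_at e) = 0.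
Proof. by case: j / e e' => e'; apply: dga_d_one. Qed.

Lemma act_one_at X i j (e : i + j = i) (e' : 0 = j) (x : X i) :
  dgm_act e x (one_at e') = x.
Proof. by case: j / e' e => e; apply: dgm_act1. Qed.

Lemma mul_one_at i j (e : i + j = i) (e' : 0 = j) (b : A i) :
  dga_mul e b (one_at e') = b.
Proof. by case: j / e' e => e; apply: dga_mul1r. Qed.

(** As d 1 = 0, evaluation at the unit descends to the cohomology of the dual. *)
Lemma dual_bound_one i (e : 0 = - i) (f : dgdual i) : bound f -> f (one_at e) = 0.
Proof.
case=> m [e' [g ->]].
rewrite -[LHS]/(g (dga_d (dual_deg1 e') (ksign k (m + 1) *: one_at e))).
by rewrite (is_linearZ (dga_d_linear _)) d_one_at scaler0 charmod0r.
Qed.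

Section CharacterMap.
Variables (X : dgmod A) (m : int) (chi : X m -> QZ).
Hypothesis chiD : {morph chi : x y / x + y}.
Hypothesis chi_bound : forall x, bound x -> chi x = 0.

Lemma char_map_deg (i : int) : i + - (i + - m) = m.
Proof. by lia. Qed.

Let chi_mod := CharMod chiD.

Definition char_fun i (x : X i) : charmod (A (- (i + - m))) :=
  charmod_comp chi_mod (dgm_act_linearr (char_map_deg i) x).

(** Sends x to the functional a |-> chi (x a). It commutes with the differentials because [chi]
    kills the coboundary d (x a). *)
Definition char_map : dghom X (dgshift (- m) dgdual).
Proof.
exists (fun i x => char_fun x : dgshift (- m) dgdual i).
- move=> i c x y; apply: charmod_eq => a.
  rewrite -[RHS]/(chi (dgm_act (char_map_deg i) x (c *: a)) +
    chi (dgm_act (char_map_deg i) y a)) /=.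
  by rewrite -chiD dgm_actDl dgm_actZl dgm_actZr.
- move=> i j e x; apply: charmod_eq => a.
  have e1 : i + (- (j - m) + 1) = m by lia.
  have e2 : - (j - m) + 1 = - (i - m) by lia.
  rewrite -[LHS]/(chi (dgm_act (char_map_deg j) (dgm_d e x) a)).
  rewrite -[RHS]/(chi (dgm_act (char_map_deg i) x
    (dga_d (dual_deg1 (shift_deg1 (- m) e))
       (ksign k (i - m + 1) *: (ksign k (- m) *: a))))).
  rewrite scalerA -ksignD.
  have -> : i - m + 1 - m = i + 1 - m - m by lia.
  rewrite ksignD ksignD -mulrA ksignMK mulr1.
  rewrite (is_linearZ (dga_d_linear _)) dgm_actZr ksignS scaleNr.
  rewrite -[chi]/(charmod_fun chi_mod) charmodN; apply/eqP; rewrite -addr_eq0 -charmodD.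
  have ea : i + - (j - m) = m - 1 by lia.
  rewrite -(dgm_leibniz ea (subrK 1 m) e _ (char_map_deg j) (char_map_deg i)) /=.
  by rewrite chi_bound //; apply: bound_d.
- move=> i j l e x b; apply: charmod_eq => a.
  rewrite -[LHS]/(chi (dgm_act (char_map_deg l) (dgm_act e x b) a)).
  rewrite -[RHS]/(chi (dgm_act (char_map_deg i) x
    (dga_mul (dual_deg (shift_deg (- m) e)) b a))).
  by congr chi; apply: dgm_actA.
Defined.

End CharacterMap.

End Dual.

(** * The dual of A represents the characters of H^0 *)

Section DualRepresents.
Variables (k : comPzRingType) (A : dgalg k).
Implicit Types X Y : dgmod A.

Lemma char_map_one X m (chi : X m -> QZ) (chiD : {morph chi : x y / x + y})
    (chib : forall x, bound x -> chi x = 0) (x : X m) (e : 0 = - (m + - m)) :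
  charmod_fun (char_map chiD chib m x : charmod (A (- (m + - m)))) (one_at A e)
    = chi x.
Proof.
rewrite -[LHS]/(chi (dgm_act (char_map_deg m m) x (one_at A e))).
have e' : m + - (m + - m) = m by lia.
by rewrite (eq_irrelevance (char_map_deg m m) e') act_one_at.
Qed.

(** Injectivity of Q/Z writes a character vanishing on cocycles as [psi] after d; then x |-> (a |->
    psi (x a)) is the null-homotopy. *)
Lemma char_map_null X m (chi : X m -> QZ) (chiD : {morph chi : x y / x + y})
    (chib : forall x, bound x -> chi x = 0) :
  (forall x, cocyc x -> chi x = 0) ->
  homotopic (char_map chiD chib) (dghom_zero _ _).
Proof.
move=> chi0.
have [|||psi [psiD psiE]] := @char_lift _ _
  (dgm_d erefl : X m -> X (m + 1)) chi => //.
  exact: (is_linearD (dgm_d_linear _)).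
pose psi' := CharMod psiD.
have eh (i j : int) : j + 1 = i -> i + - (j + - m) = m + 1 by lia.
exists (fun i j e (x : X i) =>
  charmod_comp psi' (dgm_act_linearr (eh i j e) x) : dgshift (- m) (dgdual A) j).
split.
- move=> i j e c x y; apply: charmod_eq => a.
  rewrite -[RHS]/(psi (dgm_act (eh i j e) x (c *: a)) + psi (dgm_act (eh i j e) y a)).
  rewrite -[LHS]/(psi (dgm_act (eh i j e) (c *: x + y) a)).
  by rewrite -psiD dgm_actDl dgm_actZl dgm_actZr.
- move=> i j i' j' l e e' el el' x b; apply: charmod_eq => a.
  rewrite -[LHS]/(psi (dgm_act (eh i' j' e') (dgm_act el x b) a)).
  rewrite -[RHS]/(psi (dgm_act (eh i j e) x
    (dga_mul (dual_deg (shift_deg (- m) el')) b a))).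
  by congr psi; apply: dgm_actA.
- move=> i j l e e' x; apply: charmod_eq => a.
  rewrite -[RHS]/(psi (dgm_act (eh i j e) x
    (dga_d (dual_deg1 (shift_deg1 (- m) e))
       (ksign k (j - m + 1) *: (ksign k (- m) *: a))))
    + psi (dgm_act (eh l i e') (dgm_d e' x) a)).
  rewrite -[LHS]/(chi (dgm_act (char_map_deg m i) x a) - 0) subr0.
  rewrite scalerA -ksignD.
  have -> : j - m + 1 - m = i - m - m by lia.
  rewrite ksignD ksignD -mulrA ksignMK mulr1.
  rewrite (is_linearZ (dga_d_linear _)) dgm_actZr -psiD -psiE (addrC (_ *: _)).
  congr psi; exact: dgm_leibniz.
Qed.

Lemma dcast_dual i j (e : i = j) (e' : - j = - i) (f : dgdual A i) (a : A (- j)) :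
  charmod_fun (dcast e f : charmod (A (- j))) a =
  charmod_fun (f : charmod (A (- i))) (dcast (M := dgreg A) e' a).
Proof. by case: j / e e' a => e' a; rewrite !dcast_id. Qed.

Lemma act_dcast X i j j' l (e : i + j = l) (e' : i + j' = l) (ej : j = j')
    (x : X i) (a : A j) :
  dgm_act e' x (dcast (M := dgreg A) ej a) = dgm_act e x a.
Proof. by case: j' / ej e' => e'; rewrite (eq_irrelevance e e'). Qed.

Section Maps.
Variables (X : dgmod A) (chi : X 0 -> QZ).
Hypothesis chiD : {morph chi : x y / x + y}.
Hypothesis chi_bound : forall x, bound x -> chi x = 0.

Definition dual_map : dghom X (dgdual A) :=
  dghom_comp (unshift0 (dgdual A)) (char_map chiD chi_bound).

Lemma dual_mapE i (e : i + - i = 0) (x : X i) (a : A (- i)) :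
  charmod_fun (dual_map i x : charmod (A (- i))) a = chi (dgm_act e x a).
Proof.
have e1 : - i = - (i + 0) by rewrite addr0.
rewrite (dcast_dual (addr0 i) e1).
rewrite -[LHS]/(chi (dgm_act (char_map_deg 0 i) x (dcast (M := dgreg A) e1 a))).
congr chi; exact: (act_dcast e (char_map_deg 0 i) e1).
Qed.

Lemma dual_map_null : (forall x, cocyc x -> chi x = 0) ->
  dloc dual_map =D dzero _ _.
Proof.
move=> chi0; rewrite (deq_loc_comp (unshift0 (dgdual A)))
  (deq_loc (char_map_null chiD chi_bound chi0)).
exact: dcomp0r.
Qed.

End Maps.

Lemma one_at0 : 0 = - 0 :> int. Proof. by rewrite oppr0. Qed.

Definition dual_eval X (u : dghom X (dgdual A)) (x : X 0) : QZ :=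
  charmod_fun (u 0 x : charmod (A (- 0))) (one_at A one_at0).

Lemma dual_evalD X (u : dghom X (dgdual A)) : {morph dual_eval u : x y / x + y}.
Proof. by move=> x y; rewrite /dual_eval dgh_funD. Qed.

Lemma dual_eval_bound X (u : dghom X (dgdual A)) (x : X 0) :
  bound x -> dual_eval u x = 0.
Proof. by move/(dgh_bound u); apply: dual_bound_one. Qed.

(** By A-linearity a strict map into the dual is determined by its values at the unit: (u x) a = (u
    (x a)) 1. *)
Lemma dual_map_eval X (u : dghom X (dgdual A)) i x :
  u i x = dual_map (dual_evalD u) (@dual_eval_bound X u) i x.
Proof.
apply: charmod_eq => a; rewrite (dual_mapE _ _ (subrr i)).
rewrite /dual_eval dgh_act.
rewrite -[RHS]/(charmod_fun (u i x : charmod (A (- i)))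
  (dga_mul (dual_deg (subrr i)) a (one_at A one_at0))).
have e : - i + - 0 = - i by rewrite oppr0 addr0.
by rewrite (eq_irrelevance (dual_deg (subrr i)) e) mul_one_at.
Qed.

(** The universal character: evaluation at the unit of a cocycle representing [h] in H^0 of the
    dual. The choice of representative is harmless by [dual_eval_bound]. *)
Definition point_eval (h : dmor (dgreg A) (dgdual A)) : QZ :=
  dual_eval (dghom_id (dgdual A)) (projT1 (cid (point_rep h))).

Lemma point_evalE h (c : dgdual A 0) (cc : cocyc c) :
  h =D dloc (reg_point cc) -> point_eval h = dual_eval (dghom_id (dgdual A)) c.
Proof.
rewrite /point_eval; case: cid => /= x [cx ->] /point_deq b.
apply/eqP; rewrite -subr_eq0.
by have <- := dual_eval_bound (dghom_id _) b.
Qed.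

Lemma point_eval_deq h h' : h =D h' -> point_eval h = point_eval h'.
Proof.
have [c [cc e]] := point_rep h'.
by move=> hh'; rewrite (point_evalE e); apply: point_evalE; rewrite hh'.
Qed.

Lemma point_evalD h h' : point_eval (h +D h') = point_eval h + point_eval h'.
Proof.
have [c [cc e]] := point_rep h; have [c' [cc' e']] := point_rep h'.
rewrite (point_evalE e) (point_evalE e') -dual_evalD.
apply: (point_evalE (cc := cocycD cc cc')).
rewrite e e' -deq_loc_add; apply: dloc_eq => i a.
by rewrite [RHS]dgm_actDl.
Qed.

(** The hypothesis says that the character corresponding to the numerator [u] vanishes on cocycles,
    so [u] is null-homotopic. *)
Lemma dual_point_zero X (h : dmor X (dgdual A)) :
  (forall g : dmor (dgreg A) X, point_eval (h \oD g) = 0) -> h =D dzero _ _.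
Proof.
move=> h0; have [X' [r [u [qr hr]]]] := right_fraction h.
apply: (qiso_cancelr qr); rewrite hr dcomp0l (dloc_eq (dual_map_eval u)).
apply: dual_map_null => x cx.
rewrite -(h0 (dloc r \oD dloc (reg_point cx))); symmetry.
apply: (point_evalE (cc := dgh_cocyc u cx)).
rewrite dcompA hr -deq_loc_comp; apply: dloc_eq => i a.
by rewrite [LHS]dgh_act.
Qed.

Lemma point_add X (x y : X 0) (cx : cocyc x) (cy : cocyc y) (cxy : cocyc (x + y)) :
  dloc (reg_point cxy) =D dloc (reg_point cx) +D dloc (reg_point cy).
Proof.
by rewrite -deq_loc_add; apply: dloc_eq => i a; rewrite [LHS]dgm_actDl.
Qed.

Lemma dchar_dzero (s t : dgmod A) (c : dchar s t) : c (dzero s t) = 0.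
Proof.
apply: (addIr (c (dzero s t))); rewrite -dchar_add add0r.
by apply: dchar_deq; apply: deq_add0.
Qed.

(** The pairing sends (f, g) to [point_eval] of f after g. For surjectivity, a character of Hom(A,
    x) = H^0(x) is read as a partial character on cocycles and extended to all of [x 0]; [dual_map]
    makes a map of it. *)
Lemma bc_dual_reg : bc_dual (dgreg A) (dgdual A).
Proof.
have ev1 x (f : dmor x (dgdual A)) (g g' : dmor (dgreg A) x) :
    g =D g' -> point_eval (f \oD g) = point_eval (f \oD g').
  by move=> gg'; apply: point_eval_deq; rewrite gg'.
have ev2 x (f : dmor x (dgdual A)) (g g' : dmor (dgreg A) x) :
    point_eval (f \oD (g +D g')) = point_eval (f \oD g) + point_eval (f \oD g').
  by rewrite -point_evalD; apply/point_eval_deq/deq_compDr.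
exists (fun x f => DChar (ev1 x f) (ev2 x f)); split.
- move=> x f f'; split=> [ff' g|ff'] /=.
    by apply: point_eval_deq; rewrite ff'.
  apply/dsub_eq0/dual_point_zero => g.
  have := point_evalD ((f +D dopp f') \oD g) (f' \oD g).
  rewrite -[point_eval (f' \oD g)]add0r => e.
  have e2 : point_eval ((f +D dopp f') \oD g +D f' \oD g) = point_eval (f' \oD g).
    rewrite -[RHS](ff' g) /=; apply: point_eval_deq.
    rewrite -deq_compDl -deq_addA (deq_addC (dopp f')) deq_addN.
    by rewrite deq_add0.
  by apply: (addIr (point_eval (f' \oD g))); rewrite add0r -point_evalD.
- move=> x c.
  pose G := [set z : (x 0 * QZ)%type | exists cz : cocyc z.1, z.2 = c (dloc (reg_point cz))]%classic.
  have cD (y z : x 0) (cy : cocyc y) (cz : cocyc z) (cyz : cocyc (y + z)) :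
      c (dloc (reg_point cyz)) = c (dloc (reg_point cy)) + c (dloc (reg_point cz)).
    by rewrite -dchar_add; apply/dchar_deq/point_add.
  have c0 (y : x 0) (cy : cocyc y) : bound y -> c (dloc (reg_point cy)) = 0.
    by move=> /(point_zero cy)/(dchar_deq c) ->; apply: dchar_dzero.
  have gG : partial_char G.
    split.
    - by exists (cocyc0 x 0); rewrite c0 //; apply: bound0.
    - move=> y z a b [/= cy ->] [/= cz ->]; exists (cocycB cy cz) => /=.
      rewrite (cD _ _ _ (cocycN cz)); congr (_ + _); symmetry; apply/eqP.
      rewrite -addr_eq0 addrC -(cD _ _ _ _ (cocycD cz (cocycN cz))).
      by apply/eqP/c0; rewrite subrr; apply: bound0.
    - by move=> a [/= cz ->]; apply/c0/bound0.
  have [chi [chiD chiE]] := char_extend gG.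
  have chiz (z : x 0) (cz : cocyc z) : chi z = c (dloc (reg_point cz)).
    by apply: chiE; exists cz.
  have chib (z : x 0) : bound z -> chi z = 0.
    by move=> bz; rewrite (chiz z (bound_cocyc bz)) c0.
  exists (dloc (dual_map chiD chib)) => g /=.
  have [z [cz ez]] := point_rep g.
  rewrite (dchar_deq c ez) -chiz (ev1 _ _ _ _ ez).
  rewrite (point_evalE (cc := dgh_cocyc (dual_map chiD chib) cz)); last first.
    by rewrite -deq_loc_comp; apply: dloc_eq => i a; rewrite [LHS]dgh_act.
  rewrite /dual_eval /= (dual_mapE chiD chib (subrr 0)).
  by rewrite act_one_at.
- by move=> x f f' g /=; rewrite -point_evalD; apply/point_eval_deq/deq_compDl.
- by move=> x y h f g /=; apply/point_eval_deq/deq_sym/deq_compA.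
Qed.

End DualRepresents.

(** * Resolutions by free and cofree modules *)

Section Amplitude.
Variables (k : comPzRingType) (A : dgalg k).
Implicit Types M N X Y s t : dgmod A.

Lemma cohom_zero_bound M n (x : M n) : cohom_zero_at M n -> cocyc x -> bound x.
Proof. by move/cohom_zeroP; apply. Qed.

Definition amplitude M (lo hi : int) : Prop :=
  forall i, (i < lo) || (hi < i) -> cohom_zero_at M i.

Lemma absz_bound (r : seq int) :
  exists N : nat, forall x, x \in r -> (`|x| <= N)%N.
Proof.
exists (\max_(x <- r) `|x|%N) => x xr.
exact: (@leq_bigmax_seq _ _ xpredT (fun x : int => `|x|%N)).
Qed.

Lemma amplitudeP M : cohom_bounded M <-> exists lo hi, amplitude M lo hi.
Proof.
split=> [[r rz]|[lo [hi H]]].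
  have [N rN] := absz_bound r; exists (- N%:Z), N%:Z => i iN; apply: rz.
  by apply/negP => /rN; lia.
exists [seq lo + Posz n | n <- iota 0 `|hi - lo|.+1] => n nr; apply: H.
apply: contraR nr => H; apply/mapP; exists `|n - lo|%N; last by lia.
by rewrite mem_iota; lia.
Qed.

Lemma fresh_nat (r : seq int) (c : int) : exists n : nat, (n%:Z - c) \notin r.
Proof.
have [N rN] := absz_bound r; exists (N + `|c|).+1; apply/negP => /rN; lia.
Qed.

Lemma amplitude_cone M N (f : dghom M N) lo hi lo' hi' :
  amplitude N lo hi -> amplitude M lo' hi' ->
  amplitude (dgcone f) (Num.min lo (lo' - 1)) (Num.max hi (hi' - 1)).
Proof.
move=> aN aM i ir; apply: cone_cohom_zero => [y cy|x cx _].
  exists 0; first exact: cocyc0.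
  rewrite dgh_fun0 subr0; apply: (cohom_zero_bound (aN i _)) => //; lia.
by apply: (cohom_zero_bound (aM (i + 1) _)) => //; lia.
Qed.

Lemma amplitude_shift M n lo hi :
  amplitude M lo hi -> amplitude (dgshift n M) (lo - n) (hi - n).
Proof. by move=> aM i ir; apply/cohom_zero_shift/aM; lia. Qed.

Lemma amplitude_prod fin (I : Type) (X : I -> dgmod A) lo hi :
  (forall i, amplitude (X i) lo hi) -> amplitude (dgprod fin X) lo hi.
Proof. by move=> aX j jr; apply: dgprod_cohom_zero => i; apply: aX. Qed.

Lemma acyclic_id0 X : acyclic X -> did X =D dzero X X.
Proof.
move=> aX; have q : quasi_iso (dghom_zero X X).
  apply/quasi_isoP => n; have /cohom_zeroP H := aX n.
  split=> [x cx _|y cy]; first exact: H.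
  by exists 0; [apply: cocyc0|rewrite subr0; apply: H].
apply: (qiso_cancell q); rewrite -!deq_loc_comp; exact: dloc_eq.
Qed.

Section ShiftProd.
Variables (fin : bool) (I : Type) (X : I -> dgmod A) (n : int).

Definition shift_prod : dghom (dgshift n (dgprod fin X))
  (dgprod fin (fun i => dgshift n (X i))).
Proof.
exists (fun i (x : dgshift n (dgprod fin X) i) =>
  x : dgprod fin (fun i => dgshift n (X i)) i).
- by move=> i c x y; apply: rprod_eq.
- by move=> i j e x; apply: rprod_eq.
- by move=> i j l e x a; apply: rprod_eq.
Defined.

Definition prod_shift : dghom (dgprod fin (fun i => dgshift n (X i)))
  (dgshift n (dgprod fin X)).
Proof.
exists (fun i (x : dgprod fin (fun i => dgshift n (X i)) i) =>
  x : dgshift n (dgprod fin X) i).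
- by move=> i c x y; apply: rprod_eq.
- by move=> i j e x; apply: rprod_eq.
- by move=> i j l e x a; apply: rprod_eq.
Defined.

Lemma diso_shift_prod : diso (dloc shift_prod).
Proof. by apply: (@diso_strict _ _ _ _ _ prod_shift). Qed.

End ShiftProd.

Section ConeSwap.
Variables (S T Q : dgmod A).

(* For f : T -> S and q : Q -> S the two iterated cones below have the same
   underlying graded module S (+) T[1] (+) Q[1]. *)
Definition cone_swap (f : dghom T S) (q : dghom Q S) :
  dghom (dgcone (dghom_comp (cone_in f) q)) (dgcone (dghom_comp (cone_in q) f)).
Proof.
exists (fun i (z : dgcone (dghom_comp (cone_in f) q) i) =>
  ((z.1.1, z.2), z.1.2) : dgcone (dghom_comp (cone_in q) f) i).
- by [].
- move=> i j e; case: j / e => -[[y x] w] /=.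
  congr (_, _); [congr (_, _)|] => /=; rewrite ?addr0 //.
  by rewrite addrAC.
- by [].
Defined.

End ConeSwap.

Lemma diso_cone_swap S T Q (f : dghom T S) (q : dghom Q S) : diso (dloc (cone_swap f q)).
Proof.
apply: (@diso_strict _ _ _ _ _ (cone_swap q f)); first by move=> i [[y x] w].
by move=> i [[y x] w].
Qed.

Section ConeSwapOut.
Variables (S T E : dgmod A).

(** Both iterated cones are T[1] (+) E[1] (+) S[2] as graded modules. The signs with which [g] and
    [q] enter the differential are interchanged between them, and the sign on S[2] absorbs this. *)
Definition cone_swap_out (g : dghom S T) (q : dghom S E) :
  dghom (dgcone (dghom_comp (dghom_shift 1 g) (cone_out q)))
        (dgcone (dghom_comp (dghom_shift 1 q) (cone_out g))).
Proof.
exists (fun i (z : dgcone (dghom_comp (dghom_shift 1 g) (cone_out q)) i) =>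
  (z.2.1, (z.1, - z.2.2)) : dgcone (dghom_comp (dghom_shift 1 q) (cone_out g)) i).
- move=> i c z z'; congr (_, (_, _)) => /=.
  by rewrite opprD scalerN.
- move=> i j e; case: j / e => -[y [u x]] /=.
  rewrite /dgshift_d /ksign expr1 !scaleN1r.
  rewrite (eq_irrelevance (shift_deg1 1 erefl) erefl).
  rewrite !dgh_funN !dgm_dN opprD.
  congr (_, (_, _)) => //=.
  by rewrite opprD opprK.
- move=> i j l e z a; congr (_, (_, _)) => /=.
  by rewrite -dgm_actNl.
Defined.

End ConeSwapOut.

Lemma diso_cone_swap_out S T E (g : dghom S T) (q : dghom S E) :
  diso (dloc (cone_swap_out g q)).
Proof.
apply: (@diso_strict _ _ _ _ _ (cone_swap_out q g)).
  by move=> i [y [u x]] /=; rewrite opprK.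
by move=> i [y [u x]] /=; rewrite opprK.
Qed.

Section ThickClosure.
Variables (C : subcat A) (thC : is_thick C).

Lemma thick_iso X Y (f : dmor X Y) : diso f -> C X -> C Y.
Proof. by case: thC => _ H _ _ _; apply: H. Qed.
Lemma thick_shift n X : C X -> C (dgshift n X).
Proof. by case: thC => _ _ H _ _; apply: H. Qed.
Lemma thick_summand X Y : dsummand X Y -> C Y -> C X.
Proof. by case: thC => _ _ _ _ H; apply: H. Qed.
Lemma thick_acyclic X : acyclic X -> C X.
Proof. by case: thC => H _ _ _ _ /acyclic_id0/H. Qed.
Lemma thick_unshift n X : C (dgshift n X) -> C X.
Proof.
move/(@thick_shift (- n)); apply: thick_iso; exact: diso_unshift (addNr n) X.
Qed.

End ThickClosure.

(** The unit of the cell indexed by y maps to y itself. *)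
Lemma surj_top s m (I : Type) (z : I -> s m) (cz : forall i, cocyc (z i)) :
  (forall y, cocyc y -> exists i, z i = y) ->
  surj_at (dgsum_copair (fun i => twisted_point (cz i))) m.
Proof.
move=> zs y cy; have [i zi] := zs y cy.
have e : 0 = m + - m by rewrite subrr.
exists (dgprod_inj true (fun=> dgshift (- m) (dgreg A)) i m (one_at A e)).
  by apply: dgh_cocyc; apply/shift_cocyc; apply: d_one_at.
rewrite dgsum_copair_inj /= zi.
have e' : m + (m + - m) = m by rewrite subrr addr0.
rewrite (eq_irrelevance (twist_deg m m) e') act_one_at subrr.
exact: bound0.
Qed.

(** One cell for every cocycle, so that no generators of the cohomology have to be chosen. *)
Definition top_index s m := {z : s m | cocyc z}.
Definition top_cells s m : dgmod A :=
  dgprod true (fun _ : top_index s m => dgshift (- m) (dgreg A)).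
Definition top_map s m : dghom (top_cells s m) s :=
  dgsum_copair (fun z : top_index s m => twisted_point (proj2_sig z)).

Lemma surj_top_map s m : surj_at (top_map s m) m.
Proof. by apply: surj_top => y cy; exists (exist _ y cy). Qed.

Definition char_pred s m (chi : s m -> QZ) : Prop :=
  {morph chi : x y / x + y} /\ forall x, bound x -> chi x = 0.
(** All characters of [s m] modulo coboundaries; together they separate cohomology classes, which
    makes [bottom_map] injective on H^m. *)
Definition bottom_index s m := {chi : s m -> QZ | char_pred chi}.
Definition bottom_cells s m : dgmod A :=
  dgprod false (fun _ : bottom_index s m => dgshift (- m) (dgdual A)).
Definition bottom_map s m : dghom s (bottom_cells s m) :=
  dgprod_pair (fun chi : bottom_index s m =>
    char_map (proj1 (proj2_sig chi)) (proj2 (proj2_sig chi))).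

Lemma char_map_bound s m (chi : s m -> QZ) (chiD : {morph chi : x y / x + y})
    (chib : forall x, bound x -> chi x = 0) (x : s m) :
  bound (char_map chiD chib m x) -> chi x = 0.
Proof.
move=> /shift_bound b; have e : 0 = - (m + - m) by rewrite subrr oppr0.
by rewrite -(char_map_one chiD chib x e); apply: dual_bound_one.
Qed.

Lemma bound_chars s m (x : s m) :
  (forall chi : s m -> QZ, char_pred chi -> chi x = 0) -> bound x.
Proof.
move=> H; apply: contrapT => nb.
have [|y z|chi [chiD chib chix]] := @char_separate _ (@bound _ _ s m) x _ _ nb.
- exact: bound0.
- exact: boundB.
by apply: chix; apply: H.
Qed.

Lemma inj_bottom_map s m : inj_at (bottom_map s m) m.
Proof.
move=> x cx /dgprod_boundP b; apply: bound_chars => chi pchi.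
apply: (@char_map_bound s m chi (proj1 pchi) (proj2 pchi)).
exact: (b (exist _ chi pchi)).
Qed.

(** Each character of [s m] modulo coboundaries gives a map to the shifted dual, zero by hypothesis.
    Hence all of them kill every cocycle, and they separate classes. *)
Lemma dual_detect s m :
  dhom_zero s (dgshift (- m) (dgdual A)) -> cohom_zero_at s m.
Proof.
move=> z; apply/cohom_zeroP => x cx; apply: bound_chars => chi [chiD chib].
apply: (char_map_bound (chib := chib) (chiD := chiD)).
have /dloc_left[Y [l [ql h]]] := z (dloc (char_map chiD chib)).
have := homotopic_bound h cx; rewrite [X in _ - X]dgh_fun0 subr0 => b.
exact: (quasi_iso_inj ql (dgh_cocyc (char_map chiD chib) cx) b).
Qed.

(* The step from n to n.+1 kills the cohomology in degree m - n by attaching free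
   cells; the n-th entry is the map from t to the result. *)
Fixpoint resolution t m (n : nat) : {s & dghom t s} :=
  if n is n'.+1 then
    let p := resolution t m n' in
    Tagged (fun s => dghom t s)
      (dghom_comp (cone_in (top_map (tag p) (m - n'%:Z))) (tagged p))
  else Tagged (fun s => dghom t s) (dghom_id t).

(* Dually, each step kills the cohomology in degree m, and the result is shifted
   so that m stays the lowest degree; the n-th entry maps to t[1]...[1]. *)
Fixpoint coresolution t m (n : nat) : {s & dghom s (iter n (dgshift 1) t)} :=
  if n is n'.+1 then
    let p := coresolution t m n' in
    Tagged (fun s => dghom s (dgshift 1 (iter n' (dgshift 1) t)))
      (dghom_comp (dghom_shift 1 (tagged p)) (cone_out (bottom_map (tag p) m)))
  else Tagged (fun s => dghom s t) (dghom_id t).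

(** Attaching cells Q to the target of a map f replaces cone(f) by the cone of a map from Q to
    cone(f): the octahedral axiom, here the strict isomorphism [cone_swap]. *)
Lemma resolution_thick (C : subcat A) t m n :
  is_thick C -> (forall I, C (dgprod true (fun _ : I => dgreg A))) ->
  C (dgcone (tagged (resolution t m n))).
Proof.
move=> thC CG; elim: n => [|n IH] /=.
  exact/(thick_acyclic thC)/cone_acyclic/quasi_iso_id.
apply: (thick_iso thC (diso_cone_swap _ _)); apply: (thick_cone _ thC) => //.
apply: (thick_iso thC (diso_shift_prod _ _ _)); exact: thick_shift.
Qed.

(** Here the new cone is, by [cone_swap_out], the cone of a map from the old one to the shifted
    cofree cells. *)
Lemma coresolution_thick (C : subcat A) t m n :
  is_thick C -> (forall I, C (dgprod false (fun _ : I => dgdual A))) ->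
  C (dgcone (tagged (coresolution t m n))).
Proof.
move=> thC CG; elim: n => [|n IH] /=.
  exact/(thick_acyclic thC)/cone_acyclic/quasi_iso_id.
apply: (thick_iso thC (diso_cone_swap_out _ _)); apply: (thick_cone _ thC) => //.
apply: (thick_shift thC).
apply: (thick_iso thC (diso_shift_prod _ _ _)); exact: thick_shift.
Qed.

Lemma iter_shift1 n t :
  exists f : dmor (iter n (dgshift 1) t) (dgshift n%:Z t), diso f.
Proof.
elim: n => [|n [f df]] /=.
  by exists (dloc (reshift0 t)); apply: diso_strict (@reshift0K _ _ t) (@unshift0K _ _ t).
have e : 1 + n%:Z = n.+1%:Z by lia.
exists (dloc (shift_merge e t) \oD dshift 1 f).
by apply: diso_comp; [apply: diso_merge|apply: diso_dshift].
Qed.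

End Amplitude.

(** * The inclusions between the subcategories *)

Section Main.
Variables (k : comPzRingType) (A : dgalg k) (W : nat).
Hypothesis aA : amplitude (dgreg A) (- W%:Z) 0.
Implicit Types s t : dgmod A.

Lemma dual_amplitude : amplitude (dgdual A) 0 W%:Z.
Proof. by move=> i ir; apply/dual_cohom_zero/aA; lia. Qed.

(** Cells attached in degree m - n have cohomology in [m - n - W, m - n] and enter the cone one
    degree lower. This is the lower bound for n + 1. *)
Lemma resolution_amplitude t lo m n : amplitude t lo m ->
  amplitude (tag (resolution t m n)) (Num.min lo (m - n%:Z - W%:Z)) (m - n%:Z).
Proof.
move=> at_; elim: n => [|n IH] /=; first by move=> i ir; apply: at_; lia.
set s := tag _ in IH *; move=> i ir.
have aQ : amplitude (top_cells s (m - n%:Z)) (m - n%:Z - W%:Z) (m - n%:Z).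
  move=> j jr; apply: (amplitude_prod (fun=> amplitude_shift aA)); lia.
(* The top degree dies by surjectivity of [top_map]; the cells add nothing to it because they have
   no cohomology in degree m - n + 1. *)
have [->|im] := eqVneq i (m - n%:Z).
  apply: cone_cohom_zero; first exact: surj_top_map.
  by move=> x cx _; apply: (cohom_zero_bound (aQ (m - n%:Z + 1) _)) => //; lia.
by apply: (amplitude_cone IH aQ); lia.
Qed.

(** The condition on [hi] makes room for the cofree cells, which lie in [m, m + W], so that neither
    end of the interval moves. *)
Lemma coresolution_amplitude t m hi n : m + W%:Z <= hi -> amplitude t m hi ->
  amplitude (tag (coresolution t m n)) m hi.
Proof.
move=> mhi at_; elim: n => [|n IH] //=.
set s := tag _ in IH *; move=> i ir.
have aE : amplitude (bottom_cells s m) m (m + W%:Z).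
  move=> j jr; apply: (amplitude_prod (fun=> amplitude_shift dual_amplitude)); lia.
(* The copy of s[1] in the cone reaches down to degree m - 1, where injectivity of [bottom_map]
   kills it. *)
have [em|im] := eqVneq (i + 1) m; last by apply: (amplitude_cone aE IH); lia.
apply: cone_cohom_zero; last by rewrite em; apply: inj_bottom_map.
move=> y cy; exists 0; first exact: cocyc0.
by rewrite dgh_fun0 subr0; apply: (cohom_zero_bound (aE i _)) => //; lia.
Qed.

Lemma Tb_reg : Tb (dgreg A).
Proof. by apply/TbP/amplitudeP; exists (- W%:Z), 0. Qed.

Lemma Tb_dual : Tb (dgdual A).
Proof. apply/TbP/amplitudeP; exists 0, W%:Z; exact: dual_amplitude. Qed.

Lemma Tbp_bounded t : Tbp t -> cohom_bounded t.
Proof.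
move=> /(_ _ Tb_dual)[r rz]; exists (map -%R r) => n nr; apply/dual_detect/rz.
by apply: contra nr => nr; apply/mapP; exists (- n); rewrite ?opprK.
Qed.

Lemma Tbp_thick t (C : subcat A) : Tbp t -> is_thick C ->
  (forall I, C (dgprod true (fun _ : I => dgreg A))) -> C t.
Proof.
move=> tp thC CG; have [lo [m at_]] := (amplitudeP t).1 (Tbp_bounded tp).
pose s n := tag (resolution t m n); pose f n : dghom t (s n) := tagged (resolution t m n).
pose X n := dgshift (m - n%:Z) (s n).
have [|r rz] := tp (dgprod false X).
  (* After the shift by m - n the lower bound is the minimum of lo - m + n and - W, which only grows
     with n. *)
  apply/TbP/amplitudeP; exists (Num.min (lo - m) (- W%:Z)), 0.
  apply: amplitude_prod => n i ir.
  have /(_ i) := amplitude_shift (n := m - n%:Z) (resolution_amplitude (n := n) at_).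
  by apply; lia.
have [n nr] := fresh_nat r m.
have e : n%:Z - m + (m - n%:Z) = 0 by lia.
have f0 : dloc (f n) =D dzero _ _.
  (* [f n] is its composite with the inclusion and projection of the n-th factor, up to undoing the
     shift, and so passes through a map from t to Y[n - m]. *)
  pose i := dghom_shift (n%:Z - m) (dgprod_inj false X n).
  pose p := dghom_shift (n%:Z - m) (dgprod_proj false X n).
  have := rz _ nr (dloc (dghom_comp i (dghom_comp (reshift e (s n)) (f n)))).
  move/(deq_comp (deq_refl (dloc (dghom_comp (unshift e (s n)) p)))).
  rewrite dcomp0r -deq_loc_comp => <-; apply: dloc_eq => j x.
  rewrite -[LHS](reshiftK e) -[RHS]/(unshift e (s n) j (p j (i j _))).
  congr (dgh_fun (unshift e (s n)) _ _); symmetry.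
  exact: (@put_same _ _ _ X n _ _).
apply: (thick_unshift thC (n := 1)).
apply: (thick_summand thC (cone_split f0).1).
exact: resolution_thick.
Qed.

Lemma Tbi_thick t (C : subcat A) : Tbi t -> is_thick C ->
  (forall I, C (dgprod false (fun _ : I => dgdual A))) -> C t.
Proof.
move=> ti thC CG.
have [m [hi0 at0]] : exists lo hi, amplitude t lo hi.
  apply/amplitudeP; have [r rz] := ti _ Tb_reg; exists r => n /rz.
  by move/dhom_zero_reg_shift.
(* Room above m for the cofree cells. *)
pose hi := Num.max hi0 (m + W%:Z).
have at_ : amplitude t m hi by move=> i ir; apply: at0; lia.
pose s n := tag (coresolution t m n).
pose g n : dghom (s n) (iter n (dgshift 1) t) := tagged (coresolution t m n).
(* All [s n] lie in [m, hi] already, so their plain product is a test object. *)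
have [|r rz] := ti (dgprod false s).
  apply/TbP/amplitudeP; exists m, hi; apply: amplitude_prod => n.
  by apply: coresolution_amplitude => //; lia.
have [n] := fresh_nat r 0; rewrite subr0 => nr.
have [h dh] := iter_shift1 n t.
have g0 : dloc (g n) =D dzero _ _.
  apply: (diso_cancell dh); rewrite dcomp0r.
  have := rz _ nr (h \oD dloc (dghom_comp (g n) (dgprod_proj false s n))).
  move/deq_comp/(_ (deq_refl (dloc (dgprod_inj false s n)))).
  rewrite dcomp0l -dcompA -deq_loc_comp => <-; apply: deq_comp => //.
  apply: dloc_eq => i x /=; congr (g n i _); symmetry.
  exact: (@put_same _ _ _ s n _ _).
(* Here the summand of the cone is the target of [g n], a shift of t by n. *)
apply: (thick_unshift thC (n := n%:Z)); apply: (thick_iso thC dh).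
apply: (thick_summand thC (cone_split g0).2).
exact: coresolution_thick.
Qed.

Lemma thick_is_thick (X : subcat A) : is_thick (thick X).
Proof.
split.
- by move=> t t0 C thC _; case: thC => H _ _ _ _; apply: H.
- by move=> s t f df Ts C thC XC; apply: (thick_iso thC df); apply: Ts.
- by move=> n t Tt C thC XC; apply: (thick_shift thC); apply: Tt.
- move=> M N L u v w D TM TN C thC XC; case: (thC) => _ _ _ H _.
  by apply: H D _ _; [apply: TM|apply: TN].
- by move=> s t st Tt C thC XC; apply: (thick_summand thC st); apply: Tt.
Qed.

Lemma per_reg : per (dgreg A).
Proof. by move=> C _; apply. Qed.

Lemma Tbp_add t : Tbp t -> thick (Add (dgreg A)) t.
Proof.
move=> tp; apply: (Tbp_thick tp (thick_is_thick _)) => I C thC; apply.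
exists I, (dgprod true (fun _ : I => dgreg A)), (fun l => dloc (dgprod_inj true _ l)).
by split; [apply: dgsum_is_coproduct|apply: dsummand_refl].
Qed.

Lemma add_broad t : thick (Add (dgreg A)) t -> broad_sum (@per k A) t.
Proof.
move=> Tt C thC cC pC; apply: (Tt C thC) => x [I [S [inj [cS xS]]]].
apply: (thick_summand thC xS); apply: (cC _ _ _ _ cS); apply: pC.
exact: per_reg.
Qed.

(** Hom(A, y[n]) = H^n(y) vanishes for almost all n when y is bounded, so A is in [Tbp]; the closure
    properties give the rest. *)
Lemma broad_Tbp t : broad_sum (@per k A) t -> Tbp t.
Proof.
apply; first exact: bounded_left_thick.
  exact: bounded_left_coproduct.
move=> x; apply; first exact: bounded_left_thick.
move=> _ <- y /TbP[r rz]; exists r => n /rz.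
by move/dhom_zero_reg_shift.
Qed.

Lemma Tbi_prod t : Tbi t -> thick (Prod_dual (dgreg A)) t.
Proof.
move=> ti; apply: (Tbi_thick ti (thick_is_thick _)) => I C thC; apply.
exists (dgdual A); first exact: bc_dual_reg.
exists I, (dgprod false (fun _ : I => dgdual A)), (fun l => dloc (dgprod_proj false _ l)).
by split; [apply: dgprod_is_product|apply: dsummand_refl].
Qed.

Lemma prod_broad t : thick (Prod_dual (dgreg A)) t -> broad_prod (duals (@per k A)) t.
Proof.
move=> Tt C thC cC pC; apply: (Tt C thC) => x [M' MM' [I [P [proj [pP xP]]]]].
apply: (thick_summand thC xP); apply: (cC _ _ _ _ pP); apply: pC.
by exists (dgreg A) => //; apply: per_reg.
Qed.

Lemma bc_dual_zero t t' x : bc_dual t t' -> dhom_zero t x -> dhom_zero x t'.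
Proof.
case=> eta [eta_deq _ _ _] z f; apply/eta_deq => g.
by rewrite !(dchar_deq _ (z g)) !dchar_dzero.
Qed.

(** With c' the dual of c, Hom(x, c'[n]) is the character group of Hom(c, x[- n]). The latter is
    zero for almost all n when c = A, and this condition on c is thick, so it holds on [per]. *)
Lemma broad_Tbi t : broad_prod (duals (@per k A)) t -> Tbi t.
Proof.
apply; first exact: bounded_right_thick.
  exact: bounded_right_product.
move=> t' [c pc cc'] x /TbP[r0 rz0].
have [|_ <-|r rz] := pc (ev_zero_from x).
- exact: ev_zero_from_thick.
- by exists r0 => n /rz0 /dhom_zero_reg_shift.
exists (map -%R r) => n nr.
have e : n + - n = 0 by rewrite subrr.
apply/(dhom_zero_adj _ _ e); apply: bc_dual_zero cc' _; apply: rz.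
by apply: contra nr => nr; apply/mapP; exists (- n); rewrite ?opprK.
Qed.

End Main.

Theorem corollary3p16 (k : comPzRingType) (A : dgalg k)
  (A_connective : forall n : int, 0 < n -> cohom_zero_at (dgreg A) n)
  (A_bounded : exists r : seq int,
     forall n : int, n \notin r -> cohom_zero_at (dgreg A) n) :
  [/\ forall t : dgmod A, Tbp t <-> broad_sum (@per k A) t,
      forall t : dgmod A, broad_sum (@per k A) t <-> thick (Add (dgreg A)) t,
      forall t : dgmod A, Tbi t <-> broad_prod (duals (@per k A)) t
    & forall t : dgmod A,
        broad_prod (duals (@per k A)) t <-> thick (Prod_dual (dgreg A)) t].
Proof.
(* Connectivity puts the upper end at 0, and the absolute value of any lower bound serves as W. *)
have [W aA] : exists W : nat, amplitude (dgreg A) (- W%:Z) 0.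
  have [lo [hi aA]] := (amplitudeP _).1 A_bounded.
  exists `|lo|%N => i /orP[ilo|]; last exact: A_connective.
  by apply: aA; lia.
split=> t; split=> H.
- exact: add_broad (Tbp_add aA H).
- exact: broad_Tbp H.
- exact: Tbp_add aA _ (broad_Tbp H).
- exact: add_broad H.
- exact: prod_broad (Tbi_prod aA H).
- exact: broad_Tbi H.
- exact: Tbi_prod aA _ (broad_Tbi H).
- exact: prod_broad H.
Qed.
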